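(* Let $Y$ be a Banach space with a normalized 1-unconditional basis $(y_n)$ such that the sequence of bi-orthogonal functionals $(y_n^* )\subseteq Y^*$ satisfies properties $(\alpha)$ and $(\beta)$. Then the Sierpiński space contains an isomorphic copy of $Y$. In particular, the Sierpiński space contains an isomorphic copy of any reflexive Musielak--Orlicz sequence space. It follows that the Sierpiński space contains an isomorphic copy of every $\ell_p$, $1\le p<\infty$, and of $c_0$.
   Context: Sierpiński space. For a bijection $f:\mathbb{N}\to\mathbb{Q}$, let $\mathcal{C}_f$ be the family of all finite sets $F\subseteq\mathbb{N}$ on which $f$ is increasing. Let $\|x\|_f=\sup\{\sum_{i\in F}|x(i)|:F\in\mathcal{C}_f\}$ and $X_f=\{x\in\mathbb{R}^{\mathbb{N}}:\|x\cdot\chi_{[n,\infty)}\|_f\to0\}$ with norm $\|\cdot\|_f$. Up to isomorphism $X_f$ does not depend on $f$; it is called the Sierpiński space. Properties $(\alpha)$ and $(\beta)$ for a normalized 1-unconditional basic sequence $(u_n)$ (here $u_n=y_n^*$): let $\tilde B$ be the set of all finite linear combinations $\sum_na_nu_n$ of norm at most $1$, and for $x=\sum_na_nu_n$ let $\mathrm{supp}\,x=\{n:a_n\neq0\}$. For $x,y\in\tilde B$ write $x\mathrel{\dot\leqslant}y$ if for every $z\in\tilde B$ with $\min\mathrm{supp}\,z>\max\{\max\mathrm{supp}\,x,\max\mathrm{supp}\,y\}$, $y+z\in\tilde B$ implies $x+z\in\tilde B$. $(\alpha)$: for all $x,y\in\tilde B$, either $x\mathrel{\dot\leqslant}y$ or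 $y\mathrel{\dot\leqslant}x$. $(\beta)$: for all $x,y\in\tilde B$, $n\in\mathbb{N}$ with $\max\{\max\mathrm{supp}\,x,\max\mathrm{supp}\,y\}<n$, and $a,b\in[0,1]$: if $x+au_n\in\tilde B$, $y\mathrel{\dot\leqslant}x+au_n$ and $x+(a+b)u_n\in\tilde B$, then $y+bu_n\in\tilde B$ and $y+bu_n\mathrel{\dot\leqslant}x+(a+b)u_n$. Musielak--Orlicz spaces. Let $\Phi=(\phi_i)_{i\in\mathbb{N}}$ be a sequence of Orlicz functions: each $\phi_i:[0,\infty)\to[0,\infty]$ is convex, left-continuous, not identically zero on the set where it is finite, with $\phi_i(0)=0$, $\lim_{t\to\infty}\phi_i(t)=\infty$, and normalized by $\phi_i(1)=1$. For $x=(a_i)\in\mathbb{R}^{\mathbb{N}}$ let $I_\Phi(x)=\sum_i\phi_i(|a_i|)$. The Musielak--Orlicz sequence space is $\ell_\Phi=\{x\in\mathbb{R}^{\mathbb{N}}:I_\Phi(x/\rho)<\infty\text{ for some }\rho>0\}$ with norm $\|x\|_\Phi=\inf\{\rho>0:I_\Phi(x/\rho)\le1\}$. *)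

(* Defs.v *)
From HB Require Import structures.
From mathcomp Require Import all_boot all_order all_algebra finmap.
From mathcomp Require Import all_classical all_reals all_analysis.
From mathcomp Require Import ring.

Set Implicit Arguments.
Unset Strict Implicit.
Unset Printing Implicit Defensive.

Import Order.TTheory GRing.Theory Num.Theory.
Import numFieldNormedType.Exports.

Local Open Scope classical_set_scope.
Local Open Scope ring_scope.

(* A linear subspace of V carrying its own norm. Only the values of subnorm on
   the carrier matter. All concrete spaces below (the dual, the sequence spaces)
   are built from this record as subtypes that are normedModTypes. *)
Record normed_subspace (R : realType) (V : lmodType R) := NormedSubspace {
  carrier : set V;
  subnorm : V -> R;
  carrier0 : carrier 0;
  carrierD : forall x y, carrier x -> carrier y -> carrier (x + y);
  carrierZ : forall (l : R) x, carrier x -> carrier (l *: x);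
  subnormD : forall x y, carrier x -> carrier y ->
    subnorm (x + y) <= subnorm x + subnorm y;
  subnormZ : forall (l : R) x, carrier x ->
    subnorm (l *: x) = `|l| * subnorm x;
  subnorm0_eq0 : forall x, carrier x -> subnorm x = 0 -> x = 0
}.

Section SubspaceType.
Variables (R : realType) (V : lmodType R) (S : normed_subspace V).

Definition carrier_pred : {pred V} := fun x => x \in carrier S.

Lemma carrier_submod_closed : GRing.submod_closed carrier_pred.
Proof.
split; first by rewrite unfold_in; apply/mem_set; exact: carrier0.
move=> l x y; rewrite !unfold_in !inE => Sx Sy.
by apply: carrierD => //; exact: carrierZ.
Qed.

HB.instance Definition _ :=
  GRing.isSubmodClosed.Build R V carrier_pred carrier_submod_closed.

Record subspace_type : Type :=
  SubspaceElt { subspace_val : V; _ : subspace_val \in carrier_pred }.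

HB.instance Definition _ := [isSub for subspace_val].
HB.instance Definition _ := [Choice of subspace_type by <:].
HB.instance Definition _ := [SubChoice_isSubLmodule of subspace_type by <:].

Lemma subspace_carrier (x : subspace_type) : carrier S (val x).
Proof. by have := valP x; rewrite unfold_in inE. Qed.

Let norm_D (x y : subspace_type) :
  subnorm S (val (x + y)) <= subnorm S (val x) + subnorm S (val y).
Proof. exact: (subnormD (subspace_carrier x) (subspace_carrier y)). Qed.

Let norm_Z (l : R) (x : subspace_type) :
  subnorm S (val (l *: x)) = `|l| * subnorm S (val x).
Proof. exact: (subnormZ l (subspace_carrier x)). Qed.

Let norm_0 (x : subspace_type) : subnorm S (val x) = 0 -> x = 0.
Proof.
by move=> x0; apply: val_inj; exact: (subnorm0_eq0 (subspace_carrier x)).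
Qed.

HB.instance Definition _ :=
  Lmodule_isNormed.Build R subspace_type norm_D norm_Z norm_0.

End SubspaceType.

Section Homogeneity.
Variables (R : realType) (V : lmodType R) (C : set V) (N : V -> R).
Hypothesis CZ : forall (l : R) x, C x -> C (l *: x).
Hypothesis N_ge0 : forall x, C x -> 0 <= N x.
Hypothesis NZ_le : forall (l : R) x, C x -> N (l *: x) <= `|l| * N x.

Lemma homogeneity (l : R) x : C x -> N (l *: x) = `|l| * N x.
Proof.
move=> Cx; apply/eqP; rewrite eq_le NZ_le//=.
have [->|l0] := eqVneq l 0; first by rewrite normr0 mul0r; exact/N_ge0/CZ.
have := NZ_le l^-1 (CZ l Cx).
rewrite scalerA mulVf// scale1r normfV ler_pdivlMl ?normr_gt0//.
Qed.

End Homogeneity.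

Section Dual.
Variables (R : realType) (X : normedModType R).

Definition dual_carrier : set (X -> R) :=
  [set g | linear (g : X -> R^o) /\ continuous g].

Definition dual_norm (g : X -> R) : R :=
  sup [set `|g x| | x in [set x : X | `|x| <= 1]].

Lemma dual_carrierP g : dual_carrier g ->
  exists2 M, 0 <= M & forall x, `|g x| <= M * `|x|.
Proof.
move=> [gl gc].
pose gL : {linear X -> R^o} := HB.pack g (GRing.isLinear.Build R X R^o *:%R g gl).
have /linear_boundedP/pinfty_ex_gt0[M M0 gM] := @continuous_linear_bounded _ _ _ 0 gL (gc 0).
by exists M => //; exact: ltW.
Qed.

Lemma dual_norm_has_sup g : dual_carrier g ->
  has_sup [set `|g x| | x in [set x : X | `|x| <= 1]].
Proof.
move=> /dual_carrierP[M M0 gM]; split.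
  by exists `|g 0|; exists 0 => //=; rewrite normr0.
by exists M => _ [x /= x1 <-]; rewrite (le_trans (gM x))// ler_piMr.
Qed.

Lemma dual_normP g x : dual_carrier g -> `|x| <= 1 -> `|g x| <= dual_norm g.
Proof.
by move=> /dual_norm_has_sup[_ gub] x1; apply: ub_le_sup => //; exists x.
Qed.

Lemma dual_norm_le g M : dual_carrier g ->
  (forall x, `|x| <= 1 -> `|g x| <= M) -> dual_norm g <= M.
Proof.
move=> /dual_norm_has_sup[g0 _] gM.
by apply: ge_sup => // _ [x x1 <-]; exact: gM.
Qed.

Lemma dual_norm_ge0 g : dual_carrier g -> 0 <= dual_norm g.
Proof.
move=> gd; apply: (le_trans (normr_ge0 (g 0))); apply: dual_normP => //.
by rewrite normr0.
Qed.

Lemma dual_carrier0 : dual_carrier 0.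
Proof.
split; first by move=> l x y; rewrite /= scaler0 addr0.
exact: (@cst_continuous X R 0).
Qed.

Lemma dual_carrierD g h : dual_carrier g -> dual_carrier h ->
  dual_carrier (g + h).
Proof.
move=> [gl gc] [hl hc]; split.
  move=> l x y; change (g (l *: x + y) + h (l *: x + y) =
    l * (g x + h x) + (g y + h y)).
  by rewrite (gl l x y) (hl l x y) mulrDr addrACA.
by move=> x; apply: (@continuousD _ _ _ g h); [exact: gc|exact: hc].
Qed.

Lemma dual_carrierZ (l : R) g : dual_carrier g -> dual_carrier (l *: g).
Proof.
move=> [gl gc]; split.
  move=> k x y; change (l * g (k *: x + y) = k * (l * g x) + l * g y).
  by rewrite (gl k x y) mulrDr mulrCA.
by move=> x; apply: (@continuousM _ _ (cst l) g); [exact: cst_continuous|exact: gc].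
Qed.

Lemma dual_normD g h : dual_carrier g -> dual_carrier h ->
  dual_norm (g + h) <= dual_norm g + dual_norm h.
Proof.
move=> gd hd; apply: dual_norm_le; first exact: dual_carrierD.
move=> x x1; rewrite (le_trans (ler_normD _ _))// lerD//; exact: dual_normP.
Qed.

Lemma dual_normZ (l : R) g : dual_carrier g ->
  dual_norm (l *: g) = `|l| * dual_norm g.
Proof.
apply: homogeneity l g; [exact: dual_carrierZ|exact: dual_norm_ge0|].
move=> l g gd; apply: dual_norm_le; first exact: dual_carrierZ.
by move=> x x1; rewrite normrM ler_wpM2l//; exact: dual_normP.
Qed.

Lemma dual_norm0_eq0 g : dual_carrier g -> dual_norm g = 0 -> g = 0.
Proof.
move=> gd g0; apply/funext => x; apply/eqP.
have [M _ gM] := dual_carrierP gd.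
have gz : g 0 = 0.
  by apply/eqP; have := gM 0; rewrite normr0 mulr0 normr_le0.
have [->|x0] := eqVneq x 0; first by rewrite gz.
have x1 : `|(`|x|^-1 *: x)| <= 1.
  by rewrite normrZ normfV normr_id mulVf// normr_eq0.
have := dual_normP gd x1; rewrite g0 normr_le0.
rewrite -[_ *: x]addr0 (gd.1 _ x 0) gz addr0 mulf_eq0 invr_eq0 normr_eq0.
by rewrite (negbTE x0).
Qed.

Definition dual_subspace : normed_subspace (X -> R) :=
  NormedSubspace dual_carrier0 dual_carrierD dual_carrierZ
    dual_normD dual_normZ dual_norm0_eq0.

Definition dual : Type := subspace_type dual_subspace.

HB.instance Definition _ := NormedModule.on dual.

Definition dual_apply (g : dual) : X -> R := subspace_val g.

End Dual.

Coercion dual_apply : dual >-> Funclass.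

(* The canonical embedding of X into its bidual is onto. *)
Definition reflexive_space (R : realType) (X : normedModType R) : Prop :=
  forall Psi : dual (dual X), exists x : X, forall g : dual X, Psi g = g x.

(* An isomorphism of Y onto a subspace of X: a bounded linear map that is
   bounded below. *)
Definition contains_copy (R : realType) (X Y : normedModType R) : Prop :=
  exists2 T : {linear Y -> X}, continuous T &
    exists2 c : R, 0 < c & forall y, c * `|y| <= `|T y|.

Section Bases.
Variables (R : realType) (V : normedModType R).
Implicit Types (u : nat -> V) (x y z : V) (a : nat -> R).

Definition normalized u : Prop := forall n, `|u n| = 1.

Definition schauder_basis u : Prop :=
  forall x, exists! a, series (fun n => a n *: u n) @ \oo --> x.

(* Unconditional constant 1: changes of sign preserve the norm of finite linear
   combinations. *)
Definition one_unconditional u : Prop :=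
  forall (n : nat) a (eps : nat -> bool),
    `|\sum_(i < n) ((-1) ^+ eps i * a i) *: u i| = `|\sum_(i < n) a i *: u i|.

(* x is the finite linear combination of the u n with coefficients a. *)
Definition expansion u a x : Prop :=
  finite_set [set n | a n != 0] /\ x = \sum_(n \in [set: nat]) a n *: u n.

Definition fin_ball u : set V :=
  [set x | (exists a, expansion u a x) /\ `|x| <= 1].

Definition supp u x : set nat :=
  [set n | exists2 a, expansion u a x & a n != 0].

(* The hypothesis on the supports says min (supp z) > max (supp x U supp y); it
   is void when one side is empty (min of the empty set is +oo, max is -oo). *)
Definition dot_le u x y : Prop :=
  forall z, fin_ball u z ->
    (forall i j, (supp u x `|` supp u y) i -> supp u z j -> (i < j)%N) ->
    fin_ball u (y + z) -> fin_ball u (x + z).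

Definition property_alpha u : Prop :=
  forall x y, fin_ball u x -> fin_ball u y -> dot_le u x y \/ dot_le u y x.

Definition property_beta u : Prop :=
  forall x y (n : nat) (a b : R), fin_ball u x -> fin_ball u y ->
    (forall i, (supp u x `|` supp u y) i -> (i < n)%N) ->
    0 <= a <= 1 -> 0 <= b <= 1 ->
    fin_ball u (x + a *: u n) -> dot_le u y (x + a *: u n) ->
    fin_ball u (x + (a + b) *: u n) ->
    fin_ball u (y + b *: u n) /\ dot_le u (y + b *: u n) (x + (a + b) *: u n).

End Bases.

Definition biorthogonal (R : realType) (Y : normedModType R)
    (y : nat -> Y) (ystar : nat -> dual Y) : Prop :=
  forall n m, ystar n (y m) = (n == m)%:R.

Section Sierpinski.
Variables (R : realType) (f : nat -> rat).
Implicit Types x y : nat -> R.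

Definition increasing_sets : set {fset nat} :=
  [set F : {fset nat} | {in F &, {homo f : i j / (i < j)%N >-> i < j}}].

Definition sierpinski_enorm x : \bar R :=
  ereal_sup [set (\sum_(i <- F) `|x i|)%:E | F in increasing_sets].

(* x times the indicator function of [n, +oo[. *)
Definition tail (n : nat) x : nat -> R := fun i => if (n <= i)%N then x i else 0.

Definition sierpinski_carrier : set (nat -> R) :=
  [set x | sierpinski_enorm (tail n x) @[n --> \oo] --> 0%E].

Definition sierpinski_norm x : R := fine (sierpinski_enorm x).

Local Notation N := sierpinski_enorm.

Lemma sierpinski_enorm_ub x F : increasing_sets F ->
  ((\sum_(i <- F) `|x i|)%:E <= N x)%E.
Proof. by move=> iF; apply: ereal_sup_ubound; exists F. Qed.

Lemma sierpinski_enorm_le x M :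
  (forall F, increasing_sets F -> (\sum_(i <- F) `|x i|)%:E <= M)%E -> (N x <= M)%E.
Proof. by move=> xM; apply: ge_ereal_sup => _ [F iF <-]; exact: xM. Qed.

Lemma sierpinski_enorm_ge0 x : (0 <= N x)%E.
Proof.
have i0 : increasing_sets fset0 by move=> i j; rewrite inE.
by apply: le_trans (sierpinski_enorm_ub x i0); rewrite big_seq_fset0.
Qed.

Lemma sierpinski_enormD x y : (N (x + y)%R <= N x + N y)%E.
Proof.
apply: sierpinski_enorm_le => F iF.
apply: le_trans (leeD (sierpinski_enorm_ub x iF) (sierpinski_enorm_ub y iF)).
by rewrite -EFinD lee_fin -big_split/= ler_sum// => i _; exact: ler_normD.
Qed.

Lemma sierpinski_enormZ (l : R) x : (N (l *: x)%R <= `|l|%:E * N x)%E.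
Proof.
apply: sierpinski_enorm_le => F iF.
have -> : (\sum_(i <- F) `|(l *: x) i|)%:E =
    (`|l|%:E * (\sum_(i <- F) `|x i|)%:E)%E.
  by rewrite -EFinM mulr_sumr; congr EFin; apply: eq_bigr => i _; rewrite normrM.
apply: lee_pmul; rewrite ?lee_fin ?sumr_ge0//; exact: sierpinski_enorm_ub.
Qed.

Lemma sierpinski_enorm_coord x i : (`|x i|%:E <= N x)%E.
Proof.
have iF : increasing_sets [fset i]%fset.
  by move=> j k; rewrite !inE => /eqP -> /eqP ->; rewrite ltnn.
by apply: le_trans (sierpinski_enorm_ub x iF); rewrite big_seq_fset1.
Qed.

Lemma sierpinski_enorm_fin x : sierpinski_carrier x -> N x \is a fin_num.
Proof.
move=> xC; rewrite ge0_fin_numE ?sierpinski_enorm_ge0//.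
have [n _ /(_ n (leqnn n)) /= xn] : \forall n \near \oo, (N (tail n x) < 1)%E.
  have nb : nbhs 0%E [set z : \bar R | (z < 1)%E] by apply: open_ereal_lt'; exact: lte01.
  exact: (xC _ nb).
have -> : x = (x - tail n x) + tail n x by rewrite subrK.
apply: le_lt_trans (sierpinski_enormD _ _) _.
apply: lte_add_pinfty; last exact: lt_trans xn (ltry 1).
suff : (N (x - tail n x)%R <= (\sum_(i < n) `|x i|)%:E)%E.
  by move=> /le_lt_trans; apply; exact: ltry.
apply: sierpinski_enorm_le => F _; rewrite lee_fin.
have e i : (x - tail n x) i = if (i < n)%N then x i else 0.
  rewrite -[LHS]/(x i - tail n x i) /tail leqNgt.
  by case: (i < n)%N; rewrite /= ?subrr ?subr0.
have -> : \sum_(i <- F) `|(x - tail n x) i| = \sum_(i <- F | (i < n)%N) `|x i|.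
  rewrite [RHS]big_mkcond/=; apply: eq_bigr => i _.
  by rewrite e; case: ifP; rewrite ?normr0.
rewrite -big_filter (perm_big [seq i <- index_iota 0 n | i \in F]); last first.
  apply: uniq_perm; rewrite ?filter_uniq ?iota_uniq ?fset_uniq// => i.
  by rewrite !mem_filter mem_index_iota /= andbC.
rewrite big_filter -(big_mkord xpredT (fun i => `|x i|)) big_mkcond/=.
by apply: ler_sum => i _; case: ifP.
Qed.

Lemma tailD n x y : tail n (x + y) = tail n x + tail n y.
Proof.
apply/funext => i; rewrite -[RHS]/(tail n x i + tail n y i) /tail.
by case: ifP; rewrite ?addr0.
Qed.

Lemma tailZ n (l : R) x : tail n (l *: x) = l *: tail n x.
Proof.
apply/funext => i; rewrite -[RHS]/(l * tail n x i) /tail.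
by case: ifP; rewrite ?mulr0.
Qed.

Lemma sierpinski_carrier0 : sierpinski_carrier 0.
Proof.
suff e n : N (tail n 0) = 0%E.
  by rewrite /sierpinski_carrier/= (funext e); exact: cvg_cst.
have -> : tail n 0 = 0 by apply/funext => i; rewrite /tail; case: ifP.
apply/eqP; rewrite eq_le sierpinski_enorm_ge0 andbT.
by apply: sierpinski_enorm_le => F _; rewrite big1// => i _; rewrite normr0.
Qed.

Lemma sierpinski_carrierD x y : sierpinski_carrier x -> sierpinski_carrier y ->
  sierpinski_carrier (x + y).
Proof.
move=> xC yC.
have xyC : (N (tail n x) + N (tail n y))%E @[n --> \oo] --> 0%E.
  by rewrite -[X in _ --> X]adde0; apply: cvgeD.
apply: squeeze_cvge (cvg_cst 0%E) xyC; apply: nearW => n.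
by rewrite sierpinski_enorm_ge0 tailD sierpinski_enormD.
Qed.

Lemma sierpinski_carrierZ (l : R) x :
  sierpinski_carrier x -> sierpinski_carrier (l *: x).
Proof.
move=> xC.
have lxC : (`|l|%:E * N (tail n x))%E @[n --> \oo] --> 0%E.
  by rewrite -[X in _ --> X](mule0 `|l|%:E); apply: cvgeZl.
apply: squeeze_cvge (cvg_cst 0%E) lxC; apply: nearW => n.
by rewrite sierpinski_enorm_ge0 tailZ sierpinski_enormZ.
Qed.

Lemma sierpinski_normE x : sierpinski_carrier x ->
  (sierpinski_norm x)%:E = N x.
Proof. by move=> xC; rewrite fineK// sierpinski_enorm_fin. Qed.

Lemma sierpinski_normD x y : sierpinski_carrier x -> sierpinski_carrier y ->
  sierpinski_norm (x + y) <= sierpinski_norm x + sierpinski_norm y.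
Proof.
move=> xC yC; rewrite -lee_fin EFinD !sierpinski_normE ?sierpinski_enormD//.
exact: sierpinski_carrierD.
Qed.

Lemma sierpinski_normZ (l : R) x : sierpinski_carrier x ->
  sierpinski_norm (l *: x) = `|l| * sierpinski_norm x.
Proof.
apply: homogeneity l x; first exact: sierpinski_carrierZ.
  by move=> x _; rewrite fine_ge0 ?sierpinski_enorm_ge0.
move=> l x xC; rewrite -lee_fin EFinM !sierpinski_normE ?sierpinski_enormZ//.
exact: sierpinski_carrierZ.
Qed.

Lemma sierpinski_norm0_eq0 x : sierpinski_carrier x ->
  sierpinski_norm x = 0 -> x = 0.
Proof.
move=> xC x0; apply/funext => i; apply/eqP; rewrite -normr_le0 -lee_fin -x0.
by rewrite sierpinski_normE// sierpinski_enorm_coord.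
Qed.

Definition sierpinski_space : Type := subspace_type (NormedSubspace
  sierpinski_carrier0 sierpinski_carrierD sierpinski_carrierZ
  sierpinski_normD sierpinski_normZ sierpinski_norm0_eq0).

HB.instance Definition _ := NormedModule.on sierpinski_space.

End Sierpinski.

Section MusielakOrlicz.
Variable R : realType.

(* phi is only relevant on [0, +oo[. Convexity uses the convention 0 * +oo = 0. *)
Definition orlicz_function (phi : R -> \bar R) : Prop :=
  [/\ forall t : R, 0 <= t -> (0 <= phi t)%E,
      forall s t l : R, 0 <= s -> 0 <= t -> 0 <= l <= 1 ->
        (phi (l * s + (1 - l) * t)%R <= l%:E * phi s + (1 - l)%:E * phi t)%E,
      forall t : R, 0 < t -> phi s @[s --> t^'-] --> phi t,
      exists t : R, [/\ 0 <= t, (phi t < +oo)%E & phi t != 0%E] &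
      [/\ phi 0 = 0%E, phi t @[t --> +oo] --> +oo%E & phi 1 = 1%E]].

Variables (Phi : nat -> R -> \bar R).
Implicit Types x y : nat -> R.

Definition modular x : \bar R := \sum_(0 <= i <oo) Phi i `|x i|.

Definition musielak_orlicz_carrier : set (nat -> R) :=
  [set x | exists2 rho : R, 0 < rho & (modular (rho^-1 *: x) < +oo)%E].

Definition musielak_orlicz_norm x : R :=
  inf [set rho : R | 0 < rho /\ (modular (rho^-1 *: x) <= 1)%E].

Hypothesis PhiO : forall i, orlicz_function (Phi i).

Local Notation I := modular.
Local Notation C := musielak_orlicz_carrier.
Local Notation N := musielak_orlicz_norm.

Lemma orlicz_ge0 i t : 0 <= t -> (0 <= Phi i t)%E.
Proof. by case: (PhiO i) => + _ _ _ _; exact. Qed.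

Lemma orlicz_scale_le i l t : 0 <= t -> 0 <= l <= 1 ->
  (Phi i (l * t)%R <= l%:E * Phi i t)%E.
Proof.
move=> t0 l01; have [_ /(_ t 0 l t0 (lexx _) l01) + _ _ [e _ _]] := PhiO i.
by rewrite mulr0 addr0 e mule0 adde0.
Qed.

Lemma orlicz_le i s t : 0 <= s -> s <= t -> (Phi i s <= Phi i t)%E.
Proof.
move=> s0 st; have [t0|t0] := leP t 0.
  by rewrite (_ : s = t)//; apply/eqP; rewrite eq_le st (le_trans t0).
have -> : s = s / t * t by rewrite divfK// gt_eqF.
have st01 : 0 <= s / t <= 1.
  by rewrite (divr_ge0 s0 (ltW t0))/= ler_pdivrMr// mul1r.
apply: le_trans (orlicz_scale_le _ (ltW t0) st01) _.
rewrite -[leRHS]mul1e; apply: lee_pmul => //; rewrite ?lee_fin.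
- by case/andP: st01.
- exact/orlicz_ge0/ltW.
- by case/andP: st01.
Qed.

Lemma modular_ge0 x : (0 <= I x)%E.
Proof. by apply: nneseries_ge0 => i _ _; exact: orlicz_ge0. Qed.

Lemma modular0 : I 0 = 0%E.
Proof.
rewrite /I eseries0// => i _ _; rewrite normr0.
by case: (PhiO i) => _ _ _ _ [].
Qed.

Lemma modular_scale_le l x : 0 <= l <= 1 -> (I (l *: x)%R <= l%:E * I x)%E.
Proof.
move=> l01; rewrite -nneseriesZl; last by move=> i _; exact: orlicz_ge0.
apply: lee_nneseries => [i _ _|i _]; first exact: orlicz_ge0.
rewrite normrM ger0_norm; last by case/andP: l01.
exact: orlicz_scale_le.
Qed.

Lemma modular_convex l x y : 0 <= l <= 1 ->
  (I (l *: x + (1 - l) *: y)%R <= l%:E * I x + (1 - l)%:E * I y)%E.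
Proof.
move=> l01; have [l0 l1] := andP l01.
rewrite -!nneseriesZl//; try by move=> i _; exact: orlicz_ge0.
rewrite -nneseriesD; first last.
- by move=> i _ _; rewrite mule_ge0 ?lee_fin ?subr_ge0 ?orlicz_ge0.
- by move=> i _ _; rewrite mule_ge0 ?lee_fin ?orlicz_ge0.
apply: lee_nneseries => [i _ _|i _]; first exact: orlicz_ge0.
have [_ /(_ `|x i| `|y i| l (normr_ge0 _) (normr_ge0 _) l01) + _ _ _] := PhiO i.
apply: le_trans; apply: orlicz_le => //.
rewrite (le_trans (ler_normD _ _))// !normrM (ger0_norm l0).
by rewrite (@ger0_norm _ (1 - l))// subr_ge0.
Qed.

Lemma modular_add (a b : R) x y : 0 < a -> 0 < b ->
  (I ((a + b)^-1 *: (x + y))%R <=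
    (a / (a + b))%:E * I (a^-1 *: x)%R + (b / (a + b))%:E * I (b^-1 *: y)%R)%E.
Proof.
move=> a0 b0; have ab0 : 0 < a + b by exact: addr_gt0.
have e : 1 - a / (a + b) = b / (a + b) by field; rewrite gt_eqF.
have -> : (a + b)^-1 *: (x + y) =
    (a / (a + b)) *: (a^-1 *: x) + (1 - a / (a + b)) *: (b^-1 *: y).
  rewrite e !scalerA scalerDr; congr (_ *: _ + _ *: _); field.
    by rewrite !gt_eqF.
  by rewrite !gt_eqF.
rewrite -e; apply: modular_convex.
by rewrite (divr_ge0 (ltW a0) (ltW ab0))/= ler_pdivrMr// mul1r lerDl ltW.
Qed.

Lemma modular_normZ (l a : R) x : l != 0 ->
  I ((`|l| * a)^-1 *: (l *: x)) = I (a^-1 *: x).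
Proof.
move=> l0; rewrite scalerA; apply: eq_eseriesr => i _; congr (Phi i _).
change (`|(`|l| * a)^-1 * l * x i| = `|a^-1 * x i|).
rewrite invfM !normrM !normfV normr_id.
by rewrite (mulrAC `|l|^-1) mulVf ?normr_eq0// mul1r.
Qed.

Lemma musielak_orlicz_nonempty x : C x ->
  [set rho : R | 0 < rho /\ (I (rho^-1 *: x) <= 1)%E] !=set0.
Proof.
move=> [rho rho0 Ix]; set M := fine (I (rho^-1 *: x)).
have M0 : 0 <= M by rewrite fine_ge0// modular_ge0.
have M10 : 0 < M + 1 by rewrite ltr_wpDl.
exists ((M + 1) * rho); split; first exact: mulr_gt0.
rewrite invfM -scalerA.
have M01 : 0 <= (M + 1)^-1 <= 1.
  by rewrite invr_ge0 (ltW M10)/= invf_le1// lerDr.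
apply: le_trans (modular_scale_le _ M01) _.
rewrite -(@fineK _ (I _)) ?ge0_fin_numE ?modular_ge0// -/M -EFinM lee_fin.
by rewrite ler_pdivrMl// mulr1 lerDl.
Qed.

Lemma musielak_orlicz_lbound x :
  has_lbound [set rho : R | 0 < rho /\ (I (rho^-1 *: x) <= 1)%E].
Proof. by exists 0 => r [/ltW]. Qed.

Lemma musielak_orlicz_le x rho : 0 < rho -> (I (rho^-1 *: x) <= 1)%E ->
  N x <= rho.
Proof. by move=> r0 xr; apply: ge_inf => //; exact: musielak_orlicz_lbound. Qed.

Lemma musielak_orlicz_ge x M : C x ->
  (forall rho, 0 < rho -> (I (rho^-1 *: x) <= 1)%E -> M <= rho) -> M <= N x.
Proof.
move=> xC xM; apply: lb_le_inf; first exact: musielak_orlicz_nonempty.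
by move=> r [r0 /xM]; exact.
Qed.

Lemma musielak_orlicz_carrier0 : C 0.
Proof. by exists 1 => //; rewrite scaler0 modular0. Qed.

Lemma musielak_orlicz_carrierD x y : C x -> C y -> C (x + y).
Proof.
move=> [a a0 xa] [b b0 yb]; exists (a + b); first exact: addr_gt0.
apply: le_lt_trans (modular_add _ _ a0 b0) _.
have ab0 : 0 < a + b by exact: addr_gt0.
by apply: lte_add_pinfty; apply: lte_mul_pinfty;
  rewrite ?lee_fin ?divr_ge0 ?ltW.
Qed.

Lemma musielak_orlicz_carrierZ (l : R) x : C x -> C (l *: x).
Proof.
move=> [a a0 xa]; have [->|l0] := eqVneq l 0.
  by rewrite scale0r; exact: musielak_orlicz_carrier0.
by exists (`|l| * a); [rewrite mulr_gt0// normr_gt0|rewrite modular_normZ].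
Qed.

Lemma musielak_orlicz_norm_ge0 x : C x -> 0 <= N x.
Proof. by move=> xC; apply: musielak_orlicz_ge => // r /ltW. Qed.

Lemma musielak_orlicz_normD x y : C x -> C y -> N (x + y) <= N x + N y.
Proof.
move=> xC yC; rewrite -lerBlDr; apply: musielak_orlicz_ge => // a a0 xa.
rewrite lerBlDr -lerBlDl; apply: musielak_orlicz_ge => // b b0 yb.
rewrite lerBlDl; have ab0 : 0 < a + b by exact: addr_gt0.
apply: musielak_orlicz_le => //; apply: le_trans (modular_add _ _ a0 b0) _.
have -> : 1%E = ((a / (a + b))%:E * 1 + (b / (a + b))%:E * 1)%E :> \bar R.
  by rewrite !mule1 -EFinD -mulrDl divff// gt_eqF.
by apply: leeD; apply: lee_pmul; rewrite ?modular_ge0 ?lee_fin ?divr_ge0// ltW.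
Qed.

Lemma musielak_orlicz_normZ (l : R) x : C x -> N (l *: x) = `|l| * N x.
Proof.
apply: homogeneity l x; first exact: musielak_orlicz_carrierZ.
  exact: musielak_orlicz_norm_ge0.
move=> l x xC; have [->|l0] := eqVneq l 0.
  rewrite normr0 mul0r scale0r; apply/ler_addgt0Pl => e e0; rewrite addr0.
  by apply: musielak_orlicz_le => //; rewrite scaler0 modular0.
rewrite -ler_pdivrMl ?normr_gt0//; apply: musielak_orlicz_ge => // a a0 xa.
rewrite ler_pdivrMl ?normr_gt0//; apply: musielak_orlicz_le.
  by rewrite mulr_gt0// normr_gt0.
by rewrite modular_normZ.
Qed.

Lemma musielak_orlicz_coord x i : C x -> `|x i| <= N x.
Proof.
move=> xC; apply: musielak_orlicz_ge => // a a0 xa; rewrite leNgt; apply/negP => ax.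
set t := `|(a^-1 *: x) i|.
have t1 : 1 < t.
  by rewrite /t normrM normfV (gtr0_norm a0) mulrC ltr_pdivlMr// mul1r.
have t0 : 0 < t by exact: lt_trans t1.
have It : (Phi i t <= 1)%E.
  apply: le_trans xa; rewrite /I (nneseriesD1 (n := i))//; last first.
    by move=> k _; exact: orlicz_ge0.
  by rewrite leeDl// nneseries_ge0// => k _ _; exact: orlicz_ge0.
have ti01 : 0 <= t^-1 <= 1 by rewrite invr_ge0 (ltW t0)/= invf_le1// ltW.
have := orlicz_scale_le i (ltW t0) ti01.
rewrite mulVf ?gt_eqF//; have [_ _ _ _ [_ _ ->]] := PhiO i.
apply/negP; rewrite -ltNge; apply: (@le_lt_trans _ _ (t^-1%:E * 1)%E).
  apply: lee_pmul => //; [|exact/orlicz_ge0/ltW].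
  by rewrite lee_fin invr_ge0 ltW.
by rewrite mule1 lte_fin invf_lt1.
Qed.

Lemma musielak_orlicz_norm0_eq0 x : C x -> N x = 0 -> x = 0.
Proof.
move=> xC x0; apply/funext => i; apply/eqP; rewrite -normr_le0 -x0.
exact: musielak_orlicz_coord.
Qed.

Definition musielak_orlicz_space : Type := subspace_type (NormedSubspace
  musielak_orlicz_carrier0 musielak_orlicz_carrierD musielak_orlicz_carrierZ
  musielak_orlicz_normD musielak_orlicz_normZ musielak_orlicz_norm0_eq0).

HB.instance Definition _ := NormedModule.on musielak_orlicz_space.

End MusielakOrlicz.

Section Ellp.
Variables (R : realType) (p : R).
Implicit Types x y : nat -> R.

Definition ellp_enorm x : \bar R :=
  ((\sum_(0 <= i <oo) (`|x i| `^ p)%:E) `^ p^-1)%E.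

Definition ellp_carrier : set (nat -> R) :=
  [set x | (\sum_(0 <= i <oo) (`|x i| `^ p)%:E < +oo)%E].

Definition ellp_norm x : R := fine (ellp_enorm x).

Hypothesis p1 : 1 <= p.

Let p0 : 0 < p. Proof. exact: lt_le_trans p1. Qed.

Local Notation N := ellp_enorm.

Lemma ellp_enormE x : N x = ('N[@counting nat R]_p%:E[EFin \o x])%E.
Proof. by rewrite Lnorm_counting. Qed.

Lemma ellp_sum_ge0 x : (0 <= \sum_(0 <= i <oo) (`|x i| `^ p)%:E)%E.
Proof. by apply: nneseries_ge0 => i _ _; rewrite lee_fin powR_ge0. Qed.

Lemma ellp_carrierE x : ellp_carrier x <-> (N x < +oo)%E.
Proof.
split=> [xC|]; first exact: poweR_lty.
rewrite /ellp_carrier/= /N => xN; rewrite ltey; apply/eqP => xoo.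
by move: xN; rewrite xoo poweRyr ?invr_eq0 ?gt_eqF// ltxx.
Qed.

Lemma ellp_enormD x y : (N (x + y)%R <= N x + N y)%E.
Proof. by rewrite !ellp_enormE; apply: eminkowski. Qed.

Lemma ellp_enormZ (l : R) x : N (l *: x) = (`|l|%:E * N x)%E.
Proof.
rewrite /N; under eq_eseriesr do rewrite normrM powRM// EFinM.
rewrite nneseriesZl; last by move=> i _; rewrite lee_fin powR_ge0.
rewrite poweRM ?ellp_sum_ge0 ?lee_fin ?powR_ge0//; congr (_ * _)%E.
by rewrite poweR_EFin -powRrM divff ?gt_eqF// powRr1.
Qed.

Lemma ellp_normE x : ellp_carrier x -> (ellp_norm x)%:E = N x.
Proof.
by move=> /ellp_carrierE xC; rewrite fineK// ge0_fin_numE// poweR_ge0.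
Qed.

Lemma ellp_carrier0 : ellp_carrier 0.
Proof.
by rewrite /ellp_carrier/= eseries0// => i _ _; rewrite normr0 powR0// gt_eqF.
Qed.

Lemma ellp_carrierD x y : ellp_carrier x -> ellp_carrier y -> ellp_carrier (x + y).
Proof.
move=> /ellp_carrierE xC /ellp_carrierE yC; apply/ellp_carrierE.
by apply: le_lt_trans (ellp_enormD _ _) _; exact: lte_add_pinfty.
Qed.

Lemma ellp_carrierZ (l : R) x : ellp_carrier x -> ellp_carrier (l *: x).
Proof.
move=> /ellp_carrierE xC; apply/ellp_carrierE; rewrite ellp_enormZ.
by apply: lte_mul_pinfty; rewrite ?lee_fin.
Qed.

Lemma ellp_normD x y : ellp_carrier x -> ellp_carrier y ->
  ellp_norm (x + y) <= ellp_norm x + ellp_norm y.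
Proof.
move=> xC yC; rewrite -lee_fin EFinD !ellp_normE ?ellp_enormD//.
exact: ellp_carrierD.
Qed.

Lemma ellp_normZ (l : R) x : ellp_carrier x ->
  ellp_norm (l *: x) = `|l| * ellp_norm x.
Proof.
move=> xC; apply: EFin_inj; rewrite EFinM !ellp_normE ?ellp_enormZ//.
exact: ellp_carrierZ.
Qed.

Lemma ellp_norm0_eq0 x : ellp_carrier x -> ellp_norm x = 0 -> x = 0.
Proof.
move=> xC x0; apply/funext => i.
have /eqP : N x = 0%E by rewrite -ellp_normE// x0.
rewrite poweR_eq0 ?ellp_sum_ge0// => /andP[/eqP s0 _].
have : ((`|x i| `^ p)%:E <= 0)%E.
  rewrite -s0 (nneseriesD1 (n := i))//.
  by rewrite leeDl// nneseries_ge0// => k _ _; rewrite lee_fin powR_ge0.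
rewrite lee_fin => xi0; apply/normr0_eq0/(powR_eq0_eq0 (p := p)).
by apply/eqP; rewrite eq_le xi0 powR_ge0.
Qed.

Definition ellp_space : Type := subspace_type (NormedSubspace
  ellp_carrier0 ellp_carrierD ellp_carrierZ
  ellp_normD ellp_normZ ellp_norm0_eq0).

HB.instance Definition _ := NormedModule.on ellp_space.

End Ellp.

Section C0.
Variable R : realType.
Implicit Types x y : nat -> R.

Definition c0_carrier : set (nat -> R) := [set x | x @ \oo --> (0 : R)].

Definition c0_norm x : R := sup (range (fun n => `|x n|)).

Lemma c0_has_sup x : c0_carrier x -> has_sup (range (fun n => `|x n|)).
Proof.
move=> xC; split; first by exists `|x 0%N|; exists 0%N.
have [M [_ xM]] : bounded_fun x by apply: cvg_seq_bounded; exact: cvgP xC.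
by exists (M + 1) => _ [n _ <-]; apply: xM; rewrite // ltrDl.
Qed.

Lemma c0_normP x n : c0_carrier x -> `|x n| <= c0_norm x.
Proof. by move=> /c0_has_sup[_ xub]; apply: ub_le_sup => //; exists n. Qed.

Lemma c0_norm_le x M : (forall n, `|x n| <= M) -> c0_norm x <= M.
Proof.
move=> xM; apply: ge_sup; first by exists `|x 0%N|; exists 0%N.
by move=> _ [n _ <-]; exact: xM.
Qed.

Lemma c0_carrier0 : c0_carrier 0.
Proof. exact: (@cvg_cst R 0 nat \oo). Qed.

Lemma c0_carrierD x y : c0_carrier x -> c0_carrier y -> c0_carrier (x + y).
Proof. by move=> xC yC; rewrite /c0_carrier/= -[X in _ --> X]addr0; exact: cvgD. Qed.

Lemma c0_carrierZ (l : R) x : c0_carrier x -> c0_carrier (l *: x).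
Proof.
by move=> xC; rewrite /c0_carrier/= -[X in _ --> X](mulr0 l); exact: cvgMr.
Qed.

Lemma c0_normD x y : c0_carrier x -> c0_carrier y ->
  c0_norm (x + y) <= c0_norm x + c0_norm y.
Proof.
move=> xC yC; apply: c0_norm_le => n.
by rewrite (le_trans (ler_normD _ _))// lerD// c0_normP.
Qed.

Lemma c0_normZ (l : R) x : c0_carrier x -> c0_norm (l *: x) = `|l| * c0_norm x.
Proof.
apply: homogeneity l x; first exact: c0_carrierZ.
  by move=> x xC; exact: le_trans (normr_ge0 _) (c0_normP 0 xC).
by move=> l x xC; apply: c0_norm_le => n; rewrite normrM ler_wpM2l// c0_normP.
Qed.

Lemma c0_norm0_eq0 x : c0_carrier x -> c0_norm x = 0 -> x = 0.
Proof.
by move=> xC x0; apply/funext => n; apply/eqP; rewrite -normr_le0 -x0 c0_normP.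
Qed.

Definition c0_space : Type := subspace_type (NormedSubspace
  c0_carrier0 c0_carrierD c0_carrierZ c0_normD c0_normZ c0_norm0_eq0).

HB.instance Definition _ := NormedModule.on c0_space.

End C0.

(* Main.v *)
From HB Require Import structures.
Require Import Defs.
From mathcomp Require Import all_boot all_order all_algebra finmap.
From mathcomp Require Import all_classical all_reals all_analysis.
From mathcomp Require Import zify lra ring.

Set Implicit Arguments.
Unset Strict Implicit.
Unset Printing Implicit Defensive.

Import Order.TTheory GRing.Theory Num.Theory.
Import numFieldNormedType.Exports.

Local Open Scope classical_set_scope.
Local Open Scope ring_scope.

(** The space [Y] is embedded by sending its n-th basis vector to a combination
    of the unit vectors indexed by a finite block of integers.  An increasing
    set then defines a functional on [Y], whose n-th coefficient is the sum of
    the coefficients it collects in the n-th block.  A finite grid of positive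
    functionals of the dual ball is totally preordered by property (alpha), and
    the rational attached to a point of the n-th block records a functional
    supported in [0, n]: an increasing set that stands at [w] may collect in the
    n-th block, before it stands at [t], about [g w t] = the largest [b] such
    that [w + b u_n] precedes [t].  Property (beta) keeps the functional
    collected so far below the one where the set stands, so that it belongs to
    the dual ball up to a constant, and it makes [g] subadditive.

    It remains to realize a monotone subadditive gauge [g] on a finite linear
    order, up to constants, as the largest weight of a chain in a list of
    weighted points, where a chain must increase in the list as well as in the
    order.  The list follows a tree of windows: the children of a window have
    gauge at most half of it (or are single slots) and come in reversed order,
    so that a chain visits a nested sequence of windows.  Each window carries a
    measure bounded by [g], dominating the measure of its parent and maximal
    with these properties; the intervals on which it equals [g] cover the
    window, which by subadditivity gives it at least half of the gauge.

    In the Musielak-Orlicz case the dual ball is replaced by the ball of the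
    conjugate modular, where (alpha) and (beta) amount to the superadditivity of
    the conjugate functions, and reflexivity is only used to see that the tails
    of every element tend to 0. *)

(** * Chains in a finite linear order *)

Ltac nat_lia :=
  repeat match goal with
  | H : ?P |- _ =>
    lazymatch type of P with
    | Prop =>
      lazymatch P with
      | is_true (leq _ _) => fail
      | is_true (andb (leq _ _) (leq _ _)) => fail
      | is_true (negb (eq_op _ _)) => fail
      | @eq nat _ _ => fail
      | _ => clear H
      end
    end
  end; lia.

Section WeightedChains.
Variable R : realFieldType.
Implicit Types (S t : seq (nat * R)) (mu : nat -> R).

Definition weight t : R := \sum_(p <- t) p.2.

Definition chain S (i j : nat) t : bool :=
  [&& subseq t S, sorted ltn (unzip1 t) & all (fun p => i <= p.1 < j)%N t].

Definition mass mu (i j : nat) : R := \sum_(i <= p < j) mu p.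

Lemma chain_nil S i j : chain S i j [::].
Proof. by rewrite /chain sub0seq. Qed.

Lemma weight_nil : weight [::] = 0.
Proof. by rewrite /weight big_nil. Qed.

Lemma chain_sub S S' i j i' j' t : subseq S S' -> (i' <= i)%N -> (j <= j')%N ->
  chain S i j t -> chain S' i' j' t.
Proof.
move=> SS ii jj /and3P[tS ts ta]; apply/and3P; split => //.
  exact: subseq_trans tS SS.
by apply: sub_all ta => p; lia.
Qed.

Lemma chain_widen S i j i' j' t : (i' <= i)%N -> (j <= j')%N ->
  chain S i j t -> chain S i' j' t.
Proof. exact: chain_sub. Qed.

Lemma chain_restrict S a b i j t : all (fun p => a <= p.1 < b)%N S ->
  chain S i j t -> chain S (maxn a i) (minn b j) t.
Proof.
move=> Sa /and3P[tS ts ta]; apply/and3P; split => //.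
apply/allP => p pt; have /= := allP ta p pt.
by have /= := allP Sa p (mem_subseq tS pt); lia.
Qed.

Lemma chain_empty S i j t : (j <= i)%N -> chain S i j t -> t = [::].
Proof. by case: t => [//|p t] ji /and3P[_ _ /andP[]]; lia. Qed.

Lemma sorted_ltn_cat (s1 s2 : seq nat) : sorted ltn (s1 ++ s2) ->
  [/\ sorted ltn s1, sorted ltn s2 &
    forall x y, x \in s1 -> y \in s2 -> (x < y)%N].
Proof.
rewrite (sorted_pairwise ltn_trans) pairwise_cat.
move=> /and3P[/allrelP h s1s s2s]; split.
- by rewrite (sorted_pairwise ltn_trans).
- by rewrite (sorted_pairwise ltn_trans).
- by move=> x y; exact: h.
Qed.

Lemma subseq_catE (T : eqType) (s s1 s2 : seq T) : subseq s (s1 ++ s2) ->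
  exists u1 u2, [/\ s = u1 ++ u2, subseq u1 s1 & subseq u2 s2].
Proof.
move=> /subseqP[m]; rewrite size_cat => ms ->.
exists (mask (take (size s1) m) s1), (mask (drop (size s1) m) s2).
rewrite !mask_subseq; split => //.
by rewrite -mask_cat ?cat_take_drop// size_takel// ms leq_addr.
Qed.

(** The cut [k] is one more than the last position taken from [S1], or [i] if none is taken; strict
    increase puts every position taken from [S2] at [k] or later. *)
Lemma chain_cat S1 S2 i j t : (i <= j)%N -> chain (S1 ++ S2) i j t ->
  exists k t1 t2,
    [/\ t = t1 ++ t2, (i <= k <= j)%N, chain S1 i k t1 & chain S2 k j t2].
Proof.
move=> ij /and3P[/subseq_catE[t1 [t2 [-> t1S t2S]]]].
rewrite /unzip1 map_cat all_cat => /sorted_ltn_cat[s1 s2 s12] /andP[a1 a2].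
case/lastP: t1 t1S s1 s12 a1 => [|t1 p] t1S s1 s12 a1.
  exists i, [::], t2; split; rewrite ?leqnn// ?chain_nil//.
  exact/and3P.
have pt : p \in rcons t1 p by rewrite mem_rcons mem_head.
have /= /andP[ip pj] := allP a1 p pt.
exists p.1.+1, (rcons t1 p), t2; split; [by []|by rewrite pj andbT leqW| |].
  apply/and3P; split => //; apply/allP => q qt.
  have /= /andP[-> _] := allP a1 q qt; move: qt s1.
  rewrite andTb mem_rcons inE ltnS => /predU1P[->//|qt].
  rewrite /unzip1 map_rcons -cats1 => /sorted_ltn_cat[_ _] /(_ q.1 p.1) h.
  by apply: ltnW; apply: h; rewrite ?map_f// mem_seq1.
apply/and3P; split => //; apply/allP => q qt.
by have /= /andP[_ ->] := allP a2 q qt; rewrite andbT; apply: s12; exact: map_f.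
Qed.

Lemma chain_catl S1 S2 i j t : chain S1 i j t -> chain (S1 ++ S2) i j t.
Proof. by apply: chain_sub => //; exact: prefix_subseq. Qed.

Lemma chain_catr S1 S2 i j t : chain S2 i j t -> chain (S1 ++ S2) i j t.
Proof. by apply: chain_sub => //; exact: suffix_subseq. Qed.

Lemma weight_cat t1 t2 : weight (t1 ++ t2) = weight t1 + weight t2.
Proof. by rewrite /weight big_cat. Qed.

Lemma mass_cat mu i k j : (i <= k <= j)%N ->
  mass mu i j = mass mu i k + mass mu k j.
Proof. by case/andP=> ik kj; rewrite /mass (big_cat_nat ik kj). Qed.

Lemma mass_ge0 mu i j : (forall p, 0 <= mu p) -> 0 <= mass mu i j.
Proof. by move=> mu0; rewrite sumr_ge0. Qed.

Lemma mass_empty mu i j : (j <= i)%N -> mass mu i j = 0.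
Proof. by move=> ji; rewrite /mass big_geq. Qed.

Lemma mass_sub mu i' i j j' : (forall p, 0 <= mu p) -> (i' <= i)%N ->
  (j <= j')%N -> mass mu i j <= mass mu i' j'.
Proof.
move=> mu0 ii jj; have [ij|/ltnW ji] := leqP i j; last first.
  by rewrite mass_empty// mass_ge0.
rewrite (@mass_cat mu i' i j') ?ii//=; last lia.
rewrite (@mass_cat mu i j j') ?ij//=.
by have := mass_ge0 i' i mu0; have := mass_ge0 j j' mu0; lra.
Qed.

Lemma mass_le mu mu' i j : (forall p, mu p <= mu' p) ->
  mass mu i j <= mass mu' i j.
Proof. by move=> h; apply: ler_sum. Qed.

(** * Measures dominated by a gauge *)

Variable g : nat -> nat -> R.
Hypothesis g_refl : forall i, g i i = 0.
Hypothesis g_gt0 : forall i j, (i < j)%N -> 0 < g i j.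
Hypothesis g_mono : forall i i' j j', (i' <= i)%N -> (i <= j)%N ->
  (j <= j')%N -> g i j <= g i' j'.
Hypothesis g_sub : forall i k j, (i <= k <= j)%N -> g i j <= g i k + g k j.

Definition feasible (a b : nat) mu : Prop :=
  forall i j, (a <= i)%N -> (i <= j)%N -> (j <= b)%N -> mass mu i j <= g i j.

Definition tight mu (i j : nat) : Prop := mass mu i j = g i j.

Lemma g_ge0 i j : (i <= j)%N -> 0 <= g i j.
Proof.
by rewrite leq_eqVlt => /predU1P[->|/g_gt0/ltW//]; rewrite g_refl.
Qed.

Lemma mass_bump mu p d i j :
  mass (fun q => mu q + (if q == p then d else 0)) i j =
  mass mu i j + (if (i <= p < j)%N then d else 0).
Proof.
rewrite /mass big_split/=; congr (_ + _).
rewrite -big_mkcond/= -big_filter.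
case: ifP => ipj.
  rewrite (perm_big [:: p]) ?big_seq1//.
  apply: uniq_perm; rewrite ?filter_uniq ?iota_uniq// => q.
  rewrite mem_filter mem_index_iota mem_seq1.
  by case: eqP => // ->; rewrite ipj.
rewrite big_seq big1// => q; rewrite mem_filter mem_index_iota.
by case: eqP => // ->; rewrite ipj.
Qed.

(** Greedy choice: the points are raised one after the other, each by the least slack among the
    intervals that contain it. One of these intervals becomes tight, and those already tight stay
    so, since a tight interval around the point forces the slack to be 0. *)
Lemma saturate a b mu0 : (forall p, 0 <= mu0 p) -> feasible a b mu0 ->
  exists mu, [/\ forall p, mu0 p <= mu p, feasible a b mu &
    forall p, (a <= p < b)%N -> exists i j,
      [/\ (a <= i <= p)%N, (p < j <= b)%N & tight mu i j]].
Proof.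
move=> mu00 f0.
suff /(_ b) [mu [mu0mu fmu tmu]] : forall k, exists mu,
  [/\ forall p, mu0 p <= mu p, feasible a b mu &
    forall p, (p < k)%N -> (a <= p < b)%N -> exists i j,
      [/\ (a <= i <= p)%N, (p < j <= b)%N & tight mu i j]].
  by exists mu; split => // p pab; apply: tmu => //; case/andP: pab.
elim=> [|k [mu [mu0mu fmu tmu]]]; first by exists mu0.
have [kab|kab] := boolP (a <= k < b)%N; last first.
  exists mu; split => // p; rewrite ltnS leq_eqVlt => /predU1P[->|/tmu//].
  by rewrite (negbTE kab).
pose P (ij : 'I_b.+1 * 'I_b.+1) := (a <= ij.1 <= k)%N && (k < ij.2)%N.
pose h (ij : 'I_b.+1 * 'I_b.+1) := g ij.1 ij.2 - mass mu ij.1 ij.2.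
have kb : (k < b.+1)%N by lia.
have Pk : P (Ordinal kb, ord_max) by rewrite /P/=; lia.
case: (@Order.TotalTheory.arg_minP _ R _ _ P h Pk) => -[[i ib] [j jb]] /= Pij hmin.
set d := h _ in hmin; have d0 : 0 <= d.
  by rewrite subr_ge0; apply: fmu => /=; move: Pij; rewrite /P/=; lia.
have bumpE := mass_bump mu k d.
exists (fun q => mu q + (if q == k then d else 0)); split.
- move=> p; rewrite (le_trans (mu0mu p))// lerDl; case: ifP => //.
- move=> i' j' ai' ij' jb'; rewrite bumpE; case: ifP => c; last first.
    by rewrite addr0; exact: fmu.
  have ib'' : (i' < b.+1)%N by lia.
  have jb'' : (j' < b.+1)%N by lia.
  have /hmin : P (Ordinal ib'', Ordinal jb'') by rewrite /P/=; lia.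
  by rewrite /h/=; lra.
- move=> p; rewrite ltnS leq_eqVlt => /predU1P[->|pk pab].
    move=> _; exists i, j; move: Pij; rewrite /P/= => Pij; split; [lia|lia|].
    rewrite /tight bumpE ifT; last lia.
    by rewrite /d/h/=; lra.
  have [i' [j' [ip pj tij]]] := tmu p pk pab.
  exists i', j'; split => //; rewrite /tight bumpE; case: ifP => c; last first.
    by rewrite addr0.
  suff -> : d = 0 by rewrite addr0.
  apply/eqP; rewrite eq_le d0 andbT.
  have ib'' : (i' < b.+1)%N by lia.
  have jb'' : (j' < b.+1)%N by lia.
  have /hmin : P (Ordinal ib'', Ordinal jb'') by rewrite /P/=; lia.
  by rewrite /h/= tij subrr.
Qed.

(** The tight intervals cover the window. Taking each time the one that reaches farthest gives a
    cover in which no point lies more than twice, so by subadditivity [g a b] is at most twice the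
    total mass. *)
Lemma saturated_mass a b mu : (a <= b)%N -> (forall p, 0 <= mu p) ->
  (forall p, (a <= p < b)%N -> exists i j,
      [/\ (a <= i <= p)%N, (p < j <= b)%N & tight mu i j]) ->
  g a b <= 2 * mass mu a b.
Proof.
move=> ab mu0 tmu.
(* Invariant: [y] is the right end of the cover so far, [x] its right end before the last interval
   was added, and every tight interval reaching beyond [y] starts at [x] or later. *)
suff : forall n x y, (b - y <= n)%N -> (a <= x <= y)%N -> (y <= b)%N ->
    g a y <= mass mu a x + mass mu a y ->
    (forall i j, tight mu i j -> (a <= i <= j)%N -> (y < j <= b)%N -> (x <= i)%N) ->
    g a b <= 2 * mass mu a b.
  move=> /(_ _ a a (leqnn _)); apply; rewrite ?leqnn//.
    by rewrite g_refl mass_empty// addr0.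
  by move=> i j _ /andP[].
elim=> [|n IH] x y byn axy yb gy xt.
  have yb' : y = b by lia.
  move: gy; rewrite yb'; have := @mass_sub mu a a x b mu0 (leqnn a).
  by move=> /(_ ltac:(lia)); lra.
have [yb'|yb'] := eqVneq y b.
  by move: gy; rewrite yb'; have := @mass_sub mu a a x b mu0 (leqnn a) ltac:(lia); lra.
have [i0 [j0 [ai0 yj0 t0]]] := tmu y ltac:(lia).
pose P (j : 'I_b.+1) := (y < j)%N &&
  [exists i : 'I_b.+1, (a <= i <= y)%N && (mass mu i j == g i j)].
have jb0 : (j0 < b.+1)%N by lia.
have Pj0 : P (Ordinal jb0).
  apply/andP; split => /=; first lia.
  have ib0 : (i0 < b.+1)%N by lia.
  by apply/existsP; exists (Ordinal ib0) => /=; rewrite ai0 t0 eqxx.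
case: (@arg_maxnP _ _ P val Pj0) => -[j jb].
move=> /andP[/= yj /existsP[[i ib]/= /andP[aiy /eqP tij]]] jmax.
have xi : (x <= i)%N by apply: (xt _ _ tij); lia.
apply: (IH y j); [lia|lia|lia| |].
  (* Since [x <= i], the masses of [a, x[ and [i, j[ together are at most that of [a, j[. *)
  have := @g_sub a y j ltac:(lia); have := @g_mono y i j j ltac:(lia) ltac:(lia) ltac:(lia).
  rewrite -tij; have := @mass_cat mu a i j ltac:(lia).
  by have := @mass_sub mu a a x i mu0 (leqnn _) xi; lra.
move=> i' j' t' ai' jj'; rewrite leqNgt; apply/negP => iy.
have jb' : (j' < b.+1)%N by lia.
have : P (Ordinal jb').
  apply/andP; split => /=; first lia.
  have ib' : (i' < b.+1)%N by lia.
  apply/existsP; exists (Ordinal ib') => /=; apply/andP; split; first lia.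
  exact/eqP.
by move=> /jmax/=; lia.
Qed.

(* The last clause holds because a short last piece is merged with a short
   predecessor. *)
Lemma next_break G b v : 0 < G -> (v < b)%N -> exists v',
  [/\ (v < v' <= b)%N, v' = v.+1 \/ g v v' <= G / 2,
      (v' < b)%N -> forall x, (v' < x)%N -> G / 4 < g v x &
      (v' < b)%N -> G / 4 < g v' b \/ v' = v.+1 /\ G / 4 < g v v'].
Proof.
move=> G0 vb.
(* A piece is as long as its gauge stays at most [G / 4], but it has at least one slot. *)
pose P u := (v < u <= b)%N && ((u == v.+1) || (g v u <= G / 4)).
have P0 : exists u, P u by exists v.+1; rewrite /P eqxx/= ltnSn vb.
have Pb u : P u -> (u <= b)%N by case/andP => /andP[].
have := @ex_maxnP P b P0 Pb; case: ex_maxnP => // u Pu umax _.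
have /andP[/andP[vu ub] /orP uc] := Pu.
have uS x : (u < b)%N -> (u < x)%N -> G / 4 < g v x.
  move=> ub' ux; apply: (@lt_le_trans _ _ (g v u.+1)); last by apply: g_mono; lia.
  rewrite ltNge; apply/negP => gu; suff /umax : P u.+1 by lia.
  by rewrite /P gu orbT andbT; lia.
have [ub'|ub'] := leqP b u.
  have -> : b = u by lia.
  exists u; split; [lia| |lia|lia].
  by case: uc => [/eqP->|h]; [left|right; lra].
have [h1|h1] := leP (g u b) (G / 4); last first.
  exists u; split; [lia| |by move=> _ x; exact: uS|by left].
  by case: uc => [/eqP->|h]; [left|right; lra].
have [h2|h2] := leP (g v u) (G / 4).
  exists b; split; [lia| |lia|lia].
  by right; have := @g_sub v u b ltac:(lia); lra.
exists u; split; [lia| |by move=> _ x; exact: uS|].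
  by case: uc => [/eqP->|h]; [left|lra].
by case: uc => [/eqP u1|h]; [right|lra].
Qed.

(* [mu0] is the measure of the parent window, the list of which comes first: a
   chain of [S] entered at [v] may continue one of mass [mass mu0 w v]. *)
Record good (a b : nat) mu0 S : Prop := Good {
  good_supp : all (fun p => a <= p.1 < b)%N S;
  good_tot : forall i j t, chain S i j t -> weight t <= 2 * g a b;
  good_tot1 : b = a.+1 -> forall i j t, chain S i j t -> weight t <= g a b;
  good_start : forall v x t, (a <= v <= x)%N -> (x <= b)%N -> chain S v x t ->
    mass mu0 a v + weight t <= 8 * g a x;
  good_up : forall w v x t, (a <= w <= v)%N -> (v <= x <= b)%N ->
    chain S v x t -> mass mu0 w v + weight t <= 9 * g w x;
  good_gap : forall p, (a <= p < b)%N ->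
    exists2 t, chain S p p.+1 t & g p p.+1 <= weight t;
  good_full : exists2 t, chain S a b t & g a b <= 2 * weight t;
  good_prefix : forall x, (a < x <= b)%N ->
    exists2 t, chain S a x t & g a x <= 16 * weight t;
  good_suffix : forall w, (a <= w < b)%N ->
    exists2 t, chain S w b t & g w b <= 64 * weight t;
  good_low : forall w x, (a <= w < x)%N -> (x <= b)%N ->
    exists2 t, chain S w x t & g w x <= 128 * weight t
}.

(** The invariant for a list of the children that fill [v, b[ in a window of gauge [G] and measure
    [mu]. It mirrors [good], the window's own measure not being listed yet. A chain stays in one
    child, whence the bound [G] in [tail_tot]. *)
Record good_tail (G : R) (b : nat) mu (v : nat) T : Prop := GoodTail {
  tail_supp : all (fun p => v <= p.1 < b)%N T;
  tail_tot : forall i j t, chain T i j t -> weight t <= G;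
  tail_start : forall y x t, (v <= y <= x)%N -> (x <= b)%N -> chain T y x t ->
    mass mu v y + weight t <= 8 * g v x;
  tail_up : forall w y x t, (v <= w <= y)%N -> (y <= x <= b)%N ->
    chain T y x t -> mass mu w y + weight t <= 9 * g w x;
  tail_gap : forall p, (v <= p < b)%N ->
    exists2 t, chain T p p.+1 t & g p p.+1 <= weight t;
  tail_prefix : forall x, (v < x <= b)%N ->
    exists2 t, chain T v x t & g v x <= 16 * weight t;
  tail_suffix : forall w, (v <= w < b)%N ->
    exists2 t, chain T w b t & g w b <= 64 * weight t;
  tail_low : forall w x, (v <= w < x)%N -> (x <= b)%N ->
    exists2 t, chain T w x t & g w x <= 128 * weight t
}.

(** The later slots come first in the list, whereas a chain has to increase: it cannot use both
    parts. *)
Lemma chain_cat_disjoint T S v v' b i j t :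
  all (fun p => v' <= p.1 < b)%N T -> all (fun p => v <= p.1 < v')%N S ->
  chain (T ++ S) i j t ->
  chain T (maxn v' i) (minn b j) t \/ chain S (maxn v i) (minn v' j) t.
Proof.
move=> Ts Ss tc; have [ij|/ltnW ji] := leqP i j; last first.
  by rewrite (chain_empty ji tc); left; exact: chain_nil.
have [k [t1 [t2 [-> ikj c1 c2]]]] := chain_cat ij tc.
have c1' := chain_restrict Ts c1; have c2' := chain_restrict Ss c2.
have [kv|vk] := leqP k v'.
  right; rewrite (chain_empty _ c1') ?cat0s; last nat_lia.
  by apply: chain_widen c2'; nat_lia.
left; rewrite (chain_empty _ c2') ?cats0; last nat_lia.
by apply: chain_widen c1'; nat_lia.
Qed.

(** * Recursion over the tree of windows *)

Lemma good_tail_nil G b mu : 0 < G -> feasible b b mu -> good_tail G b mu b [::].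
Proof.
move=> G0 fmu.
have nilE i j t : chain [::] i j t -> weight t = 0.
  by case/and3P => /eqP->; rewrite weight_nil.
split => //=; try by move=> *; exfalso; nat_lia.
- by move=> i j t /nilE ->; exact: ltW.
- move=> y x t ? ? /nilE->; have -> : y = b by nat_lia.
  by rewrite mass_empty// addr0 mulr_ge0// g_ge0//; nat_lia.
- move=> w y x t ? ? /nilE->; rewrite mass_empty ?addr0; last nat_lia.
  by rewrite mulr_ge0// g_ge0//; nat_lia.
Qed.

(** A chain lies in one child, which has gauge at most [G / 2] or is a single slot, so its weight is
    at most [G]. An interval that starts at [v] and goes beyond the first child has gauge more than
    [G / 4], so there everything is comparable with [G]. *)
Lemma good_tail_step G b mu v v' T S : 0 < G -> g v b <= G ->
  (forall p, 0 <= mu p) -> feasible v b mu ->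
  (v < v' <= b)%N -> v' = v.+1 \/ g v v' <= G / 2 ->
  ((v' < b)%N -> forall x, (v' < x)%N -> G / 4 < g v x) ->
  ((v' < b)%N -> G / 4 < g v' b \/ v' = v.+1 /\ G / 4 < g v v') ->
  good_tail G b mu v' T -> good v v' mu S -> good_tail G b mu v (T ++ S).
Proof.
move=> G0 gG mu0 fmu vv' n2 n3 n4 gT gS.
have split_chain i j t := @chain_cat_disjoint _ _ v v' b i j t (tail_supp gT) (good_supp gS).
have gle i j : (v <= i <= j)%N -> (j <= b)%N -> g i j <= G.
  by move=> ? ?; apply: le_trans gG; apply: g_mono; nat_lia.
have tot i j t : chain (T ++ S) i j t -> weight t <= G.
  move=> /split_chain[/(tail_tot gT)//|tc].
  have [e|h] := n2; last by have := good_tot gS tc; lra.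
  by have := good_tot1 gS e tc; have := gle v v' ltac:(nat_lia) ltac:(nat_lia); lra.
have start y x t : (v <= y <= x)%N -> (x <= b)%N -> chain (T ++ S) y x t ->
    mass mu v y + weight t <= 8 * g v x.
  move=> vyx xb tc; have my := fmu v y ltac:(nat_lia) ltac:(nat_lia) ltac:(nat_lia).
  have gy : g v y <= g v x by apply: g_mono; nat_lia.
  have g0 : 0 <= g v x by apply: g_ge0; nat_lia.
  (* Beyond [v'] the mass and the weight are each at most [G], which is less than [4 * g v x]. *)
  have [v'x|xv'] := ltnP v' x.
    have := n3 ltac:(nat_lia) x v'x; have := tot _ _ _ tc.
    by have := gle v y ltac:(nat_lia) ltac:(nat_lia); lra.
  have [tc'|tc'] := split_chain _ _ _ tc.
    by rewrite (chain_empty _ tc') ?weight_nil; [lra|nat_lia].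
  by apply: (good_start gS); [nat_lia|nat_lia|apply: chain_widen tc'; nat_lia].
have gap p : (v <= p < b)%N ->
    exists2 t, chain (T ++ S) p p.+1 t & g p p.+1 <= weight t.
  move=> vpb; have [pv'|v'p] := ltnP p v'.
    by have [t tc tw] := good_gap gS (p := p) ltac:(nat_lia); exists t => //; exact: chain_catr.
  by have [t tc tw] := tail_gap gT (p := p) ltac:(nat_lia); exists t => //; exact: chain_catl.
have prefix x : (v < x <= b)%N ->
    exists2 t, chain (T ++ S) v x t & g v x <= 16 * weight t.
  move=> vxb; have [xv'|v'x] := leqP x v'.
    have [t tc tw] := good_prefix gS (x := x) ltac:(nat_lia).
    by exists t => //; exact: chain_catr.
  have gx := gle v x ltac:(nat_lia) ltac:(nat_lia).
  have := n3 ltac:(nat_lia) v'.+1 ltac:(nat_lia).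
  have := @g_sub v v' v'.+1 ltac:(nat_lia).
  (* Since [g v v'.+1] exceeds [G / 4], either the first child or the single slot [v'] has gauge
     more than [G / 8]. A full chain of the child loses a further factor 2, whence 16. *)
  have [h|h] := ltP (G / 8) (g v v') => gs gn.
    have [t tc tw] := good_full gS; exists t; last by lra.
    by apply: chain_catr; apply: chain_widen tc; nat_lia.
  have [t tc tw] := gap v' ltac:(nat_lia); exists t; last by lra.
  by apply: chain_widen tc; nat_lia.
have suffix w : (v <= w < b)%N ->
    exists2 t, chain (T ++ S) w b t & g w b <= 64 * weight t.
  move=> vwb; have [wv'|v'w] := ltnP w v'; last first.
    have [t tc tw] := tail_suffix gT (w := w) ltac:(nat_lia).
    by exists t => //; exact: chain_catl.
  have [v'b|bv'] := ltnP v' b; last first.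
    have e : v' = b by nat_lia.
    rewrite e in gS; have [t tc tw] := good_suffix gS (w := w) ltac:(nat_lia).
    by exists t => //; exact: chain_catr.
  have gw := gle w b ltac:(nat_lia) ltac:(nat_lia).
  (* In both cases some part has gauge more than [G / 4]; the factor 16 of [tail_prefix] turns this
     into 64. *)
  have [h|[e h]] := n4 v'b.
    have [t tc tw] := tail_prefix gT (x := b) ltac:(nat_lia); exists t; last by lra.
    by apply: chain_catl; apply: chain_widen tc; nat_lia.
  have [t tc tw] := gap v ltac:(nat_lia); exists t; last by rewrite e in h; lra.
  by apply: chain_widen tc; nat_lia.
split => //.
- rewrite all_cat; apply/andP; split.
    by apply: sub_all (tail_supp gT) => p; nat_lia.
  by apply: sub_all (good_supp gS) => p; nat_lia.
- move=> w y x t vwy yxb tc.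
  have my := fmu w y ltac:(nat_lia) ltac:(nat_lia) ltac:(nat_lia).
  have gy : g w y <= g w x by apply: g_mono; nat_lia.
  have g0 : 0 <= g w x by apply: g_ge0; nat_lia.
  have [v'w|wv'] := leqP v' w.
    have [tc'|tc'] := split_chain _ _ _ tc; last first.
      by rewrite (chain_empty _ tc') ?weight_nil; [lra|nat_lia].
    by apply: (tail_up gT); [nat_lia|nat_lia|apply: chain_widen tc'; nat_lia].
  have [tc'|tc'] := split_chain _ _ _ tc.
    have [xv'|v'x] := leqP x v'.
      by rewrite (chain_empty _ tc') ?weight_nil; [lra|nat_lia].
    (* The chain starts at [v'] or later, so [tail_start] with an empty mass bounds it by 8 times
       the gauge; the mass of the window adds one more. *)
    have := @tail_start _ _ _ _ _ gT v' x t ltac:(nat_lia) ltac:(nat_lia).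
    rewrite mass_empty// add0r => /(_ _) h.
    have {}h : weight t <= 8 * g v' x.
      by apply: h; apply: chain_widen tc'; nat_lia.
    by have : g v' x <= g w x by [apply: g_mono; nat_lia]; lra.
  have [yv'|v'y] := leqP y v'; last first.
    by rewrite (chain_empty _ tc') ?weight_nil; [lra|nat_lia].
  have := @good_up _ _ _ _ gS w y (minn v' x) t ltac:(nat_lia) ltac:(nat_lia).
  move=> /(_ _) h; have {}h : mass mu w y + weight t <= 9 * g w (minn v' x).
    by apply: h; apply: chain_widen tc'; nat_lia.
  by have : g w (minn v' x) <= g w x by [apply: g_mono; nat_lia]; lra.
- move=> w x vwx xb; have [v'w|wv'] := leqP v' w.
    have [t tc tw] := tail_low gT (w := w) (x := x) ltac:(nat_lia) ltac:(nat_lia).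
    by exists t => //; exact: chain_catl.
  have [xv'|v'x] := leqP x v'.
    have [t tc tw] := good_low gS (w := w) (x := x) ltac:(nat_lia) ltac:(nat_lia).
    by exists t => //; exact: chain_catr.
  have := @g_sub w v' x ltac:(nat_lia); have := @g_ge0 w x ltac:(nat_lia) => g0.
  (* One side of [v'] has at least half of the gauge, which doubles the 64 of the suffixes. *)
  have [h|h] := leP (g w x / 2) (g w v') => gs.
    have [t tc tw] := good_suffix gS (w := w) ltac:(nat_lia); exists t; last by lra.
    by apply: chain_catr; apply: chain_widen tc; nat_lia.
  have [t tc tw] := tail_prefix gT (x := x) ltac:(nat_lia); exists t; last by lra.
  by apply: chain_catl; apply: chain_widen tc; nat_lia.
Qed.

Lemma good_single a mu0 : (forall p, 0 <= mu0 p) -> feasible a a.+1 mu0 ->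
  good a a.+1 mu0 [:: (a, g a a.+1)].
Proof.
move=> mu00 f0; have ga := g_gt0 (ltnSn a).
have chain1 i j t : chain [:: (a, g a a.+1)] i j t ->
    t = [::] \/ [/\ weight t = g a a.+1 & (i <= a < j)%N].
  case/and3P => + _; case: t => [|p [|q t]]; [by left| |].
    by rewrite sub1seq inE => /eqP-> /=; rewrite andbT /weight big_seq1; right.
  by move=> /size_subseq.
have single i j : (i <= a < j)%N ->
    exists2 t, chain [:: (a, g a a.+1)] i j t & weight t = g a a.+1.
  move=> iaj; exists [:: (a, g a a.+1)]; last by rewrite /weight big_seq1.
  by rewrite /chain subseq_refl/= iaj.
have tot i j t : chain [:: (a, g a a.+1)] i j t -> weight t <= g a a.+1.
  by case/chain1 => [->|[-> _]//]; rewrite weight_nil ltW.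
have bound w v x t : (a <= w <= v)%N -> (v <= x <= a.+1)%N ->
    chain [:: (a, g a a.+1)] v x t -> mass mu0 w v + weight t <= 8 * g w x.
  move=> awv vxb /chain1[->|[-> iaj]]; last first.
    have -> : w = a by nat_lia.
    have -> : v = a by nat_lia.
    have -> : x = a.+1 by nat_lia.
    by rewrite mass_empty// add0r; lra.
  rewrite weight_nil addr0.
  have := f0 w v ltac:(nat_lia) ltac:(nat_lia) ltac:(nat_lia).
  have : g w v <= g w x by apply: g_mono; nat_lia.
  by have := g_ge0 (i := w) (j := x) ltac:(nat_lia); lra.
split.
- by rewrite /= leqnn ltnSn.
- by move=> i j t /tot; lra.
- by move=> _ i j t /tot.
- by move=> v x t avx xb tc; apply: bound tc; nat_lia.
- move=> w v x t awv vxb tc; have := bound _ _ _ _ awv vxb tc.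
  by have := g_ge0 (i := w) (j := x) ltac:(nat_lia); lra.
- move=> p pa; have -> : p = a by nat_lia.
  by have [t tc tw] := @single a a.+1 ltac:(nat_lia); exists t; rewrite ?tw.
- by have [t tc tw] := @single a a.+1 ltac:(nat_lia); exists t => //; rewrite tw; lra.
- move=> x ax; have -> : x = a.+1 by nat_lia.
  by have [t tc tw] := @single a a.+1 ltac:(nat_lia); exists t => //; rewrite tw; lra.
- move=> w aw; have -> : w = a by nat_lia.
  by have [t tc tw] := @single a a.+1 ltac:(nat_lia); exists t => //; rewrite tw; lra.
- move=> w x aw xa; have -> : w = a by nat_lia.
  have -> : x = a.+1 by nat_lia.
  by have [t tc tw] := @single a a.+1 ltac:(nat_lia); exists t => //; rewrite tw; lra.
Qed.

Lemma weight_subseq t S : all (fun p => 0 <= p.2) S -> subseq t S ->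
  weight t <= weight S.
Proof.
elim: S t => [|q S IH] [|p t]//=.
- move=> h _; rewrite weight_nil /weight big_seq sumr_ge0// => r.
  exact: (allP (h : all (fun p => 0 <= p.2) (q :: S))) r.
- move=> /andP[q0 S0]; rewrite {2}/weight big_cons.
  case: eqP => [<-|_] tS; first by rewrite /weight big_cons lerD2l; exact: IH.
  by rewrite (le_trans (IH _ S0 tS))// lerDr.
Qed.

(** Unlike the children, the points of the measure are listed in increasing order, so that the whole
    list is a chain. *)
Definition mass_list mu (a b : nat) : seq (nat * R) :=
  [seq (p, mu p) | p <- index_iota a b].

Lemma chain_mass_list_le mu a b i j t : (forall p, 0 <= mu p) ->
  (a <= i)%N -> (j <= b)%N ->
  chain (mass_list mu a b) i j t -> weight t <= mass mu i j.
Proof.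
move=> mu0 ai jb /and3P[tS _ ta].
have tf : subseq t [seq p <- mass_list mu a b | (i <= p.1 < j)%N].
  by rewrite subseq_filter ta.
apply: le_trans (weight_subseq _ tf) _.
  by apply/allP => q; rewrite mem_filter => /andP[_ /mapP[x _ ->]]/=.
rewrite /weight big_filter big_map/= /mass.
rewrite (big_nat_widen _ _ _ _ _ jb) (big_nat_widenl _ _ _ _ _ ai)/=.
by rewrite le_eqVlt; apply/orP; left; apply/eqP/eq_bigl => p; rewrite andbC.
Qed.

Lemma chain_mass_list mu a b :
  chain (mass_list mu a b) a b (mass_list mu a b).
Proof.
rewrite /chain subseq_refl /= /unzip1 -map_comp/= map_id iota_ltn_sorted/=.
by apply/allP => q /mapP[x]; rewrite mem_index_iota => xab ->.
Qed.

Lemma weight_mass_list mu a b : weight (mass_list mu a b) = mass mu a b.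
Proof. by rewrite /weight big_map. Qed.

(** A chain follows the measure of the window up to some [k] and then one child. As [mu0 <= mu], the
    mass inherited from the parent and the mass just collected merge into a single mass of [mu];
    thus the contributions of nested windows do not accumulate. *)
Lemma good_root a b mu0 mu T : (forall p, 0 <= mu p) ->
  (forall p, mu0 p <= mu p) -> feasible a b mu -> (a.+1 < b)%N ->
  g a b <= 2 * mass mu a b ->
  good_tail (g a b) b mu a T -> good a b mu0 (mass_list mu a b ++ T).
Proof.
move=> mu_ge0 mu0mu fmu ab mab gT.
have sK : all (fun p => a <= p.1 < b)%N (mass_list mu a b).
  by apply/allP => q /mapP[x]; rewrite mem_index_iota => xab ->.
have sKT : all (fun p => a <= p.1 < b)%N (mass_list mu a b ++ T).
  by rewrite all_cat sK (tail_supp gT).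
have split_chain i j t : (a <= i <= j)%N -> (j <= b)%N ->
    chain (mass_list mu a b ++ T) i j t -> exists k t2,
    [/\ (i <= k <= j)%N, chain T k j t2 & weight t <= mass mu i k + weight t2].
  move=> aij jb /chain_cat[]; first lia.
  move=> k [t1 [t2 [-> ikj c1 c2]]]; exists k, t2; split => //.
  by rewrite weight_cat lerD2r; apply: chain_mass_list_le c1 => //; lia.
have gab : 0 <= g a b by apply: g_ge0; nat_lia.
split => //.
- move=> i j t tc.
  have [ij|/ltnW ji] := leqP i j; last first.
    by rewrite (chain_empty ji tc) weight_nil; lra.
  have [k [t1 [t2 [-> ikj c1 c2]]]] := chain_cat ij tc.
  rewrite weight_cat; have := tail_tot gT c2.
  have := @chain_mass_list_le mu a b a b t1 mu_ge0 (leqnn _) (leqnn _).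
  move=> /(_ (chain_widen _ _ (chain_restrict sK c1))) => /(_ ltac:(nat_lia) ltac:(nat_lia)).
  by have := fmu a b ltac:(nat_lia) ltac:(nat_lia) ltac:(nat_lia); lra.
- by move=> ?; exfalso; nat_lia.
- move=> v x t avx xb /split_chain[]; [nat_lia|nat_lia|].
  move=> k [t2 [vkx tc tw]].
  have := tail_start gT (y := k) (x := x) ltac:(nat_lia) ltac:(nat_lia) tc.
  rewrite (@mass_cat mu a v k) => [|]; last nat_lia.
  by have := mass_le a v mu0mu; lra.
- move=> w v x t awv vxb /split_chain[]; [nat_lia|nat_lia|].
  move=> k [t2 [vkx tc tw]].
  have := tail_up gT (w := w) (y := k) (x := x) ltac:(nat_lia) ltac:(nat_lia) tc.
  rewrite (@mass_cat mu w v k) => [|]; last nat_lia.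
  by have := mass_le w v mu0mu; lra.
- move=> p pab; have [t tc tw] := tail_gap gT pab.
  by exists t => //; exact: chain_catr.
- exists (mass_list mu a b); last by rewrite weight_mass_list.
  exact/chain_catl/chain_mass_list.
- move=> x axb; have [t tc tw] := tail_prefix gT axb.
  by exists t => //; exact: chain_catr.
- move=> w awb; have [t tc tw] := tail_suffix gT awb.
  by exists t => //; exact: chain_catr.
- move=> w x awx xb; have [t tc tw] := tail_low gT awx xb.
  by exists t => //; exact: chain_catr.
Qed.

(** The outer induction is on the length of the window, the inner one on the part of it still to be
    cut into children. *)
Lemma good_exists a b mu0 : (a < b)%N -> (forall p, 0 <= mu0 p) ->
  feasible a b mu0 -> exists2 S, good a b mu0 S & all (fun p => 0 <= p.2) S.
Proof.
have [n] := ubnP (b - a); elim: n a b mu0 => // n IH a b mu0 ban ab mu00 f0.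
have [e|ab1] := eqVneq b a.+1.
  rewrite e in f0 *; exists [:: (a, g a a.+1)]; first exact: good_single.
  by rewrite /= andbT ltW// g_gt0.
have [mu [mu0mu fmu tmu]] := saturate mu00 f0.
have mu_ge0 p : 0 <= mu p by exact: le_trans (mu0mu p).
have mab : g a b <= 2 * mass mu a b.
  by apply: saturated_mass => //; exact: ltnW.
have G0 := g_gt0 ab.
suff [T gT T0] : exists2 T, good_tail (g a b) b mu a T & all (fun p => 0 <= p.2) T.
  exists (mass_list mu a b ++ T); first by apply: good_root gT => //; nat_lia.
  by rewrite all_cat T0 andbT; apply/allP => q /mapP[x _ ->]/=.
suff : forall m v, (b - v <= m)%N -> (a <= v <= b)%N ->
    exists2 T, good_tail (g a b) b mu v T & all (fun p => 0 <= p.2) T.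
  by move=> /(_ _ a (leqnn _)); apply; rewrite leqnn ltnW.
elim=> [|m IHm] v bvm avb.
  exists [::] => //; have -> : v = b by nat_lia.
  apply: good_tail_nil => // i j bi ij jb.
  by apply: fmu; nat_lia.
have [vb|bv] := ltnP v b; last first.
  exists [::] => //; have -> : v = b by nat_lia.
  apply: good_tail_nil => // i j bi ij jb.
  by apply: fmu; nat_lia.
have [v' [vv' n2 n3 n4]] := next_break G0 vb.
(* A child equal to the window would be a single slot or have at most half of its own positive
   gauge. *)
have small : (v' - v < n)%N.
  have [|b'] := ltnP v' b; first by nat_lia.
  have [|va] := ltnP a v; first by nat_lia.
  have e1 : v' = b by nat_lia.
  have e2 : v = a by nat_lia.
  case: n2 => [|h]; first by nat_lia.
  by move: h; rewrite e1 e2; lra.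
have fmu' a' : (a <= a')%N -> feasible a' b mu.
  by move=> aa' i j ? ? ?; apply: fmu; nat_lia.
have [S gS S0] : exists2 S, good v v' mu S & all (fun p => 0 <= p.2) S.
  apply: IH => //; first by nat_lia.
  by move=> i j ? ? ?; apply: fmu; nat_lia.
have [T gT T0] := IHm v' ltac:(nat_lia) ltac:(nat_lia).
exists (T ++ S); last by rewrite all_cat T0.
apply: (good_tail_step (v' := v')) => //.
- by apply: g_mono; nat_lia.
- by apply: fmu'; nat_lia.
Qed.

(** The root window has no parent, so its inherited measure is 0. The [maxn] allows for [j < i],
    where only the empty chain exists. *)
Lemma window_list_exists N : exists S,
  [/\ all (fun p => (p.1 < N)%N && (0 <= p.2)) S,
      forall i j t, chain S i j t -> weight t <= 9 * g i (maxn i j) &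
      forall i j, (i < j <= N)%N ->
        exists2 t, chain S i j t & g i j <= 128 * weight t].
Proof.
have [->|N0] := posnP N.
  exists [::]; split => // [i j t /and3P[/eqP-> _ _]|i j]; last by nat_lia.
  by rewrite weight_nil mulr_ge0// g_ge0// leq_maxl.
have [||S gS S0] := @good_exists 0 N (fun=> 0) N0; first by [].
  by move=> i j _ ij _; rewrite /mass big1// g_ge0.
exists S; split.
- apply/allP => p pS; have /andP[_ ->] := allP (good_supp gS) _ pS.
  exact: (allP S0).
- move=> i j t tc.
  have [ij|ji] := leqP i j; last first.
    by rewrite (chain_empty (ltnW ji) tc) weight_nil mulr_ge0// g_ge0// leq_maxl.
  have tc' := chain_restrict (good_supp gS) tc.
  have [iN|Ni] := leqP i N; last first.
    by rewrite (chain_empty _ tc') ?weight_nil ?mulr_ge0 ?g_ge0//; nat_lia.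
  have := good_up gS (w := i) (v := i) (x := minn N j) ltac:(nat_lia) ltac:(nat_lia).
  move=> /(_ t) h; have {}h : mass (fun=> 0) i i + weight t <= 9 * g i (minn N j).
    by apply: h; apply: chain_widen tc'; nat_lia.
  move: h; rewrite mass_empty// add0r => /le_trans; apply.
  by rewrite ler_wpM2l//; apply: g_mono; nat_lia.
- by move=> i j ijN; apply: (good_low gS); nat_lia.
Qed.

End WeightedChains.

(** * Slots and blocks *)

Definition supp_lt (R : realType) (n : nat) (x : nat -> R) : Prop :=
  forall i, (n <= i)%N -> x i = 0.

Definition put (R : realType) (x : nat -> R) (n : nat) (a : R) : nat -> R :=
  fun i => if i == n then a else x i.

Lemma put_id (R : realType) (x : nat -> R) n : put x n (x n) = x.
Proof. by apply/funext => i; rewrite /put; case: eqP => [->|]. Qed.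

Lemma put_same (R : realType) (x : nat -> R) n a : put x n a n = a.
Proof. by rewrite /put eqxx. Qed.

Lemma put_other (R : realType) (x : nat -> R) n a i : i != n -> put x n a i = x i.
Proof. by rewrite /put => /negbTE ->. Qed.

(** By the pairwise condition [P] holds exactly on an initial segment of [s], whose length is the
    count. *)
Lemma nth_count_prefix (T : eqType) (x0 : T) (P : pred T) (s : seq T) p :
  pairwise (fun x y => P y ==> P x) s -> (p < size s)%N ->
  P (nth x0 s p) = (p < count P s)%N.
Proof.
elim: s p => // x s IH p /= /andP[/allP xs ps]; case Px : (P x); last first.
  have no y : y \in s -> P y = false.
    by move=> /xs; rewrite Px implybF => /negbTE.
  move=> pS; have -> : count P s = 0%N.
    by apply/eqP; rewrite -leqn0 leqNgt -has_count; apply/hasPn => y /no ->.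
  by case: p pS => [|p]//= pS; rewrite no// mem_nth.
by case: p => [|p]//= pS; rewrite IH.
Qed.

(* The combinatorial content of the theorem: [B] plays the role of the positive
   part of the dual ball and [le n] that of the preorder on vectors supported
   in [0, n[. *)
Record ordered_ball (R : realType) (B : set (nat -> R))
    (le : nat -> (nat -> R) -> (nat -> R) -> Prop) (K : R) : Prop := OrderedBall {
  ball_ge0 : forall x, B x -> forall i, 0 <= x i;
  ball_solid : forall x y, B y -> (forall i, 0 <= x i <= y i) -> B x;
  ball_unit : forall n, B (put (fun=> 0) n 1);
  ball_bound : forall x, B x -> forall n, x n <= K;
  ball_le_refl : forall n x, le n x x;
  ball_le_trans : forall n x y z, le n x y -> le n y z -> le n x z;
  ball_le_total : forall n x y, B x -> B y -> supp_lt n x -> supp_lt n y ->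
    le n x y \/ le n y x;
  ball_le_succ : forall n x y, le n x y -> le n.+1 x y;
  ball_le_mono : forall n x y, (forall i, 0 <= x i <= y i) -> le n x y;
  ball_le_put : forall n x y a b, B x -> B y -> supp_lt n x -> supp_lt n y ->
    0 < a -> 0 <= b -> le n.+1 y (put x n a) -> B (put x n (a + b)) ->
    B (put y n b) /\ le n.+1 (put y n b) (put x n (a + b))
}.

(** * Grid functionals, gauges and blocks of points *)

Section Blocks.
Variables (R : realType) (B : set (nat -> R)).
Variables (le : nat -> (nat -> R) -> (nat -> R) -> Prop) (K : R).
Hypothesis OB : ordered_ball B le K.
Variable eps : nat -> R.
Hypothesis eps_gt0 : forall n, 0 < eps n.

Let eps_ge0 n : 0 <= eps n. Proof. exact: ltW. Qed.

Lemma ball0 : B (fun=> 0).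
Proof.
apply: (ball_solid OB (ball_unit OB 0)) => i.
by rewrite /put /= lexx; case: ifP => _; rewrite ?lexx ?ler01.
Qed.

Definition grid_size (n : nat) : nat := (Num.truncn (K / eps n)).+1.

Lemma bound_ge0 : 0 <= K.
Proof. exact: (ball_bound OB ball0 0%N). Qed.

Lemma grid_size_gt n k : k%:R * eps n <= K -> (k < grid_size n)%N.
Proof.
move=> kK; rewrite /grid_size ltnS Num.Theory.truncn_ge_nat ?divr_ge0 ?bound_ge0//.
by rewrite ler_pdivlMr.
Qed.

(** A finite grid in the part of the ball supported in [0, n[, with mesh [eps i] in coordinate
    [i]. *)
Fixpoint states (n : nat) : seq (nat -> R) :=
  if n isn't n'.+1 then [:: fun=> 0] else
  [seq x <- [seq put x n' (k%:R * eps n') | x <- states n',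
                                             k <- iota 0 (grid_size n')]
     | `[< B x >]].

Lemma statesS n : states n.+1 =
  [seq x <- [seq put x n (k%:R * eps n) | x <- states n, k <- iota 0 (grid_size n)]
     | `[< B x >]].
Proof. by []. Qed.

Lemma statesP n x : x \in states n -> B x /\ supp_lt n x.
Proof.
elim: n x => [|n IH] x.
  by rewrite mem_seq1 => /eqP ->; split => //; exact: ball0.
rewrite statesS mem_filter => /andP[/asboolP Bx /allpairsP[[y k] /= [/IH[_ ys] _ xE]]].
by split => // i ni; rewrite xE put_other ?ys//; nat_lia.
Qed.

Lemma states_put n x k : x \in states n -> B (put x n (k%:R * eps n)) ->
  put x n (k%:R * eps n) \in states n.+1.
Proof.
move=> xn Bx; rewrite statesS mem_filter; apply/andP; split; first exact/asboolP.
apply/allpairsP; exists (x, k); split; [exact: xn| |by []].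
rewrite mem_iota add0n.
by apply: grid_size_gt; have := ball_bound OB Bx n; rewrite put_same.
Qed.

Lemma states_succ n x : x \in states n -> x \in states n.+1.
Proof.
move=> xn; have [Bx xs] := statesP xn.
have xE : x = put x n (0%:R * eps n) by rewrite mul0r -(xs n (leqnn n)) put_id.
by rewrite xE; apply: states_put => //; rewrite -xE.
Qed.

Lemma states0 n : (fun=> 0) \in states n.
Proof. by elim: n => [|n IH]; [rewrite mem_seq1|exact: states_succ]. Qed.

Definition leb n x y : bool := `[< le n x y >].

Lemma leb_trans n : transitive (leb n).
Proof.
by move=> y x z /asboolP xy /asboolP yz; apply/asboolP/(ball_le_trans OB xy yz).
Qed.

Definition slots n : seq (nat -> R) := sort (leb n.+1) (states n.+1).

Definition slot n p : nat -> R := nth (fun=> 0) (slots n) p.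

Lemma mem_slots n : slots n =i states n.+1.
Proof. by move=> x; rewrite mem_sort. Qed.

Lemma slot_mem n p : (p < size (slots n))%N -> slot n p \in states n.+1.
Proof. by move=> pn; rewrite -mem_slots mem_nth. Qed.

Lemma slots_pairwise n : pairwise (leb n.+1) (slots n).
Proof.
rewrite -sorted_pairwise; last exact: leb_trans.
apply: (@sort_sorted_in _ (mem (states n.+1))); last by apply/allP.
move=> x y /statesP[Bx xs] /statesP[By ys].
by apply/orP; have [h|h] := ball_le_total OB Bx By xs ys; [left|right]; exact/asboolP.
Qed.

Lemma slot_le n p q : (p <= q)%N -> (q < size (slots n))%N ->
  le n.+1 (slot n p) (slot n q).
Proof.
rewrite leq_eqVlt => /predU1P[->|pq] qn; first by move=> *; exact: ball_le_refl OB _ _.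
apply/asboolP; have /(pairwiseP (fun=> 0)) h := slots_pairwise n.
exact: (h p q (ltn_trans pq qn) qn pq).
Qed.

(** The slots that [w] does not precede form an initial segment, so this is the first slot that [w]
    precedes. *)
Definition entry n (w : nat -> R) : nat :=
  count (fun y => ~~ leb n.+1 w y) (slots n).

Lemma entryP n w p : (p < size (slots n))%N ->
  leb n.+1 w (slot n p) = (entry n w <= p)%N.
Proof.
move=> pn; apply/negb_inj; rewrite -ltnNge /entry.
apply: (@nth_count_prefix _ _ (fun y => ~~ leb n.+1 w y)) => //.
apply: sub_pairwise (slots_pairwise n) => x y /= xy; apply/implyP.
by apply: contra => wx; exact: leb_trans xy.
Qed.

Lemma entry_le n w p : (p < size (slots n))%N -> (entry n w <= p)%N ->
  le n.+1 w (slot n p).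
Proof. by move=> pn; rewrite -entryP// => /asboolP. Qed.

Lemma le_entry n w p : (p < size (slots n))%N -> le n.+1 w (slot n p) ->
  (entry n w <= p)%N.
Proof. by move=> pn; rewrite -entryP// => h; apply/asboolP. Qed.

Lemma state_slot n w : w \in states n.+1 ->
  exists2 p, (p < size (slots n))%N & w = slot n p.
Proof.
rewrite -mem_slots => ws; exists (index w (slots n)); first by rewrite index_mem.
by rewrite /slot nth_index.
Qed.

Lemma entry0 n : entry n (fun=> 0) = 0%N.
Proof.
apply/eqP; rewrite -leqn0 leqNgt -has_count; apply/hasPn => y.
rewrite mem_slots => /statesP[By _]; rewrite negbK; apply/asboolP.
by apply: ball_le_mono OB _ _ _ _ => i; rewrite lexx (ball_ge0 OB).
Qed.

(** Quantifying over all states that enter at [i] at the latest makes the notion depend on slots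
    only, and monotone in [i] and [j]. *)
Definition steps n i j k : Prop := forall w, w \in states n ->
  (entry n w <= i)%N -> exists p, [/\ (p < j)%N, (p < size (slots n))%N,
    B (put w n (k%:R * eps n)) & le n.+1 (put w n (k%:R * eps n)) (slot n p)].

Definition max_steps n i j : nat :=
  \max_(k < grid_size n | `[< steps n i j k >]) k.

(* The additional step makes the gauge subadditive in spite of the rounding. *)
Definition gauge n i j : R :=
  if (i < j)%N then (max_steps n i j).+1%:R * eps n else 0.

Lemma state_put0 n w : w \in states n -> put w n (0%:R * eps n) = w.
Proof. by move=> /statesP[_ ws]; rewrite mul0r -(ws n (leqnn n)) put_id. Qed.

Lemma steps0 n i j : (i < j)%N -> steps n i j 0.
Proof.
move=> ij w wn wi; have wn1 := states_succ wn.
rewrite state_put0//; have [p pn wp] := state_slot wn1.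
have en : (entry n w < size (slots n))%N.
  apply: leq_ltn_trans (pn); apply: (le_entry pn); rewrite -wp.
  exact: ball_le_refl OB _ _.
exists (entry n w); split => //; [lia|by case: (statesP wn)|].
exact: entry_le.
Qed.

Lemma steps_anti n i j k k' : (k' <= k)%N -> steps n i j k -> steps n i j k'.
Proof.
move=> kk h w wn wi; have [p [pj pn Bp lp]] := h w wn wi.
have w0 := ball_ge0 OB (statesP wn).1.
have le_kk i' : 0 <= put w n (k'%:R * eps n) i' <= put w n (k%:R * eps n) i'.
  rewrite /put; case: ifP => _; last by rewrite w0 lexx.
  by rewrite mulr_ge0//= ler_wpM2r// ler_nat.
exists p; split => //; first exact: (ball_solid OB Bp).
by apply: (ball_le_trans OB) lp; exact: (ball_le_mono OB).
Qed.

Lemma steps_lt n i j k : steps n i j k -> (k < grid_size n)%N.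
Proof.
move=> /(_ _ (states0 n)); rewrite entry0 => /(_ isT)[p [_ _ Bp _]].
by apply: grid_size_gt; have := ball_bound OB Bp n; rewrite put_same.
Qed.

Lemma steps_widen n i i' j j' k : (i' <= i)%N -> (j <= j')%N ->
  steps n i j k -> steps n i' j' k.
Proof.
move=> ii jj h w wn wi; have [p [pj pn Bp lp]] := h w wn (leq_trans wi ii).
by exists p; split => //; nat_lia.
Qed.

Lemma max_stepsP n i j k : (i < j)%N ->
  reflect (steps n i j k) (k <= max_steps n i j)%N.
Proof.
move=> ij; apply: (iffP idP) => [km|h].
  apply: (steps_anti km); rewrite /max_steps.
  elim/big_ind: _ => [|x y hx hy|k' /asboolP//]; first exact: steps0.
  by rewrite /maxn; case: ifP.
have kn := steps_lt h; rewrite /max_steps.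
by apply: (@leq_bigmax_cond _ _ _ (Ordinal kn)) => /=; exact/asboolP.
Qed.

Lemma gauge_refl n i : gauge n i i = 0.
Proof. by rewrite /gauge ltnn. Qed.

Lemma gauge_gt0 n i j : (i < j)%N -> 0 < gauge n i j.
Proof. by rewrite /gauge => ->; rewrite mulr_gt0// ltr0Sn. Qed.

Lemma gauge_mono n i i' j j' : (i' <= i)%N -> (i <= j)%N -> (j <= j')%N ->
  gauge n i j <= gauge n i' j'.
Proof.
move=> ii ij jj; have [e|ij'] := eqVneq i j.
  rewrite e gauge_refl; have [e'|ij'] := eqVneq i' j'.
    by rewrite e' gauge_refl.
  by apply/ltW/gauge_gt0; nat_lia.
rewrite /gauge !ifT; [|nat_lia|nat_lia].
rewrite ler_wpM2r// ler_nat ltnS; apply/max_stepsP; first nat_lia.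
by apply: (steps_widen ii jj); apply/max_stepsP => //; nat_lia.
Qed.

(** If [w0] shows that [a + 1] steps do not fit between [i] and [k], then [w0] with these steps
    added sits at slot [k] or later. Every state entering at [k] precedes it, and [ball_le_put]
    transfers the remaining [b - a - 1] steps to that state, so that they fit between [k] and
    [j]. *)
Lemma gauge_sub n i k j : (i <= k <= j)%N ->
  gauge n i j <= gauge n i k + gauge n k j.
Proof.
move=> ikj; have [->|ik] := eqVneq i k; first by rewrite gauge_refl add0r.
have [->|kj] := eqVneq k j; first by rewrite gauge_refl addr0.
rewrite /gauge !ifT; [|nat_lia|nat_lia|nat_lia].
set b := max_steps n i j; set a := max_steps n i k; set c := max_steps n k j.
rewrite -mulrDl ler_wpM2r// -natrD ler_nat.
have [|ab] := leqP b a; first by nat_lia.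
have hb : steps n i j b by apply/max_stepsP => //; nat_lia.
have : ~ steps n i k a.+1.
  by move/max_stepsP => /(_ ltac:(nat_lia)); rewrite ltnn.
move=> /existsNP[w0] /not_implyP[w0n] /not_implyP[w0i] w0k.
have [p [pj pn Bp lp]] := hb w0 w0n w0i.
have [Bw0 w0s] := statesP w0n.
pose q := put w0 n (a.+1%:R * eps n).
have Bq : B q.
  apply: (ball_solid OB Bp) => l; rewrite /q /put; case: ifP => _.
    by rewrite mulr_ge0//= ler_wpM2r// ler_nat.
  by rewrite (ball_ge0 OB Bw0) lexx.
have [p' p'n qE] := state_slot (states_put w0n Bq).
have kp' : (k <= p')%N.
  rewrite leqNgt; apply/negP => p'k; apply: w0k; exists p'; split => //.
  by rewrite -qE; exact: ball_le_refl OB _ _.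
suff : (b - a.+1 <= c)%N by nat_lia.
apply/max_stepsP; first nat_lia.
have e : a.+1%:R * eps n + (b - a.+1)%:R * eps n = b%:R * eps n.
  by rewrite -mulrDl -natrD subnKC.
move=> v vn vk; have [Bv vs] := statesP vn.
have vq : le n.+1 v q by rewrite /q qE; apply: entry_le => //; nat_lia.
have [|||+ +] := ball_le_put OB Bw0 Bv w0s vs _ _ vq (b := (b - a.+1)%:R * eps n).
- by rewrite mulr_gt0// ltr0Sn.
- by rewrite mulr_ge0.
- by rewrite e.
- rewrite e => Bvb lvb.
  by exists p; split => //; exact: (ball_le_trans OB) lvb lp.
Qed.

Definition block_spec n (S : seq (nat * R)) : Prop :=
  [/\ all (fun p => (p.1 < size (slots n))%N && (0 <= p.2)) S,
      forall i j t, chain S i j t -> weight t <= 9 * gauge n i (maxn i j) &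
      forall i j, (i < j <= size (slots n))%N ->
        exists2 t, chain S i j t & gauge n i j <= 128 * weight t].

Lemma block_exists n : exists S, block_spec n S.
Proof.
apply: window_list_exists; first exact: gauge_refl.
- exact: gauge_gt0.
- exact: gauge_mono.
- exact: gauge_sub.
Qed.

Definition block n : seq (nat * R) := projT1 (cid (block_exists n)).

Lemma blockP n : block_spec n (block n).
Proof. exact: projT2 (cid (block_exists n)). Qed.

(* A point [(n, (p, c))] belongs to the block of the n-th coordinate, sits in
   slot [p] and carries the coefficient [c]. *)
Local Notation point := (nat * (nat * R))%type.

Definition state_of (a : point) : nat -> R := slot a.1 a.2.1.

(* [below a b]: the index of [a] being smaller than that of [b], the rational
   attached to [a] must be smaller than the one attached to [b]. *)
Definition below (a b : point) : bool :=
  if a.1 == b.1 then (a.2.1 < b.2.1)%N else leb b.1.+1 (state_of a) (state_of b).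

Fixpoint points (N : nat) : seq point :=
  if N isn't n.+1 then [::] else points n ++ [seq (n, q) | q <- block n].

Lemma points_lt N a : a \in points N -> (a.1 < N)%N.
Proof.
elim: N => [//|N IH] /=; rewrite mem_cat => /orP[/IH|/mapP[q _ ->]//].
exact: ltnW.
Qed.

Lemma points_ge0 N a : a \in points N -> 0 <= a.2.2.
Proof.
elim: N => [//|N IH] /=; rewrite mem_cat => /orP[/IH//|/mapP[q qS ->]/=].
by have [/allP/(_ _ qS)/andP[]] := blockP N.
Qed.

Lemma points_slot N a : a \in points N -> (a.2.1 < size (slots a.1))%N.
Proof.
elim: N => [//|N IH] /=; rewrite mem_cat => /orP[/IH//|/mapP[q qS ->]/=].
by have [/allP/(_ _ qS)/andP[]] := blockP N.
Qed.

Lemma subseq_map (T1 T2 : eqType) (h : T1 -> T2) (s : seq T1) t :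
  subseq t (map h s) -> exists2 u, subseq u s & t = map h u.
Proof.
move=> /subseqP[m]; rewrite size_map => ms ->.
by exists (mask m s); rewrite ?mask_subseq// map_mask.
Qed.

Lemma le_states n x y k : (n <= k)%N -> le n x y -> le k x y.
Proof.
move=> /subnKC <-; elim: (k - n)%N => [|m IH]; first by rewrite addn0.
by rewrite addnS => /IH h; exact: (ball_le_succ OB h).
Qed.

Lemma le0 n x : B x -> le n (fun=> 0) x.
Proof.
by move=> Bx; apply: ball_le_mono OB _ _ _ _ => i; rewrite lexx (ball_ge0 OB).
Qed.

(** Induction on the blocks. [w] is 0 or the state of the last point collected, and [b] stays below
    it, so that [ball_le_put] lets [b] receive what the next block contributes. One step per block
    pays for the additional step of the gauge and one for the positive increment that [ball_le_put]
    requires, whence [2 * eps n]. *)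
Lemma gain_upper N t : subseq t (points N) -> pairwise below t ->
  exists b w, [/\ B b, supp_lt N b, w \in states N, le N b w &
    (w = (fun=> 0) \/ exists2 a, a \in t & w = state_of a)
    /\ forall x : nat -> R, (forall n, 0 <= x n) ->
      \sum_(a <- t) a.2.2 * x a.1 <=
        9 * \sum_(n < N) (b n + 2 * eps n) * x n].
Proof.
elim: N t => [|N IH] t.
  move=> /eqP -> _; exists (fun=> 0), (fun=> 0); split => //.
  - exact: ball0.
  - by rewrite mem_seq1.
  - exact: ball_le_refl OB _ _.
  - split; first by left.
    by move=> x _; rewrite big_nil big_ord0 mulr0.
move=> /subseq_catE[t1 [t2 [-> t1S /subseq_map[u uS ->]]]].
rewrite pairwise_cat => /and3P[/allrelP t1u pt1 pu].
have [b [w [Bb bs wN bw [wt bx]]]] := IH _ t1S pt1.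
have us : sorted ltn (unzip1 u).
  rewrite (sorted_pairwise ltn_trans) pairwise_map; move: pu.
  rewrite pairwise_map; apply: sub_pairwise => p q.
  by rewrite /relpre/= /below/= eqxx.
have wS := states_succ wN; have bS : supp_lt N.+1 b.
  by move=> i Ni; apply: bs; nat_lia.
have sum_extend (x c : nat -> R) : (forall n, (n < N)%N -> c n = b n) ->
   \sum_(n < N.+1) (c n + 2 * eps n) * x n =
   \sum_(n < N) (b n + 2 * eps n) * x n + (c N + 2 * eps N) * x N.
  move=> cb; rewrite big_ord_recr/=; congr (_ + _).
  by apply: eq_bigr => i _; rewrite cb.
have [u0|u0] := eqVneq u [::].
  exists b, w; split => //; first exact: ball_le_succ OB _ _ _ bw.
  split; first by rewrite u0/= cats0.
  move=> x x0; rewrite u0 cats0 sum_extend// mulrDr (le_trans (bx x x0))// lerDl.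
  by rewrite !mulr_ge0// addr_ge0// ?(ball_ge0 OB)// mulr_ge0.
have [/allP bsl bup _] := blockP N.
have [q [qu ql]] : exists q, q \in u /\ forall r, r \in u -> (r.1 <= q.1)%N.
  have [q0 q0u] : exists q0, q0 \in u.
    by case: u u0 {uS pu us t1u} => // q0 u _; exists q0; exact: mem_head.
  have : exists m, has (fun r => r.1 == m) u.
    by exists q0.1; apply/hasP; exists q0.
  move=> ex; have [|m /hasP[q qu /eqP qm] mmax] := @ex_maxnP _ (size (slots N)) ex.
    by move=> m /hasP[r ru /eqP <-]; have /andP[/ltnW] := bsl _ (mem_subseq uS ru).
  exists q; split => // r ru; rewrite qm; apply: mmax.
  by apply/hasP; exists r.
have slot_u r : r \in u -> (r.1 < size (slots N))%N.
  by move=> ru; have /andP[] := bsl _ (mem_subseq uS ru).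
(* All the points taken from block [N] sit above [w], hence at its entry or later. *)
have w_le r : r \in u -> le N.+1 w (slot N r.1).
  move=> ru; case: wt => [->|[a at1 ->]].
    by apply: le0; case: (statesP (slot_mem (slot_u r ru))).
  have := t1u a (N, r) at1 (map_f _ ru); rewrite /below/= ltn_eqF.
    by move/asboolP.
  by apply: (@points_lt N); exact: mem_subseq at1.
have w_q := w_le q qu.
have uc : chain (block N) (entry N w) q.1.+1 u.
  apply/and3P; split => //; apply/allP => r ru.
  by rewrite ltnS (ql _ ru) le_entry// ?slot_u//; exact: w_le.
have iq : (entry N w < q.1.+1)%N.
  by rewrite ltnS le_entry// slot_u.
have wt_u : weight u <= 9 * ((max_steps N (entry N w) q.1.+1).+1%:R * eps N).
  have := bup _ _ _ uc.
  by rewrite (maxn_idPr (ltnW iq)) /gauge iq.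
have sum_u (x : nat -> R) : \sum_(a <- [seq (N, q) | q <- u]) a.2.2 * x a.1 = weight u * x N.
  by rewrite big_map /weight mulr_suml.
have w'_mem : slot N q.1 \in states N.+1 by exact: slot_mem (slot_u _ qu).
have w'_in : exists2 a, a \in t1 ++ [seq (N, q) | q <- u] & slot N q.1 = state_of a.
  by exists (N, q) => //; rewrite mem_cat map_f ?orbT.
have extend (c : nat -> R) : (forall n, (n < N)%N -> c n = b n) ->
    (max_steps N (entry N w) q.1.+1).+1%:R * eps N <= c N + 2 * eps N ->
    forall x : nat -> R, (forall n, 0 <= x n) ->
      \sum_(a <- t1 ++ [seq (N, q) | q <- u]) a.2.2 * x a.1 <=
        9 * \sum_(n < N.+1) (c n + 2 * eps n) * x n.
  move=> cb cN x x0; rewrite big_cat sum_u sum_extend// mulrDr lerD// ?bx//.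
  rewrite mulrA ler_wpM2r//; apply: le_trans wt_u _.
  by rewrite ler_wpM2l.
(* If no step is available, the weight is at most [9 * eps N] and [b] is kept. *)
case km : (max_steps N (entry N w) q.1.+1) => [|k] in extend *.
  exists b, (slot N q.1); split => //.
    exact: (ball_le_trans OB) (ball_le_succ OB bw) w_q.
  split; first by right.
  apply: extend => //; rewrite mul1r (bs N)// add0r.
  by have := eps_ge0 N; lra.
(* Of the [k + 1] steps one is spent on raising [w], to have a positive increment, and [k] are given
   to [b]. *)
have : steps N (entry N w) q.1.+1 k.+1 by apply/max_stepsP; rewrite ?km.
move=> /(_ w wN (leqnn _))[p [pj pS]].
have -> : k.+1%:R * eps N = eps N + k%:R * eps N.
  by rewrite -natr1 mulrDl mul1r addrC.
move=> Bp wp; have [Bw ws] := statesP wN.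
have bw' : le N.+1 b (put w N (eps N)).
  apply: (ball_le_trans OB) (ball_le_succ OB bw) _; apply: (ball_le_mono OB) => i.
  rewrite (ball_ge0 OB Bw) /put; case: eqP => [->|_]; last by rewrite lexx.
  by rewrite (ws N (leqnn N)) eps_ge0.
have [||Bb' lb'] := ball_le_put OB Bw Bb ws bs _ _ bw' Bp => //.
  by rewrite mulr_ge0.
exists (put b N (k%:R * eps N)), (slot N q.1); split => //.
- by move=> i Ni; rewrite put_other ?bs//; nat_lia.
- apply: (ball_le_trans OB) lb' _; apply: (ball_le_trans OB) wp _.
  by apply: slot_le => //; exact: slot_u.
- split; first by right.
  apply: extend => [n nN|]; first by rewrite put_other//; nat_lia.
  by rewrite put_same -natr1 -natr1 !mulrDl mul1r; lra.
Qed.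

Definition rounding (a : nat -> R) (N i : nat) : R :=
  if (i < N)%N then (Num.truncn (a i / eps i))%:R * eps i else 0.

Lemma rounding_le a N i : B a -> 0 <= rounding a N i <= a i.
Proof.
move=> Ba; have a0 := ball_ge0 OB Ba i; rewrite /rounding; case: ifP => _; last first.
  by rewrite lexx a0.
rewrite mulr_ge0//= -ler_pdivlMr//.
by rewrite truncn_le divr_ge0.
Qed.

Lemma roundingS a N : rounding a N.+1 =
  put (rounding a N) N ((Num.truncn (a N / eps N))%:R * eps N).
Proof.
apply/funext => i; rewrite /rounding /put ltnS leq_eqVlt.
by case: eqP => [->|].
Qed.

Lemma rounding_states a N : B a -> rounding a N \in states N.
Proof.
move=> Ba; elim: N => [|N IH].
  by rewrite mem_seq1; apply/eqP/funext.
rewrite roundingS; apply: states_put => //; rewrite -roundingS.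
by apply: (ball_solid OB Ba) => i; exact: rounding_le.
Qed.

(** In block [N] the chain leads from the entry of the rounding [w] to the slot of the next rounding
    [w']. By [ball_le_put], every state preceding [w] can receive all but one of the [q] steps from
    [w] to [w']; with its additional step the gauge is therefore at least [q * eps N]. *)
Lemma gain_lower a N : B a -> exists t, [/\ subseq t (points N),
  pairwise below t,
  forall p, p \in t -> le N (state_of p) (rounding a N) &
  forall x : nat -> R, (forall n, 0 <= x n) ->
    \sum_(n < N) (a n - eps n) * x n <= 128 * \sum_(p <- t) p.2.2 * x p.1].
Proof.
move=> Ba; elim: N => [|N [t [tS tb tw tx]]].
  by exists [::]; split => // x _; rewrite big_nil big_ord0 mulr0.
have wN := rounding_states N Ba; have w'N := rounding_states N.+1 Ba.
set w := rounding a N in tw wN; set w' := rounding a N.+1 in w'N *.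
have [p0 p0s wE] := state_slot (states_succ wN).
have [p ps w'E] := state_slot w'N.
have ww' : le N.+1 w w'.
  apply: (ball_le_mono OB) => i; rewrite /w /w' /rounding.
  have [iN|Ni] := ltnP i N; first by rewrite ltnS ltnW// mulr_ge0/=.
  by case: ifP => _; rewrite !lexx// mulr_ge0.
have ip : (entry N w <= p)%N by apply: le_entry => //; rewrite -w'E.
have [/allP bsl _ blow] := blockP N.
have [u /and3P[uS us ua] uw] := blow (entry N w) p.+1 ltac:(nat_lia).
set q := Num.truncn (a N / eps N).
have q_gauge : q%:R * eps N <= gauge N (entry N w) p.+1.
  rewrite /gauge ltnS ip ler_wpM2r// ler_nat.
  case qE : q => [//|k]; rewrite ltnS.
  apply/max_stepsP => // v vN vi; have [Bv vs] := statesP vN.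
  have [Bw ws] := statesP wN.
  have vw : le N.+1 v w.
    rewrite wE; apply: entry_le => //; apply: leq_trans vi _.
    by apply: le_entry => //; rewrite wE; exact: ball_le_refl OB _ _.
  have vw' : le N.+1 v (put w N (eps N)).
    apply: (ball_le_trans OB) vw _; apply: (ball_le_mono OB) => i.
    rewrite (ball_ge0 OB Bw) /put; case: eqP => [->|_]; last by rewrite lexx.
    by rewrite (ws N (leqnn N)) eps_ge0.
  have w'E2 : w' = put w N (eps N + k%:R * eps N).
    by rewrite /w' roundingS -/q qE -natr1 mulrDl mul1r addrC.
  have Bw' : B (put w N (eps N + k%:R * eps N)).
    by rewrite -w'E2; case: (statesP w'N).
  have [||Bv' lv'] := ball_le_put OB Bw Bv ws vs _ _ vw' Bw' => //.
    by rewrite mulr_ge0.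
  by exists p; split => //; rewrite -w'E w'E2.
have slot_u r : r \in u -> (r.1 < size (slots N))%N.
  by move=> ru; have /andP[] := bsl _ (mem_subseq uS ru).
have u_ge r : r \in u -> le N.+1 w (slot N r.1).
  by move=> ru; apply: entry_le (slot_u _ ru) _; have /andP[] := allP ua _ ru.
have u_le r : r \in u -> le N.+1 (slot N r.1) w'.
  move=> ru; rewrite w'E; apply: slot_le => //.
  by rewrite -ltnS; have /andP[] := allP ua _ ru.
exists (t ++ [seq (N, r) | r <- u]); split.
- exact: cat_subseq (map_subseq _ uS).
- rewrite pairwise_cat tb/=; apply/andP; split.
    apply/allrelP => r' _ r't /mapP[r ru ->]; rewrite /below/= ltn_eqF.
      apply/asboolP; apply: (ball_le_trans OB) (u_ge r ru).
      exact/(ball_le_succ OB)/tw.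
    by apply: (@points_lt N); exact: mem_subseq r't.
  rewrite pairwise_map; move: us.
  rewrite (sorted_pairwise ltn_trans) pairwise_map; apply: sub_pairwise => r r'.
  by rewrite /relpre/= /below/= eqxx.
- move=> r; rewrite mem_cat => /orP[/tw h|/mapP[r' r'u ->]].
    by apply: (ball_le_trans OB) ww'; exact: (ball_le_succ OB).
  exact: u_le.
- move=> x x0; rewrite big_ord_recr big_cat/= mulrDr lerD ?tx//.
  rewrite big_map/= -mulr_suml mulrA ler_wpM2r//.
  apply: le_trans uw; apply: le_trans q_gauge.
  have := truncnS_gt (a N / eps N).
  by rewrite ltr_pdivrMr// -natr1 mulrDl mul1r -/q; lra.
Qed.

End Blocks.

(** * Prescribing an increasing pattern *)

Section Selection.
Variable f : nat -> rat.
Hypothesis f_bij : bijective f.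

(** Induction on [M]: if the index found is [M] itself, the interval from [a] to [f M] contains the
    value of another one. *)
Lemma large_index_between M a b : a < b -> exists2 m, (M <= m)%N & a < f m < b.
Proof.
have [g _ fK] := f_bij.
elim: M a b => [|M IH] a b ab.
  by exists (g ((a + b) / 2)) => //; rewrite fK !midf_lt.
have [m Mm /andP[am mb]] := IH a b ab.
have [mM|mM] := eqVneq m M; last by exists m; rewrite ?am//; lia.
have [m' Mm' /andP[am' m'm]] := IH a (f m) am.
exists m'; last by rewrite am' (lt_trans m'm).
by rewrite ltn_neqAle Mm' andbT; apply: contraTneq m'm => <-; rewrite mM ltxx.
Qed.

Lemma seq_max (s : seq rat) : s != [::] -> exists2 a, a \in s & all (<= a) s.
Proof.
elim: s => // x [|y s] IH _; first by exists x; rewrite ?mem_head//= lexx.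
have [a ain alla] := IH isT; have [xa|/ltW ax] := leP x a.
  by exists a; [rewrite inE ain orbT|rewrite /= xa].
exists x; first exact: mem_head.
by rewrite /= lexx/=; apply: sub_all alla => z /= za; exact: le_trans ax.
Qed.

Lemma seq_min (s : seq rat) : s != [::] -> exists2 a, a \in s & all (>= a) s.
Proof.
move=> s0; have [] := @seq_max [seq - x | x <- s]; first by case: s s0.
move=> _ /mapP[a ain ->] /allP h; exists a => //; apply/allP => x xs /=.
by rewrite -lerN2; apply: h; exact: map_f.
Qed.

Lemma separate (L U : seq rat) :
  (forall l u, l \in L -> u \in U -> l < u) ->
  exists a b, [/\ a < b, all (<= a) L & all (>= b) U].
Proof.
move=> LU; have [->|L0] := eqVneq L [::].
  have [->|/seq_min[b _ bU]] := eqVneq U [::]; first by exists 0, 1.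
  by exists (b - 1), b; split => //; rewrite ltrBlDr ltrDl.
have [a aL La] := seq_max L0.
have [->|/seq_min[b bU Ub]] := eqVneq U [::].
  by exists a, (a + 1); split => //; rewrite ltrDl.
by exists a, b; split => //; exact: LU.
Qed.

Variable r : rel nat.
Hypothesis r_trans : forall i j k, (i < j < k)%N -> r i j -> r j k -> r i k.
Hypothesis r_cotrans : forall i j k, (i < j < k)%N -> ~~ r i j -> r i k -> r j k.

Let valid (s : seq nat) : Prop := forall i j, (i < j < size s)%N ->
  (nth 0 s i < nth 0 s j)%N /\ (f (nth 0 s i) < f (nth 0 s j)) = r i j.

Let valid_step s : valid s -> exists m, valid (rcons s m).
Proof.
move=> vs; set k := size s; pose h i := f (nth 0%N s i).
have [f' f'K _] := f_bij; have f_inj := can_inj f'K.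
(* The values that have to lie below the new one are smaller than those that have to lie above it;
   this is where [r_trans] and [r_cotrans] enter. *)
have [|a [b [ab La Ub]]] := @separate [seq h i | i <- iota 0 k & r i k]
    [seq h i | i <- iota 0 k & ~~ r i k].
  move=> _ _ /mapP[i + ->] /mapP[j + ->].
  rewrite !mem_filter !mem_iota !add0n /= => /andP[rik ik] /andP[rjk jk].
  have [ij|ji|ij] := ltngtP i j.
  - have [_ ->] := vs i j ltac:(by rewrite ij).
    by apply/negP => /negP nij; case/negP: rjk; apply: r_cotrans rik; rewrite ?ij.
  - have [ss e] := vs j i ltac:(by rewrite ji).
    rewrite lt_neqAle; apply/andP; split.
      by apply/negP => /eqP/f_inj se; move: ss; rewrite se ltnn.
    rewrite leNgt e; apply/negP => rji; case/negP: rjk.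
    by apply: r_trans rji rik; rewrite ji.
  - by rewrite -ij rik in rjk.
have [m sm /andP[am mb]] := large_index_between (\max_(x <- s) x).+1 ab.
exists m => i j; rewrite size_rcons ltnS -/k => /andP[ij].
rewrite leq_eqVlt => /predU1P[jk|jk]; last first.
  by rewrite !nth_rcons -/k jk (ltn_trans ij jk); apply: vs; rewrite ij.
rewrite jk in ij *; rewrite !nth_rcons -/k ltnn eqxx ij; split.
  apply: leq_trans sm; rewrite ltnS.
  by apply: (@leq_bigmax_seq _ s xpredT id (nth 0%N s i)) => //; exact: mem_nth.
case rik : (r i k).
  apply: le_lt_trans am; apply: (allP La); apply: map_f.
  by rewrite mem_filter rik mem_iota.
apply/negbTE; rewrite -leNgt; apply: le_trans (ltW mb) _.
apply: (allP Ub); apply: map_f.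
by rewrite mem_filter rik mem_iota.
Qed.

(** The indices are chosen one by one: the next value goes into the gap left by the finitely many
    previous ones, and density provides an arbitrarily large index there. *)
Lemma realize_below : exists iota : nat -> nat,
  forall i j, (i < j)%N -> (iota i < iota j)%N /\ (f (iota i) < f (iota j)) = r i j.
Proof.
have /choice[next nextP] : forall s, exists m, valid s -> valid (rcons s m).
  move=> s; have [/valid_step[m ?]|ns] := pselect (valid s); first by exists m.
  by exists 0%N.
pose L := fix L n := if n isn't n'.+1 then [::] else rcons (L n') (next (L n')).
have sL n : size (L n) = n by elim: n => //= n IH; rewrite size_rcons IH.
have vL n : valid (L n).
  by elim: n => [|n IH]; [move=> i j; rewrite ltn0 andbF|exact: nextP].
have nL n k : (k < n)%N -> nth 0%N (L n) k = next (L k).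
  elim: n => // n IH; rewrite ltnS leq_eqVlt => /predU1P[->|kn] /=.
    by rewrite nth_rcons sL ltnn eqxx.
  by rewrite nth_rcons sL kn IH.
exists (fun k => next (L k)) => i j ij.
have := vL j.+1 i j; rewrite sL ij ltnSn => /(_ isT).
by rewrite !nL// ltnS ltnW.
Qed.

End Selection.

(** * Placing the points among the indices of the Sierpiński space *)

Section Enumeration.
Variables (R : realType) (f : nat -> rat).
Hypothesis f_bij : bijective f.
Variables (B : set (nat -> R)).
Variables (le : nat -> (nat -> R) -> (nat -> R) -> Prop) (K : R).
Hypothesis OB : ordered_ball B le K.
Variable eps : nat -> R.
Hypothesis eps_gt0 : forall n, 0 < eps n.

Local Notation point := (nat * (nat * R))%type.
Local Notation pts := (points OB eps_gt0).
Local Notation pbelow := (below B le K eps).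
Local Notation pstate := (state_of B le K eps).
Local Notation pblock := (block OB eps_gt0).

Lemma state_of_mem N (a : point) : a \in pts N -> pstate a \in states B K eps a.1.+1.
Proof. by move=> aN; apply: slot_mem; exact: points_slot aN. Qed.

Lemma below_le N M (a b : point) : a \in pts N -> b \in pts M ->
  (a.1 <= b.1)%N -> pbelow a b -> le b.1.+1 (pstate a) (pstate b).
Proof.
move=> aN bM ab; rewrite /below; case: eqP => [e ab2|_ /asboolP//].
rewrite /state_of e; apply: (slot_le OB); first exact: ltnW.
exact: points_slot bM.
Qed.

Lemma not_below_le N M (a b : point) : a \in pts N -> b \in pts M ->
  (a.1 <= b.1)%N -> ~~ pbelow a b -> le b.1.+1 (pstate b) (pstate a).
Proof.
move=> aN bM ab; rewrite /below; case: eqP => [e|_].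
  rewrite -leqNgt /state_of -e => ba; apply: (slot_le OB) => //.
  exact: points_slot aN.
move=> /asboolP nab.
have [Ba sa] := statesP OB (state_of_mem aN).
have [Bb sb] := statesP OB (state_of_mem bM).
have sa' : supp_lt b.1.+1 (pstate a).
  by move=> i bi; apply: sa; exact: leq_trans bi.
by have [|] := ball_le_total OB Ba Bb sa' sb.
Qed.

Lemma below_trans N M L (a b c : point) :
  a \in pts N -> b \in pts M -> c \in pts L ->
  (a.1 <= b.1 <= c.1)%N -> pbelow a b -> pbelow b c -> pbelow a c.
Proof.
move=> aN bM cL /andP[ab bc] lab lbc.
have [ac|ac] := eqVneq a.1 c.1; last first.
  rewrite /below (negbTE ac); apply/asboolP.
  apply: (ball_le_trans OB) (below_le bM cL bc lbc).
  by apply: (le_states OB) (below_le aN bM ab lab).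
have e : a.1 = b.1 by lia.
move: lab lbc; rewrite /below -e ac eqxx; exact: ltn_trans.
Qed.

(** By totality a failure of [below] gives the reverse inequality between the states; inside one
    block the slots themselves are compared. *)
Lemma below_cotrans N M L (a b c : point) :
  a \in pts N -> b \in pts M -> c \in pts L ->
  (a.1 <= b.1 <= c.1)%N -> ~~ pbelow a b -> pbelow a c -> pbelow b c.
Proof.
move=> aN bM cL /andP[ab bc] nab lac.
have [bc'|bc'] := eqVneq b.1 c.1; last first.
  rewrite /below (negbTE bc'); apply/asboolP.
  apply: (ball_le_trans OB) (below_le aN cL (leq_trans ab bc) lac).
  by apply: (le_states OB) (not_below_le aN bM ab nab).
have [ab'|ab'] := eqVneq a.1 b.1.
  move: nab lac; rewrite /below ab' bc' eqxx -leqNgt; exact: leq_ltn_trans.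
have lac' := below_le aN cL (leq_trans ab bc) lac.
rewrite /below bc' eqxx ltnNge; apply/negP => cb.
case/negP: nab; rewrite /below (negbTE ab'); apply/asboolP.
rewrite -bc' in lac'.
apply: (ball_le_trans OB) lac' _; rewrite /state_of bc'; apply: (slot_le OB) => //.
by rewrite -bc'; exact: points_slot bM.
Qed.

Lemma block_nonempty n : pblock n != [::].
Proof.
have [_ _ low] := blockP OB eps_gt0 n.
have sz : (0 < size (slots B le K eps n))%N.
  have : (fun=> 0) \in slots B le K eps n by rewrite mem_slots (states0 OB).
  by case: slots.
have [t /and3P[tS _ _]] := low 0%N (size (slots B le K eps n)) ltac:(by rewrite sz leqnn).
have := gauge_gt0 B le K eps_gt0 n sz.
case: (pblock n) tS => // /eqP ->; rewrite weight_nil mulr0 => /lt_le_trans h /h.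
by rewrite ltxx.
Qed.

Lemma points_size N : (N <= size (pts N))%N.
Proof.
elim: N => //= N IH; rewrite size_cat size_map -[N.+1]addn1 leq_add//.
by rewrite lt0n size_eq0 block_nonempty.
Qed.

Lemma points_prefix N M : (N <= M)%N -> exists2 s,
  pts M = pts N ++ s & all (fun a : point => N <= a.1)%N s.
Proof.
move=> /subnKC <-; elim: (M - N)%N => [|k [s IH sN]].
  by exists [::]; rewrite ?addn0 ?cats0.
rewrite addnS /= IH -catA; eexists; first by [].
by rewrite all_cat sN; apply/allP => _ /mapP[q _ ->]; exact: leq_addr.
Qed.

(** No block is empty, so [points k.+1] has more than [k] elements, and these lists extend one
    another: this is the [k]-th point of the infinite list. *)
Definition label k : point := nth (0%N, (0%N, 0)) (pts k.+1) k.

Lemma nth_points N k : (k < size (pts N))%N ->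
  nth (0%N, (0%N, 0)) (pts N) k = label k.
Proof.
move=> kN; rewrite /label; have [h|h] := leqP N k.+1.
  by have [s -> _] := points_prefix h; rewrite nth_cat kN.
have [s -> _] := points_prefix (ltnW h); rewrite nth_cat.
by rewrite (leq_trans _ (points_size k.+1)).
Qed.

Lemma label_points N k : (k < N)%N -> label k \in pts N.
Proof.
move=> kN; have kS : (k < size (pts N))%N by exact: leq_trans (points_size N).
by rewrite -(nth_points kS) mem_nth.
Qed.

Lemma label_ge N k : (size (pts N) <= k)%N -> (N <= (label k).1)%N.
Proof.
move=> Nk; have kS : (k < size (pts (maxn N k.+1)))%N.
  by apply: leq_trans (points_size _); exact: leq_maxr.
have [s ptsE /allP sN] := points_prefix (leq_maxl N k.+1).
rewrite -(nth_points kS) ptsE nth_cat ltnNge Nk /=; apply/sN/mem_nth.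
by rewrite ltn_subLR// -size_cat -ptsE.
Qed.

Lemma map_label N : [seq label k | k <- iota 0 (size (pts N))] = pts N.
Proof.
apply: (@eq_from_nth _ (0%N, (0%N, 0))); rewrite size_map size_iota// => k kN.
by rewrite (nth_map 0%N) ?size_iota// nth_iota// add0n nth_points.
Qed.

Lemma points_mono N : pairwise (fun a b : point => (a.1 <= b.1)%N) (pts N).
Proof.
elim: N => //= N IH; rewrite pairwise_cat IH/=; apply/andP; split.
  apply/allrelP => a _ aN /mapP[q _ ->]; exact/ltnW/(points_lt aN).
rewrite pairwise_map; apply/(pairwiseP (0%N, 0)) => i j _ _ _.
by rewrite /relpre/=.
Qed.

Lemma label_mono i j : (i < j)%N -> ((label i).1 <= (label j).1)%N.
Proof.
move=> ij; have jS := points_size j.+1.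
rewrite -(@nth_points j.+1 i) ?(leq_trans _ jS)//; last exact: ltnW.
rewrite -(@nth_points j.+1 j)//.
have /(pairwiseP (0%N, (0%N, 0))) h := points_mono j.+1.
by apply: h => //; exact: leq_trans (ltnW _) jS.
Qed.

Lemma index_exists : exists iota : nat -> nat, forall i j, (i < j)%N ->
  (iota i < iota j)%N /\
  (f (iota i) < f (iota j)) = pbelow (label i) (label j).
Proof.
apply: realize_below => // i j k /andP[ij jk] h1 h2.
  apply: (below_trans (label_points (ltnSn _)) (label_points (ltnSn _))
    (label_points (ltnSn _)) _ h1 h2).
  by rewrite !label_mono.
apply: (below_cotrans (label_points (ltnSn _)) (label_points (ltnSn _))
    (label_points (ltnSn _)) _ h1 h2).
by rewrite !label_mono.
Qed.

Definition spot : nat -> nat := projT1 (cid index_exists).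

Lemma spot_lt i j : (i < j)%N -> (spot i < spot j)%N.
Proof. by move=> ij; case: (projT2 (cid index_exists) i j ij). Qed.

Lemma spot_below i j : (i < j)%N ->
  (f (spot i) < f (spot j)) = pbelow (label i) (label j).
Proof. by move=> ij; case: (projT2 (cid index_exists) i j ij). Qed.

Lemma spot_ge k : (k <= spot k)%N.
Proof. by elim: k => // k /leq_ltn_trans; apply; exact: spot_lt. Qed.

Lemma spot_inj : injective spot.
Proof.
move=> i j e; apply/eqP; case: ltngtP => // /spot_lt; by rewrite e ltnn.
Qed.

(** The image vector: a point [(n, (p, c))] puts [c * x n] at its spot. Stopping at [k = j] loses
    nothing because [k <= spot k]. *)
Definition spread (x : nat -> R) (j : nat) : R :=
  \sum_(k < j.+1 | spot k == j) (label k).2.2 * x (label k).1.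

Lemma spread_spot x k : spread x (spot k) = (label k).2.2 * x (label k).1.
Proof.
have kk : (k < (spot k).+1)%N by rewrite ltnS spot_ge.
rewrite /spread (big_pred1 (Ordinal kk))// => i /=.
by rewrite (inj_eq spot_inj).
Qed.

Lemma spread_other x j : (forall k, spot k != j) -> spread x j = 0.
Proof. by move=> h; rewrite /spread big_pred0// => k; exact/negbTE. Qed.

Lemma spread_linear l x y j : spread (l *: x + y) j = l * spread x j + spread y j.
Proof.
rewrite /spread mulr_sumr -big_split/=; apply: eq_bigr => k _.
by rewrite mulrDr mulrCA.
Qed.

Lemma label_ge0 k : 0 <= (label k).2.2.
Proof. exact: points_ge0 (label_points (ltnSn k)). Qed.

Lemma sum_spread x (ks : seq nat) :
  \sum_(j <- [seq spot k | k <- ks]) `|spread x j| =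
  \sum_(p <- [seq label k | k <- ks]) p.2.2 * `|x p.1|.
Proof.
rewrite !big_map; apply: eq_bigr => k _.
by rewrite spread_spot normrM ger0_norm// label_ge0.
Qed.

(** The elements of [F] that are not spots carry the coefficient 0; on the others the monotonicity
    of [f] is the relation [below] between their points. *)
Lemma increasing_chain (F : {fset nat}) : increasing_sets f F ->
  exists N ks, let t := [seq label k | k <- ks] in
  [/\ subseq t (pts N), pairwise pbelow t,
      (forall k, k \in ks -> spot k \in F) &
      forall x, \sum_(j <- F) `|spread x j| = \sum_(p <- t) p.2.2 * `|x p.1|].
Proof.
move=> iF; set M := (\max_(j <- F) j).+1.
have FM j : j \in F -> (j < M)%N.
  by move=> jF; rewrite ltnS; have := @leq_bigmax_seq _ (enum_fset F) xpredT id j jF isT.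
pose ks := [seq k <- iota 0 M | spot k \in F].
have ksF k : k \in ks -> spot k \in F by rewrite mem_filter => /andP[].
exists M, ks; split => //.
- rewrite -map_label; apply: map_subseq.
  apply: subseq_trans (filter_subseq _ _) _.
  rewrite -(subnKC (points_size M)) iotaD; exact: prefix_subseq.
- rewrite pairwise_map; have : pairwise ltn ks.
    by rewrite -(sorted_pairwise ltn_trans) sorted_filter ?iota_ltn_sorted//; exact: ltn_trans.
  move=> /(pairwiseP 0%N) h; apply/(pairwiseP 0%N) => i j im jm ij.
  have hij : (nth 0%N ks i < nth 0%N ks j)%N := h i j im jm ij.
  rewrite /relpre/= -spot_below//.
  have homoF : {in F &, {homo f : i j / (i < j)%N >-> i < j}} := iF.
  by apply: homoF; [exact/ksF/mem_nth|exact/ksF/mem_nth|exact: spot_lt].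
- move=> x; rewrite -sum_spread.
  rewrite (bigID (fun j => j \in [seq spot k | k <- ks]))/= addrC.
  rewrite [X in X + _]big_seq_cond [X in X + _]big1 ?add0r; last first.
    move=> j /andP[jF jks]; rewrite spread_other ?normr0// => k.
    apply: contra jks => /eqP kj; apply/mapP; exists k => //.
    rewrite mem_filter kj jF mem_iota/= add0n.
    by apply: leq_ltn_trans (FM _ jF); rewrite -kj; exact: spot_ge.
  rewrite -big_filter; apply: perm_big; apply: uniq_perm.
  - by rewrite filter_uniq// fset_uniq.
  - by rewrite (map_inj_uniq spot_inj) filter_uniq// iota_uniq.
  - move=> j; rewrite mem_filter andbC; apply: andb_idl => /mapP[k /ksF kF ->] //.
Qed.

Lemma chain_increasing N t : subseq t (pts N) -> pairwise pbelow t ->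
  exists2 F : {fset nat}, increasing_sets f F &
    forall x, \sum_(j <- F) `|spread x j| = \sum_(p <- t) p.2.2 * `|x p.1|.
Proof.
rewrite -map_label => /subseq_map[ks ksS ->]; rewrite pairwise_map => bks.
have ksu : uniq ks by apply: subseq_uniq ksS _; exact: iota_uniq.
have kss : pairwise ltn ks.
  apply: subseq_pairwise ksS _; rewrite -(sorted_pairwise ltn_trans).
  exact: iota_ltn_sorted.
exists [fset j | j in [seq spot k | k <- ks]]%fset.
  move=> j1 j2; rewrite !inE => /mapP[k1 k1s ->] /mapP[k2 k2s ->] k12.
  have kk : (k1 < k2)%N.
    rewrite ltnNge leq_eqVlt; apply/negP => /predU1P[e|/spot_lt]; move: k12.
      by rewrite e ltnn.
    by lia.
  rewrite spot_below//.
  move/(pairwiseP 0%N): bks => /(_ (index k1 ks) (index k2 ks)).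
  rewrite /relpre !nth_index//; apply; rewrite ?inE ?index_mem//.
  rewrite ltnNge leq_eqVlt; apply/negP => /predU1P[e|e].
    by move: kk; rewrite -(nth_index 0%N k1s) -e nth_index// ltnn.
  move/(pairwiseP 0%N): kss => /(_ (index k2 ks) (index k1 ks)).
  by rewrite !inE !index_mem !nth_index// => /(_ k2s k1s e); lia.
move=> x; rewrite -sum_spread; apply: perm_big.
apply: uniq_perm; rewrite ?fset_uniq// ?(map_inj_uniq spot_inj)// => j.
by rewrite inE.
Qed.

End Enumeration.

(** * The embedding *)

Section Embedding.
Variables (R : realType) (f : nat -> rat).
Hypothesis f_bij : bijective f.
Variables (B : set (nat -> R)).
Variables (le : nat -> (nat -> R) -> (nat -> R) -> Prop) (K : R).
Hypothesis OB : ordered_ball B le K.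
Variables (Y : normedModType R) (c : nat -> Y -> R) (C1 C2 : R).
Hypothesis c_linear : forall n l x y, c n (l *: x + y) = l * c n x + c n y.
Hypothesis C1_ge0 : 0 <= C1.
Hypothesis C2_gt0 : 0 < C2.
Hypothesis pairing_le : forall a N y, B a ->
  \sum_(i < N) a i * `|c i y| <= C1 * `|y|.
Hypothesis norm_le_pairing : forall y M,
  (forall a N, B a -> \sum_(i < N) a i * `|c i y| <= M) -> `|y| <= C2 * M.
Hypothesis pairing_tail : forall y e, 0 < e -> exists N0, forall a N, B a ->
  \sum_(i < N | (N0 <= i)%N) a i * `|c i y| <= e.

(** These add up to 1/2, so that the rounding errors can be absorbed in [norm_le_embed]. *)
Let eps (n : nat) : R := 2^-1 ^+ n.+2.

Let eps_gt0 n : 0 < eps n. Proof. by rewrite exprn_gt0. Qed.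

Let sum_eps N0 N : \sum_(i < N | (N0 <= i)%N) eps i <= 2^-1 ^+ N0.+1.
Proof.
suff -> : \sum_(i < N | (N0 <= i)%N) eps i =
    if (N0 <= N)%N then 2^-1 ^+ N0.+1 - 2^-1 ^+ N.+1 else 0.
  by case: ifP => _; rewrite ?exprn_ge0// lerBlDr lerDl exprn_ge0.
rewrite big_mkcond/=; elim: N => [|N IH].
  by rewrite big_ord0 leqn0; case: eqP => [->|//]; rewrite subrr.
rewrite big_ord_recr/= IH; case: (leqP N0 N) => N0N.
  by rewrite leqW// /eps (exprS _ N.+1); set h := 2^-1 ^+ N.+1; field.
rewrite /= addr0 leq_eqVlt ltnS (leqNgt N0 N) N0N orbF.
by case: eqP => // ->; rewrite subrr.
Qed.

Local Notation spread := (spread f_bij OB eps_gt0).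
Local Notation enorm := (sierpinski_enorm f).

Let coords (y : Y) : nat -> R := fun i => c i y.

Let coord_le n y : `|c n y| <= C1 * `|y|.
Proof.
have := pairing_le n.+1 y (ball_unit OB n).
rewrite (bigD1 ord_max)//= put_same mul1r big1 ?addr0// => i /negbTE.
by move=> /= ni; rewrite /put -[_ == _]/(i == ord_max) ni mul0r.
Qed.

(** In [gain_upper] the pairing with [b] is at most [e], and the errors [2 * eps i] count only from
    [N0] on, where the [eps i] add up to at most [2^-1 ^+ N0.+1]. *)
Let spread_le (x : nat -> R) N0 e D :
  (forall a N, B a -> \sum_(i < N) a i * `|x i| <= e) ->
  (forall i, `|x i| <= D) -> (forall i, (i < N0)%N -> x i = 0) ->
  (enorm (spread x) <= (9 * (e + 2^-1 ^+ N0 * D))%:E)%E.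
Proof.
move=> xe xD x0; apply: sierpinski_enorm_le => F iF; rewrite lee_fin.
have [N [ks /= [tS tb _ ->]]] := increasing_chain f_bij OB eps_gt0 iF.
have [b [w [Bb _ _ _ [_ /(_ (fun i => `|x i|))]]]] := gain_upper tS tb.
move=> /(_ (fun i => normr_ge0 _)) /le_trans; apply; rewrite ler_wpM2l//.
under eq_bigr do rewrite mulrDl.
rewrite big_split/= lerD ?xe//.
have D0 : 0 <= D by exact: le_trans (xD 0%N).
apply: (@le_trans _ _ (\sum_(i < N | (N0 <= i)%N) eps i * (2 * D))).
  rewrite [leRHS]big_mkcond/=; apply: ler_sum => i _; case: leqP => [_|iN].
    by rewrite -mulrA mulrCA ler_wpM2l// ?ler_wpM2l// ltW.
  by rewrite x0// normr0 mulr0.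
rewrite -mulr_suml; apply: le_trans (ler_wpM2r _ (sum_eps N0 N)) _.
  by rewrite mulr_ge0.
by rewrite exprS; set h := 2^-1 ^+ N0; have -> : 2^-1 * h * (2 * D) = h * D by field.
Qed.

Let spread_coords_le y : (enorm (spread (coords y)) <= (18 * C1 * `|y|)%:E)%E.
Proof.
have -> : 18 * C1 * `|y| = 9 * (C1 * `|y| + 2^-1 ^+ 0 * (C1 * `|y|)) by rewrite expr0; ring.
by apply: spread_le => // [a N Ba|i]; [exact: pairing_le|exact: coord_le].
Qed.

(** Past the spots of the first [M] blocks the vector is dominated by the image of the coordinates
    from [M] on; for large [M] both terms of [spread_le] are small. *)
Let spread_carrier y : sierpinski_carrier f (spread (coords y)).
Proof.
suff H e : 0 < e -> \forall n \near \oo, (enorm (tail n (spread (coords y))) <= e%:E)%E.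
  apply/fine_cvgP; split.
    near=> n; rewrite ge0_fin_numE ?sierpinski_enorm_ge0//.
    by apply: (@le_lt_trans _ _ 1%E); [near: n; exact: H|exact: ltry].
  apply/cvgrPdist_le => e e0; near=> n; rewrite sub0r normrN.
  rewrite ger0_norm ?fine_ge0 ?sierpinski_enorm_ge0//.
  have h : (enorm (tail n (spread (coords y))) <= e%:E)%E by near: n; exact: H.
  rewrite -lee_fin fineK// ge0_fin_numE ?sierpinski_enorm_ge0//.
  exact: le_lt_trans h (ltry e).
move=> e0; have e18 : 0 < e / 18 by rewrite divr_gt0.
have [N0 yN0] := pairing_tail y e18.
have [N1 N1e] : exists N1, 2^-1 ^+ N1 * (C1 * `|y|) <= e / 18.
  have h1 : (fun n => 2^-1 ^+ n * (C1 * `|y|)) @ \oo --> (0 : R).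
    rewrite -[X in _ --> X](mul0r (C1 * `|y|)); apply: cvgMl.
    by apply: cvg_expr; rewrite ger0_norm ?invr_ge0// invf_lt1 ?ltr1n.
  have /cvgrPdist_le/(_ _ e18)[N1 _ /(_ N1 (leqnn N1))] := h1.
  rewrite /= sub0r normrN ger0_norm; first by exists N1.
  by rewrite !mulr_ge0 ?exprn_ge0.
pose M := maxn N0 N1.
pose x i := if (M <= i)%N then c i y else 0.
have xc i : `|x i| <= `|c i y| by rewrite /x; case: ifP => // _; rewrite normr0.
have xb : (enorm (spread x) <= (9 * (e / 18 + 2^-1 ^+ M * (C1 * `|y|)))%:E)%E.
  apply: spread_le.
  - move=> a N Ba; apply: le_trans (yN0 a N Ba).
    rewrite [leRHS]big_mkcond/=; apply: ler_sum => i _; rewrite /x.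
    case: (leqP M i) => Mi; last first.
      by rewrite normr0 mulr0; case: ifP => // _; rewrite mulr_ge0// (ball_ge0 OB).
    by rewrite (leq_trans (leq_maxl _ _) Mi).
  - by move=> i; exact: le_trans (xc i) (coord_le i y).
  - by move=> i; rewrite /x ltnNge => /negbTE ->.
exists (spot f_bij OB eps_gt0 (size (points OB eps_gt0 M))) => // n /= Mn.
apply: le_trans (le_trans xb _); last first.
  rewrite lee_fin; have : 2^-1 ^+ M * (C1 * `|y|) <= 2^-1 ^+ N1 * (C1 * `|y|).
    rewrite ler_wpM2r ?mulr_ge0//; apply: ler_wiXn2l; rewrite ?invr_ge0// ?invf_le1 ?ler1n//.
    exact: leq_maxr.
  by move: N1e; lra.
apply: sierpinski_enorm_le => F iF; apply: le_trans (sierpinski_enorm_ub _ iF).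
rewrite lee_fin; apply: ler_sum => j _; rewrite /tail.
case: (leqP n j) => nj; last by rewrite normr0.
have [[k kj]|nk] := pselect (exists k, spot f_bij OB eps_gt0 k = j); last first.
  by rewrite spread_other ?normr0// => k; apply/eqP => kj; apply: nk; exists k.
rewrite -kj !spread_spot /x ifT//; apply: label_ge.
rewrite leqNgt; apply/negP => /(spot_lt f_bij OB eps_gt0); rewrite kj; lia.
Unshelve. all: by end_near. Qed.

Let embed (y : Y) : sierpinski_space R f.
Proof.
by refine (@SubspaceElt _ _ _ (spread (coords y)) _);
  exact: mem_set (spread_carrier y).
Defined.

Let embed_linear : linear embed.
Proof.
move=> l x y; apply/val_inj/funext => j.
change (spread (coords (l *: x + y)) j = l * spread (coords x) j + spread (coords y) j).
rewrite -spread_linear; suff -> : coords (l *: x + y) = l *: coords x + coords y by [].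
by apply/funext => i; exact: c_linear.
Qed.

Let embed_normE y : (`|embed y|)%:E = enorm (spread (coords y)).
Proof. exact: sierpinski_normE (spread_carrier y). Qed.

Let pairing_embed a N y : B a ->
  \sum_(i < N) (a i - eps i) * `|c i y| <= 128 * `|embed y|.
Proof.
move=> Ba; have [t [tS tb _ tx]] := gain_lower OB eps_gt0 N Ba.
have [F iF FE] := chain_increasing f_bij tS tb.
apply: le_trans (tx (fun i => `|c i y|) (fun i => normr_ge0 _)) _.
rewrite ler_wpM2l// -lee_fin embed_normE.
by rewrite -(FE (coords y)); exact: sierpinski_enorm_ub.
Qed.

(** Every [|c i y|] is at most [sup A], so the error in [pairing_embed] is at most [sup A / 2] and
    is absorbed, which doubles the constant 128. *)
Let norm_le_embed y : `|y| <= C2 * (256 * `|embed y|).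
Proof.
pose A := [set s | exists a N, B a /\ s = \sum_(i < N) a i * `|c i y|].
have A0 : has_sup A.
  split; first by exists 0, (fun=> 0), 0%N; rewrite big_ord0; split => //; exact: ball0 OB.
  by exists (C1 * `|y|) => _ [a [N [Ba ->]]]; exact: pairing_le.
have supA a N : B a -> \sum_(i < N) a i * `|c i y| <= sup A.
  by move=> Ba; apply: ub_le_sup; [exact: A0.2|exists a, N].
have supA_coord n : `|c n y| <= sup A.
  have := supA _ n.+1 (ball_unit OB n).
  rewrite (bigD1 ord_max)//= put_same mul1r big1 ?addr0// => i /negbTE.
  by move=> /= ni; rewrite /put -[_ == _]/(i == ord_max) ni mul0r.
have sA0 : 0 <= sup A by exact: le_trans (supA_coord 0%N).
suff : sup A <= 128 * `|embed y| + sup A / 2.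
  move=> h; apply: norm_le_pairing => a N Ba; apply: le_trans (supA a N Ba) _.
  by lra.
apply: ge_sup; first exact: A0.1.
move=> _ [a [N [Ba ->]]].
have -> : \sum_(i < N) a i * `|c i y| =
    \sum_(i < N) (a i - eps i) * `|c i y| + \sum_(i < N) eps i * `|c i y|.
  by rewrite -big_split/=; apply: eq_bigr => i _; rewrite -mulrDl subrK.
rewrite lerD ?pairing_embed//.
apply: (@le_trans _ _ (\sum_(i < N | (0 <= i)%N) eps i * sup A)).
  by apply: ler_sum => i _; rewrite ler_wpM2l// ltW.
rewrite -mulr_suml mulrC ler_wpM2l//; exact: (sum_eps 0 N).
Qed.

Theorem embedding : contains_copy (sierpinski_space R f) Y.
Proof.
pose T : {linear Y -> sierpinski_space R f} :=
  HB.pack embed (GRing.isLinear.Build R Y (sierpinski_space R f) *:%R embed embed_linear).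
exists T.
  apply: bounded_linear_continuous; apply/linear_boundedP.
  exists (18 * C1); split; first exact: num_real.
  move=> r /ltW rC y.
  change (`|embed y| <= r * `|y|); rewrite -lee_fin embed_normE.
  by apply: le_trans (spread_coords_le y) _; rewrite lee_fin ler_wpM2r.
exists (C2 * 256)^-1; first by rewrite invr_gt0 mulr_gt0.
by move=> y; rewrite ler_pdivrMl ?mulr_gt0// -mulrA; exact: norm_le_embed.
Qed.

End Embedding.

(** * Modular spaces *)

Section Modular.
Variables (R : realType) (phi : nat -> R -> R).
Hypothesis phi_ge0 : forall i t, 0 <= t <= 1 -> 0 <= phi i t.
Hypothesis phi0 : forall i, phi i 0 = 0.
Hypothesis phi1 : forall i, phi i 1 <= 1.
Hypothesis phi_convex : forall i s t l, 0 <= s <= 1 -> 0 <= t <= 1 ->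
  0 <= l <= 1 -> phi i (l * s + (1 - l) * t) <= l * phi i s + (1 - l) * phi i t.

Lemma phi_mono i s t : 0 <= s -> s <= t -> t <= 1 -> phi i s <= phi i t.
Proof.
move=> s0 st t1; have [t0|t0] := leP t 0.
  by rewrite (_ : s = t)//; lra.
have e : s = s / t * t + (1 - s / t) * 0 by rewrite mulr0 addr0 divfK// gt_eqF.
have st01 : 0 <= s / t <= 1.
  by rewrite divr_ge0 ?ler_pdivrMr ?mul1r//; lra.
have := phi_convex i (s := t) (t := 0) ltac:(lra) ltac:(lra) st01.
rewrite -e phi0 mulr0 addr0 => /le_trans; apply.
by rewrite ler_piMl ?phi_ge0//; lra.
Qed.

(** The slopes of adjacent chords of a convex function increase; the divisions are cleared. *)
Lemma phi_chord i s t r : 0 <= s -> s < t -> t < r -> r <= 1 ->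
  (phi i t - phi i s) * (r - t) <= (phi i r - phi i t) * (t - s).
Proof.
move=> s0 st tr r1; have rs : 0 < r - s by lra.
set l := (r - t) / (r - s).
have l01 : 0 <= l <= 1.
  by rewrite /l divr_ge0 ?ler_pdivrMr ?mul1r//; lra.
have e : l * s + (1 - l) * r = t by rewrite /l; field; lra.
have := phi_convex i (s := s) (t := r) ltac:(lra) ltac:(lra) l01.
rewrite e -(ler_pM2r rs).
have -> : (l * phi i s + (1 - l) * phi i r) * (r - s) =
  (r - t) * phi i s + (t - s) * phi i r by rewrite /l; field; lra.
by nra.
Qed.

(* The conjugate of [phi i], where [phi i] is understood to be infinite
   beyond 1. *)
Definition conjugate (i : nat) (a : R) : R :=
  sup [set a * t - phi i t | t in [set t | 0 <= t <= 1]].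

Let conj_has_sup i a : has_sup [set a * t - phi i t | t in [set t | 0 <= t <= 1]].
Proof.
split; first by exists (a * 0 - phi i 0), 0 => //=; lra.
exists `|a| => _ [t /= t01 <-]; have := phi_ge0 i t01.
have : a * t <= `|a|.
  apply: le_trans (ler_norm _) _; rewrite normrM ler_piMr// ger0_norm; lra.
lra.
Qed.

Lemma conj_ge i a t : 0 <= t <= 1 -> a * t - phi i t <= conjugate i a.
Proof. by move=> t01; apply: ub_le_sup; [case: (conj_has_sup i a)|exists t]. Qed.

Lemma conj_le i a M : (forall t, 0 <= t <= 1 -> a * t - phi i t <= M) ->
  conjugate i a <= M.
Proof.
move=> h; apply: ge_sup; first by case: (conj_has_sup i a).
by move=> _ [t t01 <-]; exact: h.
Qed.

Lemma young i a t : 0 <= t <= 1 -> a * t <= phi i t + conjugate i a.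
Proof. by move=> /(conj_ge i a); lra. Qed.

Lemma conj_ge0 i a : 0 <= conjugate i a.
Proof. by have := @conj_ge i a 0 ltac:(lra); rewrite phi0; lra. Qed.

Lemma conj0 i : conjugate i 0 = 0.
Proof.
apply/eqP; rewrite eq_le conj_ge0 andbT; apply: conj_le => t t01.
by have := phi_ge0 i t01; lra.
Qed.

Lemma conj_mono i a b : a <= b -> conjugate i a <= conjugate i b.
Proof.
move=> ab; apply: conj_le => t t01; apply: le_trans (conj_ge i b t01).
by rewrite lerD2r ler_wpM2r//; lra.
Qed.

(** Given test points [t] and [s], the larger one tests [a + b]: it does not decrease either linear
    term, and the other value of [phi i] is dropped as nonnegative. *)
Lemma conj_superadditive i a b : 0 <= a -> 0 <= b ->
  conjugate i a + conjugate i b <= conjugate i (a + b).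
Proof.
move=> a0 b0; rewrite -lerBrDr; apply: conj_le => t t01.
rewrite lerBrDr addrC -lerBrDr; apply: conj_le => s s01.
have pt := phi_ge0 i t01; have ps := phi_ge0 i s01.
rewrite lerBrDr; have [st|ts] := leP s t.
  apply: le_trans (conj_ge i (a + b) t01).
  by have : b * s <= b * t by [rewrite ler_wpM2l]; lra.
apply: le_trans (conj_ge i (a + b) s01).
by have : a * t <= a * s by [rewrite ler_wpM2l// ltW]; lra.
Qed.

Lemma conj1 i : conjugate i 1 <= 1.
Proof. by apply: conj_le => t t01; have := phi_ge0 i t01; lra. Qed.

Lemma conj_bound i a : conjugate i a <= 1 -> a <= 2.
Proof. by have := @conj_ge i a 1 ltac:(lra); have := phi1 i; lra. Qed.

Lemma conj_scale i a l : 0 <= l <= 1 -> conjugate i (l * a) <= l * conjugate i a.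
Proof.
move=> l01; apply: conj_le => t t01; have := conj_ge i a t01.
have := phi_ge0 i t01 => p0 h.
apply: (@le_trans _ _ (l * (a * t - phi i t))); last by rewrite ler_wpM2l//; lra.
by nra.
Qed.

(** The slope [a] of the chord over [t / 2, t] replaces that of a supporting line. Outside this
    interval the slopes of chords are compared by convexity, inside it monotonicity suffices. *)
Lemma chord_young i t : 0 <= t <= 1 ->
  exists2 a, 0 <= a & phi i (t / 2) + conjugate i a <= a * t.
Proof.
move=> t01; have [t0|t0] := eqVneq t 0.
  by exists 0; rewrite // t0 mul0r phi0 conj0; lra.
have tgt0 : 0 < t by lra.
have mono2 := @phi_mono i (t / 2) t ltac:(lra) ltac:(lra) ltac:(lra).
set a := (phi i t - phi i (t / 2)) / (t / 2).
have a0 : 0 <= a by rewrite divr_ge0//; lra.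
have aE : a * (t / 2) = phi i t - phi i (t / 2) by rewrite divfK//; lra.
exists a => //; rewrite -lerBrDl; apply: conj_le => s s01.
have [st|ts] := leP s (t / 2).
  have [e|ne] := eqVneq s (t / 2).
    by rewrite e; have : 0 <= a * (t / 2); nra.
  have := @phi_chord i s (t / 2) t ltac:(lra) ltac:(lra) ltac:(lra) ltac:(lra).
  have -> : t - t / 2 = t / 2 by field.
  rewrite -aE; have : 0 < t / 2 by lra.
  move=> t2 h.
  have {}h : phi i (t / 2) - phi i s <= a * (t / 2 - s).
    by rewrite -(ler_pM2r t2); lra.
  by have : 0 <= a * (t / 2); nra.
have [st2|ts2] := leP s t.
  have := @phi_mono i (t / 2) s ltac:(lra) ltac:(lra) ltac:(lra).
  by have : a * s <= a * t by [rewrite ler_wpM2l]; lra.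
have := @phi_chord i (t / 2) t s ltac:(lra) ltac:(lra) ltac:(lra) ltac:(lra).
have -> : t - t / 2 = t / 2 by field.
rewrite -aE; have : 0 < t / 2 by lra.
move=> t2 h.
have {}h : a * (s - t) <= phi i s - phi i t.
  by rewrite -(ler_pM2r t2); lra.
by lra.
Qed.

(** * The ball of the conjugate modular *)

Definition conj_ball : set (nat -> R) :=
  [set a : nat -> R | (forall i, 0 <= a i) /\ forall N, \sum_(i < N) conjugate i (a i) <= 1].

(** For vectors supported in [0, n[ this compares the conjugate modulars; asking for all [m >= n]
    lets the relation pass from [n] to [n.+1]. *)
Definition conj_le_rel (n : nat) (x y : nat -> R) : Prop := forall m, (n <= m)%N ->
  \sum_(i < m) conjugate i (x i) <= \sum_(i < m) conjugate i (y i).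

Lemma sum_conj_mono (x : nat -> R) n m : (n <= m)%N ->
  \sum_(i < n) conjugate i (x i) <= \sum_(i < m) conjugate i (x i).
Proof.
move=> /subnKC <-; elim: (m - n)%N => [|k IH]; first by rewrite addn0.
by rewrite addnS big_ord_recr/= (le_trans IH)// lerDl conj_ge0.
Qed.

Lemma sum_conj_supp x n m : supp_lt n x -> (n <= m)%N ->
  \sum_(i < m) conjugate i (x i) = \sum_(i < n) conjugate i (x i).
Proof.
move=> xn /subnKC <-; elim: (m - n)%N => [|k IH]; first by rewrite addn0.
by rewrite addnS big_ord_recr/= IH xn ?leq_addr// conj0 addr0.
Qed.

Lemma sum_conj_put x n a m : supp_lt n x -> (n < m)%N ->
  \sum_(i < m) conjugate i (put x n a i) = \sum_(i < m) conjugate i (x i) + conjugate n a.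
Proof.
move=> xn nm; rewrite (bigD1 (Ordinal nm))//= put_same.
rewrite [in RHS](bigD1 (Ordinal nm))//= xn// conj0 add0r addrC; congr (_ + _).
apply: eq_bigr => i ni; rewrite put_other//.
Qed.

Lemma conj_ordered_ball : ordered_ball conj_ball conj_le_rel 2.
Proof.
split.
- by move=> x [].
- move=> x y [y0 yN] xy; split=> [i|N]; first by case/andP: (xy i).
  apply: le_trans (yN N); apply: ler_sum => i _; apply: conj_mono.
  by case/andP: (xy i).
- move=> n; split=> [i|N]; first by rewrite /put; case: ifP.
  apply: le_trans (@sum_conj_mono _ N (maxn N n.+1) (leq_maxl _ _)) _.
  rewrite sum_conj_put// ?leq_maxr// big1 ?add0r ?conj1// => i _.
  exact: conj0.
- move=> x [x0 xN] n; apply: (@conj_bound n); apply: le_trans (xN n.+1).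
  by rewrite big_ord_recr/= lerDr sumr_ge0// => i _; exact: conj_ge0.
- by move=> n x m.
- move=> n x y z xy yz m nm; exact: le_trans (xy m nm) (yz m nm).
- move=> n x y _ _ xn yn.
  have [h|/ltW h] := leP (\sum_(i < n) conjugate i (x i)) (\sum_(i < n) conjugate i (y i)).
    by left => m nm; rewrite !(@sum_conj_supp _ n m).
  by right => m nm; rewrite !(@sum_conj_supp _ n m).
- by move=> n x y xy m nm; apply: xy; exact: ltnW.
- move=> n x y xy m _; apply: ler_sum => i _; apply: conj_mono.
  by case/andP: (xy i).
(* Superadditivity: the modular of [y] grows by [conjugate n b], that of [put x n a] by at least as
   much. *)
- move=> n x y a b [x0 xN] [y0 yN] xn yn a0 b0 yxa [xab0 xabN].
  have key m : (n < m)%N -> \sum_(i < m) conjugate i (put y n b i) <=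
      \sum_(i < m) conjugate i (put x n (a + b) i).
    move=> nm; have := yxa m nm; rewrite !sum_conj_put//.
    by have := conj_superadditive n (ltW a0) b0; lra.
  split; last exact: key.
  split=> [i|N]; first by rewrite /put; case: ifP.
  apply: le_trans (@sum_conj_mono _ N (maxn N n.+1) (leq_maxl _ _)) _.
  by apply: le_trans (key _ _) (xabN _); exact: leq_maxr.
Qed.

Lemma conj_ball_pairing (a x : nat -> R) N : conj_ball a ->
  (forall i, (i < N)%N -> 0 <= x i <= 1) ->
  \sum_(i < N) a i * x i <= \sum_(i < N) phi i (x i) + 1.
Proof.
move=> [a0 aN] x01; apply: le_trans (_ : \sum_(i < N) (phi i (x i) + conjugate i (a i)) <= _).
  by apply: ler_sum => i _; apply: young; exact: x01.
by rewrite big_split lerD2l; exact: aN.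
Qed.

Lemma conj_ball_coord (x : nat -> R) n :
  (forall (a : nat -> R) N, conj_ball a -> \sum_(i < N) a i * x i <= 1) -> x n <= 1.
Proof.
move=> xa; have := xa _ n.+1 (ball_unit conj_ordered_ball n).
rewrite (bigD1 ord_max)//= put_same mul1r big1 ?addr0// => i /negbTE.
by move=> /= ni; rewrite /put -[_ == _]/(i == ord_max) ni mul0r.
Qed.

(* If the conjugate modular of the supporting slopes exceeds 1, rescale it to 1. *)
Lemma conj_ball_polar (x : nat -> R) : (forall i, 0 <= x i) ->
  (forall (a : nat -> R) N, conj_ball a -> \sum_(i < N) a i * x i <= 1) ->
  forall N, \sum_(i < N) phi i (x i / 2) <= 1.
Proof.
move=> x0 xa N.
have x01 i : 0 <= x i <= 1 by rewrite x0 conj_ball_coord.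
have /choice[a aP] : forall i, exists a, 0 <= a /\ phi i (x i / 2) + conjugate i a <= a * x i.
  by move=> i; have [a a0 ax] := chord_young i (x01 i); exists a.
pose b i := if (i < N)%N then a i else 0.
have b0 i : 0 <= b i by rewrite /b; case: ifP => // _; case: (aP i).
have bN : supp_lt N b by move=> i Ni; rewrite /b ltnNge Ni.
set s := \sum_(i < N) conjugate i (b i).
have main : \sum_(i < N) phi i (x i / 2) + s <= \sum_(i < N) b i * x i.
  by rewrite -big_split; apply: ler_sum => i _; rewrite /b ltn_ord; case: (aP i).
have bsum m : \sum_(i < m) conjugate i (b i) <= s.
  have [mN|/ltnW Nm] := leqP m N; first exact: sum_conj_mono.
  by rewrite (sum_conj_supp bN).
have [s1|s1] := leP s 1.
  have : conj_ball b by split => // m; exact: le_trans (bsum m) s1.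
  move=> /(xa b N); have : 0 <= s by rewrite sumr_ge0// => i _; exact: conj_ge0.
  lra.
have s0 : 0 < s by lra.
have si : 0 <= s^-1 <= 1 by rewrite invr_ge0 (ltW s0) invf_le1// ltW.
have : conj_ball (fun i => s^-1 * b i).
  split=> [i|m]; first by rewrite mulr_ge0//; lra.
  apply: (@le_trans _ _ (\sum_(i < m) s^-1 * conjugate i (b i))).
    by apply: ler_sum => i _; exact: conj_scale.
  rewrite -mulr_sumr -[leRHS](mulVf (lt0r_neq0 s0)) ler_wpM2l//; lra.
move=> /(xa _ N).
under eq_bigr do rewrite -mulrA.
by rewrite -mulr_sumr ler_pdivrMl// mulr1; lra.
Qed.

(** * Spaces whose norm comes from a modular *)

Variables (f : nat -> rat) (Y : normedModType R) (c : nat -> Y -> R).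
Hypothesis f_bij : bijective f.
Hypothesis c_linear : forall n l x y, c n (l *: x + y) = l * c n x + c n y.
Hypothesis unit_modular : forall y, `|y| < 1 -> (forall i, `|c i y| <= 1) /\
  forall N, \sum_(i < N) phi i `|c i y| <= 1.
Hypothesis modular_unit : forall y, (forall i, `|c i y| <= 1) ->
  (forall N, \sum_(i < N) phi i `|c i y| <= 1) -> `|y| <= 1.
Hypothesis modular_tail : forall y e, 0 < e -> exists N0,
  (forall i, (N0 <= i)%N -> `|c i y| <= e) /\
  forall N, \sum_(i < N | (N0 <= i)%N) phi i (`|c i y| / e) <= 1.

Let c0 n : c n 0 = 0.
Proof.
have := c_linear n 1 0 0; rewrite scaler0 addr0 mul1r; lra.
Qed.

Let cZ n l y : c n (l *: y) = l * c n y.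
Proof. by rewrite -[l *: y]addr0 c_linear c0 addr0. Qed.

Let pairing_le (a : nat -> R) N y : conj_ball a ->
  \sum_(i < N) a i * `|c i y| <= 4 * `|y|.
Proof.
move=> Ba; have [->|y0] := eqVneq y 0.
  by rewrite normr0 mulr0 big1// => i _; rewrite c0 normr0 mulr0.
have ny : 0 < `|y| by rewrite normr_gt0.
(* [unit_modular] asks for a norm strictly below 1, hence the factor 2. *)
set l := (2 * `|y|)^-1; have l0 : 0 < l by rewrite invr_gt0 mulr_gt0.
have ly : `|l *: y| < 1.
  by rewrite normrZ gtr0_norm// /l invfM -mulrA mulVf ?gt_eqF// mulr1 invf_lt1 ?ltr1n.
have [c1 cN] := unit_modular ly.
have := @conj_ball_pairing a (fun i => `|c i (l *: y)|) N Ba.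
move=> /(_ (fun i _ => ltac:(by rewrite normr_ge0 c1))).
have -> : \sum_(i < N) a i * `|c i (l *: y)| = l * \sum_(i < N) a i * `|c i y|.
  by rewrite mulr_sumr; apply: eq_bigr => i _; rewrite cZ normrM gtr0_norm// mulrCA.
have := cN N => h1 h2; have : l * \sum_(i < N) a i * `|c i y| <= 2 by lra.
by rewrite ler_pdivrMl ?mulr_gt0//; lra.
Qed.

(** Divided by [M + e], the coordinates are in the polar of the ball, so that half of them have
    modular at most 1 by [conj_ball_polar]; [e] keeps the divisor positive. *)
Let norm_le_pairing y M :
  (forall (a : nat -> R) N, conj_ball a -> \sum_(i < N) a i * `|c i y| <= M) -> `|y| <= 2 * M.
Proof.
move=> yM; have M0 : 0 <= M.
  by have := yM _ 0%N (ball0 conj_ordered_ball); rewrite big_ord0.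
rewrite mulrC -ler_pdivrMr//; apply/ler_addgt0Pr => e e0.
have Me : 0 < M + e by lra.
rewrite ler_pdivrMr//; set l := (2 * (M + e))^-1.
have l0 : 0 < l by rewrite invr_gt0 mulr_gt0.
have lE i : `|c i (l *: y)| = (M + e)^-1 * `|c i y| / 2.
  rewrite cZ normrM gtr0_norm// /l invfM; ring.
pose x i := (M + e)^-1 * `|c i y|.
have x0 i : 0 <= x i by rewrite mulr_ge0// invr_ge0 ltW.
have xa (a : nat -> R) N : conj_ball a -> \sum_(i < N) a i * x i <= 1.
  move=> Ba; rewrite /x; under eq_bigr do rewrite mulrCA.
  by rewrite -mulr_sumr ler_pdivrMl// mulr1; have := yM a N Ba; lra.
suff : `|l *: y| <= 1.
  by rewrite normrZ gtr0_norm// ler_pdivrMl ?mulr_gt0//; lra.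
apply: modular_unit => [i|N].
  rewrite lE -/(x i); have := @conj_ball_coord x i (fun a N => xa a N); lra.
under eq_bigr do rewrite lE -/(x _).
exact: conj_ball_polar.
Qed.

Theorem modular_embedding : contains_copy (sierpinski_space R f) Y.
Proof.
apply: (embedding f_bij conj_ordered_ball c_linear _ _ pairing_le norm_le_pairing) => //.
move=> y e e0; have e2 : 0 < e / 2 by lra.
have [N0 [ye yN]] := modular_tail y e2; exists N0 => a N Ba.
(* The pairing with the tail divided by [e / 2] is at most 2, hence at most [e] without the
   division. *)
have := @conj_ball_pairing a (fun i => if (N0 <= i)%N then `|c i y| / (e / 2) else 0) N Ba.
have h01 i : (i < N)%N -> 0 <= (if (N0 <= i)%N then `|c i y| / (e / 2) else 0) <= 1.
  move=> _; case: ifP => [/ye h|_]; last by lra.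
  by rewrite divr_ge0//= ?ler_pdivrMr ?mul1r// ltW.
move=> /(_ h01).
have -> : \sum_(i < N) phi i (if (N0 <= i)%N then `|c i y| / (e / 2) else 0) =
    \sum_(i < N | (N0 <= i)%N) phi i (`|c i y| / (e / 2)).
  by rewrite [RHS]big_mkcond/=; apply: eq_bigr => i _; case: ifP.
have -> : \sum_(i < N) a i * (if (N0 <= i)%N then `|c i y| / (e / 2) else 0) =
    (\sum_(i < N | (N0 <= i)%N) a i * `|c i y|) / (e / 2).
  rewrite mulr_suml [RHS]big_mkcond/=; apply: eq_bigr => i _.
  by case: ifP => _; rewrite ?mulr0// mulrA.
have := yN N => h1 h2.
have : (\sum_(i < N | (N0 <= i)%N) a i * `|c i y|) / (e / 2) <= 2 by lra.
by rewrite ler_pdivrMr//; lra.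
Qed.

End Modular.

(** * Hahn-Banach theorem *)

Section HahnBanach.
Variables (R : realType) (V : lmodType R).
Implicit Types (q : V -> R) (x y v : V).

Definition sublinear q : Prop := (forall x y, q (x + y) <= q x + q y) /\
  (forall l x, 0 <= l -> q (l *: x) = l * q x).

Lemma sublinear0 q : sublinear q -> q 0 = 0.
Proof. by move=> [_ qZ]; have := qZ 0 0 (lexx _); rewrite scale0r mul0r. Qed.

Lemma sublinear_opp q x : sublinear q -> - q (- x) <= q x.
Proof.
move=> qs; have := qs.1 x (- x); rewrite subrr sublinear0//; lra.
Qed.

Lemma sublinear_pos q : (forall x y, q (x + y) <= q x + q y) -> q 0 = 0 ->
  (forall l x, 0 < l -> q (l *: x) <= l * q x) -> sublinear q.
Proof.
move=> qD q0 qZ; split=> // l x; rewrite le_eqVlt => /predU1P[<-|l0].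
  by rewrite scale0r mul0r.
apply/eqP; rewrite eq_le qZ//= -ler_pdivlMl//.
have li0 : 0 < l^-1 by rewrite invr_gt0.
by have := qZ l^-1 (l *: x) li0; rewrite scalerA mulVf ?gt_eqF// scale1r.
Qed.

(** A linear functional below [q] that agrees with [q] at [v] is below [shave q v]; conversely, by
    [shave_opp], being below [shave q v] forces this agreement. *)
Definition shave q v x : R :=
  inf [set q (x + t *: v) - t * q v | t in [set t | 0 <= t]].

Section Shave.
Variables (q : V -> R) (v : V).
Hypothesis qs : sublinear q.

Lemma shave_has_inf x :
  has_inf [set q (x + t *: v) - t * q v | t in [set t | 0 <= t]].
Proof.
split; first by exists (q (x + 0 *: v) - 0 * q v), 0 => /=.
exists (- q (- x)) => _ [t /= t0 <-].
have := qs.1 (x + t *: v) (- x).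
by rewrite addrAC subrr add0r qs.2//; lra.
Qed.

Lemma shave_le x t : 0 <= t -> shave q v x <= q (x + t *: v) - t * q v.
Proof. by move=> t0; apply: ge_inf; [case: (shave_has_inf x)|exists t]. Qed.

Lemma shave_ge x M : (forall t, 0 <= t -> M <= q (x + t *: v) - t * q v) ->
  M <= shave q v x.
Proof.
move=> h; apply: lb_le_inf; first by case: (shave_has_inf x).
by move=> _ [t t0 <-]; exact: h.
Qed.

Lemma shave_le_self x : shave q v x <= q x.
Proof. by have := shave_le x (lexx 0); rewrite scale0r addr0 mul0r subr0. Qed.

Lemma shave_opp : shave q v (- v) <= - q v.
Proof.
have := @shave_le (- v) 1 ler01.
by rewrite scale1r addNr sublinear0// mul1r add0r.
Qed.

Lemma shave_sublinear : sublinear (shave q v).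
Proof.
apply: sublinear_pos.
- move=> x y; rewrite -lerBlDr; apply: shave_ge => t t0.
  rewrite lerBlDr -lerBlDl; apply: shave_ge => s s0; rewrite lerBlDl.
  have := @shave_le (x + y) (t + s) ltac:(lra).
  have := qs.1 (x + t *: v) (y + s *: v).
  by rewrite scalerDl addrACA; lra.
- apply/eqP; rewrite eq_le; apply/andP; split.
    by rewrite -(sublinear0 qs) shave_le_self.
  by apply: shave_ge => t t0; rewrite add0r qs.2// subrr.
- move=> l x l0; rewrite -ler_pdivrMl//; apply: shave_ge => t t0.
  rewrite ler_pdivrMl//.
  have lt0 : 0 <= l * t by rewrite mulr_ge0// ltW.
  have := @shave_le (l *: x) (l * t) lt0.
  by rewrite -scalerA -scalerDr (qs.2 _ _ (ltW l0)) mulrBr mulrA.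
Qed.

End Shave.

(* A sublinear functional that is minimal for the pointwise order is linear:
   it equals its own shave in every direction, which gives superadditivity. *)
Lemma minimal_sublinear p : sublinear p ->
  exists q, [/\ sublinear q, forall x, q x <= p x &
    forall q', sublinear q' -> (forall x, q' x <= q x) -> q' = q].
Proof.
move=> ps; pose T := {q : V -> R | sublinear q /\ forall x, q x <= p x}.
pose r (s t : T) := `[< forall x, projT1 t x <= projT1 s x >].
have [] := @Zorn T r.
- by move=> t; apply/asboolP.
- move=> s t u /asboolP st /asboolP tu; apply/asboolP => x.
  exact: le_trans (tu x) (st x).
- move=> [s sP] [t tP] /asboolP/= st /asboolP/= ts; apply: eq_exist => /=.
  by apply/funext => x; apply/eqP; rewrite eq_le (st x) (ts x).
- move=> A Atot; have [[s0 As0]|A0] := pselect (exists s, A s); last first.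
    exists (exist _ p (conj ps (fun x => lexx (p x)))) => s As; apply/asboolP.
    by exfalso; apply: A0; exists s.
  pose S x := [set projT1 s x | s in A].
  have Sinf x : has_inf (S x).
    split; first by exists (projT1 s0 x), s0.
    exists (- p (- x)) => _ [[s [ss sp]] /= _ <-].
    by apply: le_trans (sublinear_opp x ss); rewrite lerN2.
  pose q x := inf (S x).
  have qle s x : A s -> q x <= projT1 s x.
    by move=> As; apply: ge_inf; [case: (Sinf x)|exists s].
  have qge x M : (forall s, A s -> M <= projT1 s x) -> M <= q x.
    by move=> h; apply: lb_le_inf; [case: (Sinf x)|move=> _ [s As <-]; exact: h].
  have qs : sublinear q.
    apply: sublinear_pos.
    + move=> x y; rewrite -lerBlDr; apply: (qge _ _) => s As.
      rewrite lerBlDr -lerBlDl; apply: (qge _ _) => t At; rewrite lerBlDl.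
      have [[ss _] [ts _]] := (projT2 s, projT2 t).
      (* The family is totally ordered: the smaller of [s] and [t] is subadditive and bounds both
         terms. *)
      have [/asboolP st|/asboolP ts'] := Atot s t As At.
        have := qle t (x + y) At; have := ts.1 x y; have := st x; lra.
      have := qle s (x + y) As; have := ss.1 x y; have := ts' y; lra.
    + apply/eqP; rewrite eq_le; apply/andP; split.
        by have := qle s0 0 As0; rewrite (sublinear0 (projT2 s0).1).
      by apply: (qge _ _) => s _; rewrite (sublinear0 (projT2 s).1).
    + move=> l x l0; rewrite -ler_pdivrMl//; apply: (qge _ _) => s As.
      by rewrite ler_pdivrMl//; have := qle s (l *: x) As; rewrite ((projT2 s).1.2 _ _ (ltW l0)).
  have qp x : q x <= p x.
    by apply: le_trans (qle s0 x As0) _; case: (projT2 s0).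
  by exists (exist _ q (conj qs qp)) => s As; apply/asboolP => x; exact: qle.
- move=> [q [qs qp]] qmin; exists q; split => // q' q's q'q.
  have q'p x : q' x <= p x by exact: le_trans (q'q x) (qp x).
  have := qmin (exist _ q' (conj q's q'p)).
  by move=> /(_ (asboolT q'q)) => -[].
Qed.

Theorem hahn_banach p v : sublinear p ->
  exists g : V -> R, [/\ linear (g : V -> R^o), forall x, g x <= p x & g v = p v].
Proof.
(* Starting from [shave p v] instead of [p] makes the functional attain [p v]. *)
move=> ps; have [q [qs qle qmin]] := minimal_sublinear (shave_sublinear v ps).
have qp x : q x <= p x by exact: le_trans (qle x) (shave_le_self v ps x).
have shaveE w : shave q w = q.
  by apply: qmin; [exact: shave_sublinear|exact: shave_le_self].
have qD x y : q (x + y) = q x + q y.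
  apply/eqP; rewrite eq_le qs.1/=.
  have := @shave_le q y qs x 1 ler01; rewrite shaveE scale1r mul1r; lra.
have qN x : q (- x) = - q x.
  by have := qD x (- x); rewrite subrr sublinear0//; lra.
exists q; split => //.
- move=> l x y; rewrite qD; congr (_ + _).
  have [l0|l0] := leP 0 l; first exact: qs.2.
  have nl : 0 <= - l by rewrite oppr_ge0 ltW.
  by rewrite -{1}(opprK l) scaleNr qN (qs.2 _ _ nl) mulNr opprK.
- apply/eqP; rewrite eq_le qp/=.
  have := qle (- v); have := shave_opp v ps; rewrite qN; lra.
Qed.

End HahnBanach.

(** * The spaces c_0 and l_p *)

(** The modular that vanishes on [0, 1] and is understood to be infinite beyond has the ball of the
    sup norm as its unit ball. *)
Lemma c0_embedding (R : realType) (f : nat -> rat) : bijective f ->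
  contains_copy (sierpinski_space R f) (c0_space R).
Proof.
move=> f_bij.
have zero_sum N (P : pred 'I_N) : \sum_(i < N | P i) (0 : R) <= 1.
  by rewrite big1_eq.
apply: (@modular_embedding R (fun _ _ => 0) _ _ _ _ f (c0_space R)
  (fun i y => subspace_val y i) f_bij) => //.
- by move=> i s t l *; rewrite !mulr0 addr0.
- move=> y y1; split => // i.
  by apply: le_trans (ltW y1); exact: c0_normP i (subspace_carrier y).
- by move=> y y1 _; exact: c0_norm_le.
- move=> y e e0; have /cvgrPdist_le/(_ _ e0)[N0 _ yN] := subspace_carrier y.
  exists N0; split => // i Ni; have := yN i Ni.
  by rewrite /= sub0r normrN.
Qed.

Lemma powR_convex (R : realType) (p s t l : R) : 1 <= p -> 0 <= s -> 0 <= t ->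
  0 <= l <= 1 ->
  (l * s + (1 - l) * t) `^ p <= l * s `^ p + (1 - l) * t `^ p.
Proof.
move=> p1 s0 t0 l01.
have [l0 l1] := andP l01.
have := @convex_powR R p p1 (Itv01 l0 l1) s t.
by rewrite !inE/= !in_itv/= !andbT => /(_ s0 t0).
Qed.

Lemma nneseries_leP (R : realType) (u : nat -> \bar R) M :
  (forall i, (0 <= u i)%E) ->
  (\sum_(0 <= i <oo) u i <= M)%E <-> forall N, (\sum_(i < N) u i <= M)%E.
Proof.
move=> u0; split=> [uM N|uN].
  by apply: le_trans uM; rewrite -(big_mkord xpredT); exact: nneseries_lim_ge.
apply: lime_le; first exact: is_cvg_nneseries.
by apply: nearW => N; rewrite big_mkord.
Qed.

Lemma sum_tail_nat (R : realType) (u : nat -> R) N0 N :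
  \sum_(i < N | (N0 <= i)%N) u i = \sum_(N0 <= i < N) u i.
Proof. by rewrite (big_nat_widenl _ 0%N)//= big_mkord. Qed.

Lemma cvge0_le (R : realType) (u : nat -> \bar R) (e : R) : 0 < e ->
  u @ \oo --> 0%E -> exists N, forall n, (N <= n)%N -> (u n <= e%:E)%E.
Proof.
move=> e0 u0; have nb : nbhs 0%E [set z : \bar R | (z < e%:E)%E].
  by apply: open_ereal_lt'; rewrite lte_fin.
by have [N _ uN] := u0 _ nb; exists N => n Nn; apply/ltW/uN.
Qed.

Section EllpEmbedding.
Variables (R : realType) (p : R) (p1 : 1 <= p).
Local Notation ellp := (ellp_space p1).
Implicit Type y : ellp.

Let p0 : 0 < p. Proof. exact: lt_le_trans p1. Qed.

Let powers y := (\sum_(0 <= i <oo) (`|subspace_val y i| `^ p)%:E)%E.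

Let powers_ge0 y i : (0 <= (`|subspace_val y i| `^ p)%:E)%E.
Proof. by rewrite lee_fin powR_ge0. Qed.

Lemma ellp_norm_le1 y : `|y| <= 1 <->
  forall N, \sum_(i < N) `|subspace_val y i| `^ p <= 1.
Proof.
have yC : (powers y < +oo)%E := subspace_carrier y.
have pge0 : (0 <= powers y)%E by exact: nneseries_ge0.
have -> : (forall N, \sum_(i < N) `|subspace_val y i| `^ p <= 1) <->
    (powers y <= 1)%E.
  rewrite (nneseries_leP _ (powers_ge0 y)).
  by split => h N; have := h N; rewrite sumEFin lee_fin.
change (fine (powers y `^ p^-1) <= 1 <-> (powers y <= 1)%E).
move: yC pge0; case: (powers y) => // r _; rewrite lee_fin => r0.
rewrite poweR_EFin/= lee_fin; split => h.
  rewrite leNgt; apply/negP => r1.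
  have : 1 `^ p^-1 < r `^ p^-1.
    by apply: gt0_ltr_powR; rewrite ?invr_gt0// nnegrE.
  by rewrite powR1; lra.
have one1 : (1 : R) `^ p^-1 = 1 by rewrite powR1.
by rewrite -[leRHS]one1; apply: ge0_ler_powR; rewrite ?invr_ge0 ?nnegrE// ltW.
Qed.

Lemma ellp_embedding (f : nat -> rat) : bijective f ->
  contains_copy (sierpinski_space R f) ellp.
Proof.
move=> f_bij.
apply: (@modular_embedding R (fun _ t => t `^ p) _ _ _ _ f ellp
  (fun i y => subspace_val y i) f_bij) => //.
- by move=> i t _; exact: powR_ge0.
- by move=> i; rewrite powR0// gt_eqF.
- by move=> i; rewrite powR1.
- by move=> i s t l s01 t01 l01; apply: powR_convex => //; lra.
- move=> y /ltW/ellp_norm_le1 yN; split => // i.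
  rewrite leNgt; apply/negP => yi; have := yN i.+1.
  rewrite big_ord_recr/= leNgt => /negP; apply.
  apply: ltr_wpDl; first by rewrite sumr_ge0// => j _; exact: powR_ge0.
  have one1 : (1 : R) `^ p = 1 by rewrite powR1.
  by rewrite -[ltLHS]one1; apply: gt0_ltr_powR; rewrite ?nnegrE.
- by move=> y _ /ellp_norm_le1.
- move=> y e e0; have ep0 : 0 < e `^ p by rewrite powR_gt0.
  have := @nneseries_tail_cvg R (fun i => (`|subspace_val y i| `^ p)%:E) xpredT.
  move=> /(_ (subspace_carrier y) (fun i _ => powers_ge0 y i)).
  move=> /(cvge0_le ep0)[N0 /(_ N0 (leqnn N0)) tailN0].
  have main N : \sum_(N0 <= i < N) `|subspace_val y i| `^ p <= e `^ p.
    rewrite -lee_fin -sumEFin; apply: le_trans tailN0.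
    exact: nneseries_lim_ge.
  exists N0; split=> [i Ni|N].
    rewrite leNgt; apply/negP => yi; have := main i.+1.
    rewrite big_nat_recr//= leNgt => /negP; apply.
    apply: ltr_wpDl; first by rewrite sumr_ge0// => j _; exact: powR_ge0.
    by apply: gt0_ltr_powR; rewrite ?nnegrE// ltW.
  rewrite (sum_tail_nat (fun i => (`|subspace_val y i| / e) `^ p)).
  have -> : \sum_(N0 <= i < N) (`|subspace_val y i| / e) `^ p =
      (\sum_(N0 <= i < N) `|subspace_val y i| `^ p) / e `^ p.
    rewrite mulr_suml; apply: eq_bigr => i _.
    have e1 : e != 0 by rewrite gt_eqF.
    rewrite -[X in _ = X `^ p / _](divfK e1) [in RHS]powRM ?divr_ge0 ?(ltW e0)//.
    by rewrite mulfK// gt_eqF.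
  by rewrite ler_pdivrMr// mul1r.
Qed.

End EllpEmbedding.

(** * Reflexive Musielak-Orlicz spaces *)

Section DualFacts.
Variables (R : realType) (X : normedModType R).
Implicit Types (h : dual X) (z : X).

Lemma dual_linear h l x y : h (l *: x + y) = l * h x + h y.
Proof. by have [hl _] := subspace_carrier h; exact: hl. Qed.

Lemma dual0 h : h 0 = 0.
Proof. by have := dual_linear h 1 0 0; rewrite scaler0 addr0 mul1r; lra. Qed.

Lemma dualZ h l z : h (l *: z) = l * h z.
Proof. by rewrite -[l *: z]addr0 dual_linear dual0 addr0. Qed.

Lemma dualD h x y : h (x + y) = h x + h y.
Proof. by have := dual_linear h 1 x y; rewrite scale1r mul1r. Qed.

Lemma dualN h z : h (- z) = - h z.
Proof. by rewrite -scaleN1r dualZ mulN1r. Qed.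

Lemma dual_sum h (I : Type) (r : seq I) (P : pred I) (F : I -> X) :
  h (\sum_(i <- r | P i) F i) = \sum_(i <- r | P i) h (F i).
Proof. exact: (big_morph h (dualD h) (dual0 h)). Qed.

Lemma dual_norm_bound h z : `|h z| <= `|h| * `|z|.
Proof.
have [->|z0] := eqVneq z 0; first by rewrite dual0 !normr0 mulr0.
have nz : 0 < `|z| by rewrite normr_gt0.
have : `|h (`|z|^-1 *: z)| <= `|h|.
  apply: (dual_normP (subspace_carrier h)).
  by rewrite normrZ normfV normr_id mulVf// gt_eqF.
by rewrite dualZ normrM normfV normr_id ler_pdivrMl// mulrC.
Qed.

Lemma dual_norm_leP h M : (forall z, `|h z| <= M * `|z|) -> 0 <= M -> `|h| <= M.
Proof.
move=> hM M0; apply: (dual_norm_le (subspace_carrier h)) => z z1.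
by apply: le_trans (hM z) _; rewrite ler_piMr.
Qed.

Lemma dual_exists (g : X -> R) M : linear (g : X -> R^o) ->
  (forall z, `|g z| <= M * `|z|) -> exists h : dual X, forall z, h z = g z.
Proof.
move=> gl gM.
pose gL : {linear X -> R^o} := HB.pack g (GRing.isLinear.Build R X R^o *:%R g gl).
have gc : continuous g.
  apply: (@bounded_linear_continuous _ _ _ gL); apply/linear_boundedP.
  exists M; split; first exact: num_real.
  by move=> r /ltW Mr z; apply: le_trans (gM z) _; rewrite ler_wpM2r.
by exists (@SubspaceElt _ _ (dual_subspace X) g (mem_set (conj gl gc))).
Qed.

(** The bound by a multiple of the norm makes the Hahn-Banach functional continuous. *)
Lemma dual_dominated (q : X -> R) v M : sublinear q ->
  (forall x, q x <= M * `|x|) ->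
  exists h : dual X, (forall x, h x <= q x) /\ h v = q v.
Proof.
move=> qs qM; have [g [gl gq gv]] := hahn_banach v qs.
have g0 : g 0 = 0.
  have := gl 1 0 0; rewrite scaler0 addr0 scale1r => h.
  by apply: (addrI (g 0)); rewrite addr0 -h.
have gN x : g (- x) = - g x.
  by have := gl (-1) x 0; rewrite scaleN1r addr0 => ->; rewrite scaleN1r g0 addr0.
have [|h hg] := @dual_exists g M gl.
  move=> x; rewrite ler_norml (le_trans (gq x))// andbT lerNl -gN.
  by rewrite (le_trans (gq _))// (le_trans (qM _))// normrN.
by exists h; split => [x|]; rewrite hg.
Qed.

Lemma hahn_banach_norm z : exists2 h : dual X, `|h| <= 1 & h z = `|z|.
Proof.
have ns : sublinear (fun x : X => `|x|).
  split; first exact: ler_normD.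
  by move=> l x l0; rewrite normrZ ger0_norm.
have [|h [hle hz]] := @dual_dominated _ z 1 ns; first by move=> x; rewrite mul1r.
exists h => //; apply: dual_norm_leP => // x.
by rewrite mul1r ler_norml hle andbT lerNl -dualN (le_trans (hle _))// normrN.
Qed.

End DualFacts.

(** * Upper limits of bounded sequences *)

Section EventualBound.
Variable R : realType.
Implicit Types u v : nat -> R.

Definition eventual_sup u : R :=
  inf [set M | exists N, forall n, (N <= n)%N -> u n <= M].

Definition bounded_seq u := exists m, forall n, `|u n| <= m.

Lemma eventual_sup_has_inf u : bounded_seq u ->
  has_inf [set M | exists N, forall n, (N <= n)%N -> u n <= M].
Proof.
move=> [m um]; split.
  by exists m; exists 0%N => n _; exact: le_trans (ler_norm _) (um n).
exists (- m) => M [N NM]; apply: le_trans (NM N (leqnn N)).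
by have := um N; rewrite ler_norml => /andP[].
Qed.

Lemma eventual_sup_le u M N : bounded_seq u ->
  (forall n, (N <= n)%N -> u n <= M) -> eventual_sup u <= M.
Proof.
by move=> ub uM; apply: ge_inf; [case: (eventual_sup_has_inf ub)|exists N].
Qed.

Lemma eventual_sup_ge u M : bounded_seq u ->
  (forall n, M <= u n) -> M <= eventual_sup u.
Proof.
move=> ub uM; apply: lb_le_inf; first by case: (eventual_sup_has_inf ub).
by move=> M' [N NM]; exact: le_trans (uM N) (NM N (leqnn N)).
Qed.

Lemma eventual_supD u v : bounded_seq u -> bounded_seq v ->
  bounded_seq (u + v) ->
  eventual_sup (u + v) <= eventual_sup u + eventual_sup v.
Proof.
move=> ub vb uvb; rewrite -lerBlDr; apply: lb_le_inf.
  by case: (eventual_sup_has_inf ub).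
move=> M [N NM]; rewrite lerBlDr -lerBlDl; apply: lb_le_inf.
  by case: (eventual_sup_has_inf vb).
move=> M' [N' NM']; rewrite lerBlDl; apply: (@eventual_sup_le _ _ (maxn N N')) => // n.
by rewrite geq_max => /andP[n1 n2]; apply: lerD; [exact: NM|exact: NM'].
Qed.

Lemma eventual_supZ l u : 0 < l -> bounded_seq u -> bounded_seq (l *: u) ->
  eventual_sup (l *: u) <= l * eventual_sup u.
Proof.
move=> l0 ub lub; rewrite -ler_pdivrMl//; apply: lb_le_inf.
  by case: (eventual_sup_has_inf ub).
move=> M [N NM]; rewrite ler_pdivrMl//; apply: (@eventual_sup_le _ _ N) => // n Nn.
by apply: ler_wpM2l; [exact: ltW|exact: NM].
Qed.

Lemma eventual_sup_lt u M : bounded_seq u -> eventual_sup u < M ->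
  exists N, forall n, (N <= n)%N -> u n < M.
Proof.
move=> ub /(inf_lt (eventual_sup_has_inf ub).1)[M' [N NM'] M'M].
by exists N => n /NM' h; exact: le_lt_trans h M'M.
Qed.

End EventualBound.

(** * Solidity, cuts and tails in a Musielak-Orlicz space *)

Section MusielakOrliczEmbedding.
Variables (R : realType) (Phi : nat -> R -> \bar R).
Hypothesis PhiO : forall i, orlicz_function (Phi i).
Local Notation X := (musielak_orlicz_space PhiO).
Local Notation carrier := (musielak_orlicz_carrier Phi).
Implicit Type y : X.

Lemma modular_mono (x z : nat -> R) : (forall i, `|x i| <= `|z i|) ->
  (modular Phi x <= modular Phi z)%E.
Proof.
move=> xz; apply: lee_nneseries => [i _ _|i _]; first exact: (orlicz_ge0 PhiO).
by apply: (orlicz_le PhiO).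
Qed.

Lemma modular_monoZ l (x z : nat -> R) : (forall i, `|x i| <= `|z i|) ->
  (modular Phi (l *: x) <= modular Phi (l *: z))%E.
Proof.
move=> xz; apply: modular_mono => i.
change (`|l * x i| <= `|l * z i|).
by rewrite !normrM ler_wpM2l.
Qed.

Lemma carrier_solid (x z : nat -> R) : (forall i, `|x i| <= `|z i|) ->
  carrier z -> carrier x.
Proof.
move=> xz [rho rho0 Iz]; exists rho => //; apply: le_lt_trans Iz.
exact: modular_monoZ.
Qed.

Lemma mo_norm_solid (x z : X) :
  (forall i, `|subspace_val x i| <= `|subspace_val z i|) -> `|x| <= `|z|.
Proof.
move=> xz; apply: (musielak_orlicz_ge PhiO (subspace_carrier z)) => rho rho0 Iz.
apply: musielak_orlicz_le => //; apply: le_trans Iz; exact: modular_monoZ.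
Qed.

Lemma mo_coord_le y i : `|subspace_val y i| <= `|y|.
Proof. exact (musielak_orlicz_coord PhiO i (subspace_carrier y)). Qed.

Definition cut (n : nat) (x : nat -> R) : nat -> R :=
  fun i => if (i < n)%N then x i else 0.

Lemma mo_cut_subproof n y : carrier (cut n (subspace_val y)).
Proof.
apply: carrier_solid (subspace_carrier y) => i.
by rewrite /cut; case: ifP => // _; rewrite normr0.
Qed.

Lemma mo_tail_subproof n y : carrier (tail n (subspace_val y)).
Proof.
apply: carrier_solid (subspace_carrier y) => i.
by rewrite /tail; case: ifP => // _; rewrite normr0.
Qed.

Definition mo_cut (n : nat) y : X.
Proof.
by refine (@SubspaceElt _ _ _ (cut n (subspace_val y)) _);
  exact: mem_set (mo_cut_subproof n y).
Defined.

Definition mo_tail (n : nat) y : X.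
Proof.
by refine (@SubspaceElt _ _ _ (tail n (subspace_val y)) _);
  exact: mem_set (mo_tail_subproof n y).
Defined.

Lemma mo_tail_norm n y : `|mo_tail n y| <= `|y|.
Proof.
apply: mo_norm_solid => i /=.
by rewrite /tail; case: ifP => // _; rewrite normr0.
Qed.

Lemma mo_cut_norm n y : `|mo_cut n y| <= `|y|.
Proof.
apply: mo_norm_solid => i /=.
by rewrite /cut; case: ifP => // _; rewrite normr0.
Qed.

Lemma mo_tailD n y z : mo_tail n (y + z) = mo_tail n y + mo_tail n z.
Proof.
apply: val_inj.
change (tail n (subspace_val y + subspace_val z) =
  tail n (subspace_val y) + tail n (subspace_val z)).
exact: tailD.
Qed.

Lemma mo_tailZ n l y : mo_tail n (l *: y) = l *: mo_tail n y.
Proof.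
apply: val_inj.
change (tail n (l *: subspace_val y) = l *: tail n (subspace_val y)).
exact: tailZ.
Qed.

Lemma mo_tail_cut n m y : (n <= m)%N -> mo_tail m (mo_cut n y) = 0.
Proof.
move=> nm; apply/val_inj/funext => i /=; rewrite /tail /cut.
case: ifP => // mi; rewrite ifF//; apply/negbTE; rewrite -leqNgt.
exact: leq_trans nm mi.
Qed.

(** The norms of the tails decrease, so this is their limit: a seminorm that vanishes on vectors of
    finite support. *)
Let tail_size y : R := eventual_sup (fun n => `|mo_tail n y|).

Let tail_bounded y : bounded_seq (fun n => `|mo_tail n y|).
Proof. by exists `|y| => n; rewrite normr_id; exact: mo_tail_norm. Qed.

Let tail_size_le y : tail_size y <= `|y|.
Proof.
by apply: (@eventual_sup_le _ _ _ 0) => // n _; exact: mo_tail_norm.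
Qed.

Let tail_size_sublinear : sublinear tail_size.
Proof.
apply: sublinear_pos.
- move=> x y; have xyb : bounded_seq ((fun n => `|mo_tail n x|) + (fun n => `|mo_tail n y|)).
    exists (`|x| + `|y|) => n; change (`| `|mo_tail n x| + `|mo_tail n y| | <= `|x| + `|y|).
    by rewrite ger0_norm ?addr_ge0// lerD// mo_tail_norm.
  apply: le_trans (eventual_supD (tail_bounded x) (tail_bounded y) xyb).
  apply: lb_le_inf; first by case: (eventual_sup_has_inf xyb).
  move=> M [N NM]; apply: (@eventual_sup_le _ _ _ N) => // n Nn.
  by apply: le_trans (NM n Nn); rewrite mo_tailD; exact: ler_normD.
- apply/eqP; rewrite eq_le; apply/andP; split.
    by have := tail_size_le 0; rewrite normr0.
  by apply: eventual_sup_ge.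
- move=> l x l0; have lb : bounded_seq (l *: (fun n => `|mo_tail n x|)).
    exists (l * `|x|) => n; change (`|l * `|mo_tail n x| | <= l * `|x|).
    by rewrite normrM normr_id gtr0_norm// ler_wpM2l ?mo_tail_norm// ltW.
  apply: le_trans (eventual_supZ l0 (tail_bounded x) lb).
  apply: lb_le_inf; first by case: (eventual_sup_has_inf lb).
  move=> M [N NM]; apply: (@eventual_sup_le _ _ _ N) => // n Nn.
  by apply: le_trans (NM n Nn); rewrite mo_tailZ normrZ gtr0_norm.
Qed.

(* A functional of the bidual dominated by the upper limit of
   [h |-> h (mo_cut n y)] can only be the evaluation at [y], and this upper limit
   is nonpositive at a functional [G] dominated by the limit norm of the tails. *)
Lemma reflexive_mo_tail : reflexive_space X ->
  forall y e, 0 < e -> exists N, `|mo_tail N y| < e.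
Proof.
move=> refl y e e0.
have [G [Gle Gy]] : exists h : dual X, (forall x, h x <= tail_size x) /\ h y = tail_size y.
  by apply: (@dual_dominated _ X _ _ 1) => // x; rewrite mul1r.
have cut_bounded (h : dual X) : bounded_seq (fun n => h (mo_cut n y)).
  exists (`|h| * `|y|) => n; apply: le_trans (dual_norm_bound _ _) _.
  by rewrite ler_wpM2l// mo_cut_norm.
pose q (h : dual X) := eventual_sup (fun n => h (mo_cut n y)).
have qs : sublinear q.
  apply: sublinear_pos.
  - by move=> h k; exact: (eventual_supD (cut_bounded h) (cut_bounded k) (cut_bounded (h + k))).
  - apply/eqP; rewrite eq_le; apply/andP; split.
      by apply: (@eventual_sup_le _ _ _ 0).
    by apply: eventual_sup_ge.
  - by move=> l h l0; exact: (eventual_supZ l0 (cut_bounded h) (cut_bounded (l *: h))).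
have [Psi [Psile _]] : exists h : dual (dual X), (forall x, h x <= q x) /\ h 0 = q 0.
  apply: (@dual_dominated _ (dual X) _ _ `|y|) => // h.
  apply: (@eventual_sup_le _ _ _ 0) => // n _.
  apply: le_trans (ler_norm _) _; apply: le_trans (dual_norm_bound _ _) _.
  by rewrite mulrC ler_wpM2r// mo_cut_norm.
have [x Psix] := refl Psi.
have xy : x = y.
  apply/val_inj/funext => i.
  (* The coordinate functional [E] is eventually constant along the cuts of [y]; the bounds by [q]
     at [E] and at [- E] give [Psi E] the value [E y]. *)
  have [| |E Ei] := @dual_exists _ X (fun z => subspace_val z i) 1.
  - by move=> l u v.
  - by move=> z; rewrite mul1r mo_coord_le.
  have cutE n : (i.+1 <= n)%N -> E (mo_cut n y) = subspace_val y i.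
    by move=> ni; rewrite Ei /= /cut ni.
  apply/eqP; rewrite eq_le; apply/andP; split.
    have := Psile E; rewrite Psix Ei => /le_trans; apply.
    by apply: (@eventual_sup_le _ _ _ i.+1) => // n /cutE ->.
  rewrite -lerN2; have := Psile (- E).
  rewrite Psix; change ((- E : dual X) x) with (- E x); rewrite Ei => /le_trans; apply.
  apply: (@eventual_sup_le _ _ _ i.+1) => // n /cutE h.
  by change (- E (mo_cut n y) <= - subspace_val y i); rewrite h.
have ty0 : tail_size y <= 0.
  rewrite -Gy -xy -Psix; apply: le_trans (Psile G) _.
  apply: (@eventual_sup_le _ _ _ 0) => // n _; apply: le_trans (Gle _) _.
  apply: (@eventual_sup_le _ _ _ n) => // m nm.
  by rewrite mo_tail_cut// normr0.
have [N NP] := eventual_sup_lt (tail_bounded y) (le_lt_trans ty0 e0).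
by exists N; exact: NP.
Qed.

(** * Musielak-Orlicz spaces as modular spaces *)

Let phi (i : nat) (t : R) : R := fine (Phi i t).

Let phiE i t : 0 <= t <= 1 -> Phi i t = (phi i t)%:E.
Proof.
move=> /andP[t0 t1]; rewrite /phi fineK// ge0_fin_numE ?(orlicz_ge0 PhiO)//.
apply: le_lt_trans (orlicz_le PhiO i t0 t1) _.
by have [_ _ _ _ [_ _ ->]] := PhiO i; exact: ltry.
Qed.

Let modular_leP (x : nat -> R) : (forall i, `|x i| <= 1) ->
  (modular Phi x <= 1)%E <-> forall N, \sum_(i < N) phi i `|x i| <= 1.
Proof.
move=> x1; rewrite (nneseries_leP _ (fun i => orlicz_ge0 PhiO i (normr_ge0 (x i)))).
have e N : (\sum_(i < N) Phi i `|x i|)%E = (\sum_(i < N) phi i `|x i|)%:E.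
  by rewrite -sumEFin; apply: eq_bigr => i _; rewrite phiE// normr_ge0 x1.
by split => h N; have := h N; rewrite e lee_fin.
Qed.

Let unit_modular y : `|y| < 1 -> (forall i, `|subspace_val y i| <= 1) /\
  forall N, \sum_(i < N) phi i `|subspace_val y i| <= 1.
Proof.
move=> y1; have c1 i : `|subspace_val y i| <= 1.
  by apply: le_trans (ltW y1); exact: mo_coord_le.
split => //; apply/modular_leP => //.
have [rho [rho0 Iy] rho1] :=
  inf_lt (musielak_orlicz_nonempty PhiO (subspace_carrier y)) y1.
have -> : subspace_val y = rho *: (rho^-1 *: subspace_val y).
  by rewrite scalerA divff ?scale1r// gt_eqF.
apply: le_trans (modular_scale_le PhiO _ _) _; first by rewrite ltW//= ltW.
rewrite -[leRHS]mule1; apply: lee_pmul => //.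
- by rewrite lee_fin ltW.
- exact: (modular_ge0 PhiO).
- by rewrite lee_fin ltW.
Qed.

Lemma musielak_orlicz_embedding (f : nat -> rat) : bijective f ->
  reflexive_space X -> contains_copy (sierpinski_space R f) X.
Proof.
move=> f_bij refl.
apply: (@modular_embedding R phi _ _ _ _ f X
  (fun i y => subspace_val y i) f_bij) => //.
- by move=> i t /andP[t0 _]; rewrite fine_ge0// (orlicz_ge0 PhiO).
- by move=> i; rewrite /phi; have [_ _ _ _ [-> _ _]] := PhiO i.
- by move=> i; rewrite /phi; have [_ _ _ _ [_ _ ->]] := PhiO i.
- move=> i s t l s01 t01 l01.
  have [_ /(_ s t l) h _ _ _] := PhiO i.
  have c01 : 0 <= l * s + (1 - l) * t <= 1 by nra.
  rewrite -lee_fin EFinD !EFinM -!phiE//.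
  by apply: h => //; lra.
- move=> y y1 yN; apply: musielak_orlicz_le => //.
  by rewrite invr1 scale1r; apply/modular_leP.
- move=> y e e0; have [N0 yN0] := reflexive_mo_tail refl y e0.
  have ty : `|e^-1 *: mo_tail N0 y| < 1.
    by rewrite normrZ gtr0_norm ?invr_gt0// ltr_pdivrMl// mulr1.
  have [t1 tN] := unit_modular ty.
  have tE i : `|subspace_val (e^-1 *: mo_tail N0 y) i| =
      if (N0 <= i)%N then `|subspace_val y i| / e else 0.
    change (`|e^-1 * tail N0 (subspace_val y) i| =
      if (N0 <= i)%N then `|subspace_val y i| / e else 0).
    rewrite /tail normrM normfV (gtr0_norm e0) mulrC.
    by case: ifP => _; rewrite ?normr0 ?mul0r.
  exists N0; split=> [i Ni|N].
    by have := t1 i; rewrite tE Ni ler_pdivrMr// mul1r.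
  rewrite big_mkcond/=; apply: le_trans (tN N); apply: ler_sum => i _.
  rewrite tE; case: ifP => // _.
  by rewrite /phi; have [_ _ _ _ [-> _ _]] := PhiO i.
Qed.

End MusielakOrliczEmbedding.

(** * Spaces with an unconditional basis *)

Section UnconditionalBasis.
Variables (R : realType) (Y : normedModType R) (y : nat -> Y).
Variable ystar : nat -> dual Y.
Hypothesis y_basis : schauder_basis y.
Hypothesis y_normalized : normalized y.
Hypothesis y_unc : one_unconditional y.
Hypothesis y_bi : biorthogonal y ystar.
Implicit Types (a c d x z w : nat -> R) (v : Y).

(** * Unconditionality and expansions in the basis *)

Definition comb N c : Y := \sum_(i < N) c i *: y i.

Lemma ystar_y n m : ystar n (y m) = (n == m)%:R.
Proof. exact: y_bi. Qed.

Lemma ystar_comb n N c : ystar n (comb N c) = if (n < N)%N then c n else 0.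
Proof.
rewrite dual_sum; have [nN|Nn] := ltnP n N.
  rewrite (bigD1 (Ordinal nN))//= dualZ ystar_y eqxx mulr1 big1 ?addr0// => i ni.
  rewrite dualZ ystar_y; case: eqP => [e|_]; last by rewrite mulr0.
  by case/eqP: ni; apply: val_inj.
rewrite big1// => i _; rewrite dualZ ystar_y; case: eqP => [e|_]; last by rewrite mulr0.
by have := ltn_ord i; rewrite -e ltnNge Nn.
Qed.

Lemma comb_ext N c d : (forall i, (i < N)%N -> c i = d i) -> comb N c = comb N d.
Proof. by move=> cd; apply: eq_bigr => i _; rewrite cd. Qed.

(** A coefficient of modulus at most [|d k|] is a convex combination of [d k] and [- d k], and the
    change of sign preserves the norm. *)
Lemma comb_put_le N d k t : `|t| <= `|d k| ->
  `|comb N (put d k t)| <= `|comb N d|.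
Proof.
move=> td; have [dk0|dk0] := eqVneq (d k) 0.
  have -> : t = d k by apply/eqP; rewrite dk0 -normr_le0 (le_trans td)// dk0 normr0.
  by rewrite put_id.
have tdk : -1 <= t / d k <= 1.
  by rewrite -ler_norml normrM normfV ler_pdivrMr ?normr_gt0// mul1r.
have [l l01 le] : exists2 l, 0 <= l <= 1 & l * d k + (1 - l) * (- d k) = t.
  by exists ((1 + t / d k) / 2); [lra|field].
have -> : comb N (put d k t) = l *: comb N d + (1 - l) *: comb N (put d k (- d k)).
  rewrite /comb !scaler_sumr -big_split/=; apply: eq_bigr => i _.
  rewrite !scalerA -scalerDl /put; case: eqP => [->|_]; first by rewrite le.
  by rewrite -mulrDl addrC subrK mul1r.
apply: le_trans (ler_normD _ _) _; rewrite !normrZ.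
have -> : `|comb N (put d k (- d k))| = `|comb N d|.
  rewrite -(y_unc N d (fun i => i == k)); congr `|_|; apply: eq_bigr => i _.
  rewrite /put; case: eqP => [->|_]; first by rewrite expr1 mulN1r.
  by rewrite expr0 mul1r.
rewrite (@ger0_norm _ l) ?(@ger0_norm _ (1 - l)); [|lra|lra].
by rewrite -mulrDl addrC subrK mul1r.
Qed.

Lemma comb_le N c d : (forall i, (i < N)%N -> `|c i| <= `|d i|) ->
  `|comb N c| <= `|comb N d|.
Proof.
move=> cd; pose h k i := if (i < k)%N then c i else d i.
suff H k : (k <= N)%N -> `|comb N (h k)| <= `|comb N d|.
  by apply: le_trans (H N (leqnn N)); rewrite le_eqVlt; apply/orP; left; apply/eqP;
    congr `|_|; apply: comb_ext => i iN; rewrite /h iN.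
elim: k => [|k IH] kN; first by rewrite (@comb_ext _ (h 0%N) d).
apply: le_trans (IH (ltnW kN)).
rewrite (@comb_ext _ (h k.+1) (put (h k) k (c k))); last first.
  by move=> i iN; rewrite /h /put ltnS leq_eqVlt; case: eqP => [->|].
by apply: comb_put_le; rewrite /h ltnn cd.
Qed.

Lemma comb_widen N M c : (N <= M)%N -> `|comb N c| <= `|comb M c|.
Proof.
move=> NM; have -> : comb N c = comb M (fun i => if (i < N)%N then c i else 0).
  rewrite /comb (big_ord_widen _ (fun i => c i *: y i) NM) big_mkcond/=.
  by apply: eq_bigr => i _; case: ifP; rewrite ?scale0r.
by apply: comb_le => i _; case: ifP => // _; rewrite normr0.
Qed.

Definition coord v : nat -> R := fun i => ystar i v.

(** Continuity of [ystar i] identifies the coefficients of the Schauder expansion with [coord v]. *)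
Lemma coord_cvg v e : 0 < e ->
  exists N, forall n, (N <= n)%N -> `|v - comb n (coord v)| <= e.
Proof.
move=> e0; have [a [av _]] := y_basis v.
have close e' : 0 < e' -> exists N, forall n, (N <= n)%N -> `|v - comb n a| <= e'.
  move=> e'0; have /cvgrPdist_le/(_ _ e'0)[N _ vN] := av.
  by exists N => n Nn; have := vN n Nn; rewrite /series/= big_mkord.
have -> : coord v = a; last exact: close.
apply/funext => i; apply/eqP; rewrite -subr_eq0 -normr_le0.
apply/ler_addgt0Pl => e' e'0; rewrite addr0.
pose M := `|ystar i| + 1; have M0 : 0 < M by rewrite ltr_wpDl.
have [|N vN] := close (e' / M); first by rewrite divr_gt0.
have {vN} := vN (maxn N i.+1) (leq_maxl _ _).
rewrite ler_pdivlMr// => h; apply: le_trans h.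
have := dual_norm_bound (ystar i) (v - comb (maxn N i.+1) a).
rewrite dualD dualN ystar_comb leq_maxr => /le_trans; apply.
by rewrite mulrC ler_wpM2l// /M lerDl.
Qed.

Lemma comb_coord_le N v : `|comb N (coord v)| <= `|v|.
Proof.
apply/ler_addgt0Pr => e e0; have [M vM] := coord_cvg v e0.
apply: le_trans (comb_widen _ (leq_maxl N M)) _.
have := vM (maxn N M) (leq_maxr _ _); rewrite distrC => h.
rewrite -[X in `|X|](subrK v) (le_trans (ler_normD _ _))// addrC lerD2l//.
Qed.

(** The nonnegative coefficient sequences of finitely supported functionals of norm at most 1; the
    absolute values treat all choices of signs at once. *)
Definition dual_ball : set (nat -> R) := [set a : nat -> R |
  [/\ forall i, 0 <= a i, exists N, supp_lt N a &
      forall N c, \sum_(i < N) a i * `|c i| <= `|comb N c|]].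

(** The relation [dot_le] on positive vectors, with the tail [w] starting at [n] instead of after
    the supports. *)
Definition dual_le (n : nat) x z : Prop := forall w,
  (forall i, (i < n)%N -> w i = 0) -> dual_ball w ->
  dual_ball (z + w) -> dual_ball (x + w).

Definition dual_comb N a : dual Y := \sum_(i < N) a i *: ystar i.

Lemma dual_combE N a v : dual_comb N a v = \sum_(i < N) a i * ystar i v.
Proof.
rewrite /dual_comb; elim: N => [|N IH]; first by rewrite !big_ord0.
by rewrite !big_ord_recr/= -IH.
Qed.

Lemma dual_comb_widen N M a : supp_lt N a -> (N <= M)%N ->
  dual_comb M a = dual_comb N a.
Proof.
move=> aN /subnKC <-; elim: (M - N)%N => [|k IH]; first by rewrite addn0.
by rewrite addnS /dual_comb big_ord_recr/= -/(dual_comb _ _) IH aN ?leq_addr// scale0r addr0.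
Qed.

Lemma dual_combD N a c : dual_comb N (a + c) = dual_comb N a + dual_comb N c.
Proof. by rewrite /dual_comb -big_split/=; apply: eq_bigr => i _; rewrite -scalerDl. Qed.

Lemma dual_comb_put n x b : supp_lt n x ->
  dual_comb n.+1 (put x n b) = dual_comb n x + b *: ystar n.
Proof.
move=> xn; rewrite /dual_comb big_ord_recr/= put_same; congr (_ + _).
by apply: eq_bigr => i _; rewrite put_other// neq_ltn ltn_ord.
Qed.

Lemma dual_comb_y N a n : supp_lt N a -> dual_comb N a (y n) = a n.
Proof.
move=> aN; rewrite dual_combE; have [nN|Nn] := ltnP n N.
  rewrite (bigD1 (Ordinal nN))//= ystar_y eqxx mulr1 big1 ?addr0// => i ni.
  rewrite ystar_y; case: eqP => [e|_]; last by rewrite mulr0.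
  by case/eqP: ni; apply: val_inj.
rewrite aN// big1// => i _; rewrite ystar_y; case: eqP => [e|_]; last by rewrite mulr0.
by have := ltn_ord i; rewrite e ltnNge Nn.
Qed.

Lemma expansionP a (x : dual Y) :
  expansion ystar a x <-> exists2 N, supp_lt N a & x = dual_comb N a.
Proof.
have sumE N : supp_lt N a -> \sum_(n \in [set: nat]) a n *: ystar n = dual_comb N a.
  move=> aN; rewrite /dual_comb (@fsbig_ord _ _ _ N (fun n => a n *: ystar n)).
  apply/esym/fsbig_widen => // n [_ /= /negP]; rewrite -leqNgt => Nn.
  by rewrite aN// scale0r.
split=> [[+ xE]|[N aN ->]].
  move=> /finite_fsetP[X aX]; pose N := (\max_(i <- X) i).+1.
  have aN : supp_lt N a.
    move=> i Ni; apply/eqP; apply: contraLR Ni => ai; rewrite -ltnNge ltnS.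
    have iX : i \in enum_fset X.
      by have : [set n | a n != 0] i by []; rewrite aX.
    by have := @leq_bigmax_seq _ (enum_fset X) xpredT id i iX isT.
  by exists N => //; rewrite xE; exact: sumE.
split; last by rewrite (sumE N).
apply: (sub_finite_set _ (finite_II N)) => n /= an.
by rewrite ltnNge; apply: contra an => Nn; rewrite aN.
Qed.

Lemma dual_comb_norm N a : supp_lt N a ->
  `|dual_comb N a| <= 1 <-> dual_ball (fun i => `|a i|).
Proof.
move=> aN; split=> [aD|[_ _ aB]].
  split=> //; first by exists N => i Ni; rewrite aN// normr0.
  (* With the signs of [a] the functional adds up absolute values, and [comb_le] removes the signs
     from the norm. *)
  move=> M c; pose d i := Num.sg (a i) * `|c i|.
  have dc i : (i < M)%N -> `|d i| <= `|c i|.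
    by rewrite /d normrM normr_id normr_sg => _; rewrite ler_piMl// lern1 leq_b1.
  apply: le_trans (comb_le dc).
  have -> : \sum_(i < M) `|a i| * `|c i| = dual_comb (maxn N M) a (comb M d).
    rewrite dual_combE (big_ord_widen _ (fun i => `|a i| * `|c i|) (leq_maxr N M)).
    rewrite big_mkcond/=; apply: eq_bigr => i _; rewrite ystar_comb.
    case: ifP => _; last by rewrite mulr0.
    by rewrite /d mulrA [X in _ = X * _]mulrC -normrEsg.
  rewrite (dual_comb_widen aN (leq_maxl _ _)).
  apply: le_trans (ler_norm _) (le_trans (dual_norm_bound _ _) _).
  by rewrite ler_piMl.
apply: dual_norm_leP => // v; rewrite mul1r.
apply: le_trans (comb_coord_le N v).
rewrite dual_combE (le_trans (ler_norm_sum _ _ _))//.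
by apply: le_trans (aB N (coord v)); apply: ler_sum => i _; rewrite normrM.
Qed.

Lemma fin_ball_comb N a : supp_lt N a ->
  fin_ball ystar (dual_comb N a) <-> dual_ball (fun i => `|a i|).
Proof.
move=> aN; rewrite -(dual_comb_norm aN); split=> [[]//|a1]; split => //.
by exists a; apply/expansionP; exists N.
Qed.

Lemma fin_ball_exists (x : dual Y) : fin_ball ystar x ->
  exists N a, supp_lt N a /\ x = dual_comb N a.
Proof. by move=> [[a /expansionP[N aN xE]] _]; exists N, a. Qed.

Lemma supp_comb N a n : supp_lt N a ->
  supp ystar (dual_comb N a) n <-> a n != 0.
Proof.
move=> aN; split=> [[b /expansionP[M bM e]]|an].
  by rewrite -(dual_comb_y n bM) -e dual_comb_y.
by exists a => //; apply/expansionP; exists N.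
Qed.

Lemma dual_ball_abs a : (forall i, 0 <= a i) -> (fun i => `|a i|) = a.
Proof. by move=> a0; apply/funext => i; rewrite ger0_norm. Qed.

Lemma fin_ball_comb_ge0 N a : supp_lt N a -> (forall i, 0 <= a i) ->
  fin_ball ystar (dual_comb N a) <-> dual_ball a.
Proof. by move=> aN a0; rewrite -{2}(dual_ball_abs a0); exact: fin_ball_comb. Qed.

Lemma supp_ltD N M a c : supp_lt N a -> supp_lt M c -> supp_lt (maxn N M) (a + c).
Proof.
move=> aN cM i; rewrite geq_max => /andP[Ni Mi].
by change (a i + c i = 0); rewrite aN// cM// addr0.
Qed.

Lemma dual_comb_add N M a c : supp_lt N a -> supp_lt M c ->
  dual_comb N a + dual_comb M c = dual_comb (maxn N M) (a + c).
Proof.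
move=> aN cM; rewrite dual_combD.
by rewrite (dual_comb_widen aN (leq_maxl _ _)) (dual_comb_widen cM (leq_maxr _ _)).
Qed.

Lemma dot_le_dual n x z : supp_lt n x -> supp_lt n z ->
  (forall i, 0 <= x i) -> (forall i, 0 <= z i) ->
  dot_le ystar (dual_comb n x) (dual_comb n z) -> dual_le n x z.
Proof.
move=> xn zn x0 z0 xz w wn Bw Bzw; have [w0 [M wM] _] := Bw.
have zw0 i : 0 <= (z + w) i by exact: addr_ge0.
have xw0 i : 0 <= (x + w) i by exact: addr_ge0.
have zwS := supp_ltD zn wM; have xwS := supp_ltD xn wM.
apply/(fin_ball_comb_ge0 xwS xw0); rewrite -dual_comb_add//; apply: xz.
- exact/(fin_ball_comb_ge0 wM w0).
- move=> i j ij /(supp_comb _ wM) wj.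
  have nj : (n <= j)%N by rewrite leqNgt; apply: contra wj => jn; rewrite wn.
  apply: leq_trans nj; rewrite ltnNge; apply/negP => ni.
  by case: ij => [/(supp_comb _ xn)|/(supp_comb _ zn)]; rewrite ?xn ?zn ?eqxx.
- by rewrite dual_comb_add//; exact/(fin_ball_comb_ge0 zwS zw0).
Qed.

(** Tails in [dot_le] begin after the supports, those in [dual_le n.+1] after [n]. Since [a > 0],
    the coordinate [n] is in a support and the two conditions meet. A tail may have signs, but only
    its absolute values count. *)
Lemma dual_le_dot n x z (a : R) : supp_lt n x -> supp_lt n z ->
  (forall i, 0 <= x i) -> (forall i, 0 <= z i) -> 0 < a ->
  dual_le n.+1 z (put x n a) ->
  dot_le ystar (dual_comb n z) (dual_comb n.+1 (put x n a)).
Proof.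
move=> xn zn x0 z0 a0 zx W Wb supps.
have [M [w [wM WE]]] := fin_ball_exists Wb.
have pn : supp_lt n.+1 (put x n a).
  by move=> i ni; rewrite put_other ?xn//; [exact: ltnW|rewrite neq_ltn ni orbT].
have wn i : (i < n.+1)%N -> w i = 0.
  move=> ni; apply/eqP; apply: contraLR ni => wi; rewrite -leqNgt.
  apply: (supps n i); last by rewrite WE; exact/(supp_comb _ wM).
  by right; apply/(supp_comb _ pn); rewrite put_same gt_eqF.
have absD u : supp_lt n.+1 u -> (forall i, 0 <= u i) ->
    (fun i => `|(u + w) i|) = u + (fun i => `|w i|).
  move=> un u0; apply/funext => i; change (`|u i + w i| = u i + `|w i|).
  have [ni|ni] := ltnP i n.+1; first by rewrite wn// normr0 !addr0 ger0_norm.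
  by rewrite un// !add0r.
have zn1 : supp_lt n.+1 z by move=> i ni; apply: zn; exact: ltnW.
have p0 i : 0 <= put x n a i by rewrite /put; case: ifP => // _; exact: ltW.
rewrite WE !dual_comb_add// => /(fin_ball_comb (supp_ltD pn wM)).
rewrite absD// => Bpw; apply/(fin_ball_comb (supp_ltD zn wM)); rewrite absD//.
apply: zx => //; first by move=> i ni; rewrite wn// normr0.
by apply/(fin_ball_comb wM); rewrite -WE.
Qed.

(** * The dual ball as an ordered ball *)

Hypothesis y_alpha : property_alpha ystar.
Hypothesis y_beta : property_beta ystar.

Lemma dual_ball_solid x z : dual_ball z -> (forall i, 0 <= x i <= z i) ->
  dual_ball x.
Proof.
move=> [z0 [N zN] zc] xz; split.
- by move=> i; case/andP: (xz i).
- exists N => i Ni; apply/eqP; rewrite eq_le -{1}(zN i Ni).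
  by have /andP[-> ->] := xz i.
- move=> M c; apply: le_trans (zc M c); apply: ler_sum => i _.
  by rewrite ler_wpM2r//; case/andP: (xz i).
Qed.

Lemma dual_ball_bound x : dual_ball x -> forall n, x n <= 1.
Proof.
move=> [x0 _ xc] n; have := xc n.+1 (fun i => (i == n)%:R).
rewrite big_ord_recr/= eqxx normr1 mulr1 => h.
apply: le_trans (le_trans h _).
  by rewrite lerDr sumr_ge0// => i _; rewrite mulr_ge0.
rewrite /comb big_ord_recr/= eqxx scale1r big1 ?add0r ?y_normalized// => i _.
by rewrite ltn_eqF ?ltn_ord// scale0r.
Qed.

Lemma dual_ball_unit n : dual_ball (put (fun=> 0) n 1).
Proof.
split.
- by move=> i; rewrite /put; case: ifP.
- by exists n.+1 => i ni; rewrite put_other// neq_ltn ni orbT.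
- move=> N c; have [nN|Nn] := ltnP n N; last first.
    rewrite big1// => i _; rewrite put_other ?mul0r// neq_ltn.
    by rewrite (leq_trans (ltn_ord i) Nn).
  have sE (T : lmodType R) (F : nat -> T) :
      \sum_(i < N) (put (fun=> 0) n 1 i * c i) *: F i = c n *: F n.
    rewrite (bigD1 (Ordinal nN))//= put_same mul1r big1 ?addr0// => i ni.
    by rewrite put_other ?mul0r ?scale0r//; apply: contra ni => /eqP e; apply/eqP/val_inj.
  apply: (@le_trans _ _ `|comb N (fun i => put (fun=> 0) n 1 i * c i)|).
    rewrite /comb sE normrZ y_normalized mulr1.
    rewrite (bigD1 (Ordinal nN))//= put_same mul1r big1 ?addr0// => i ni.
    by rewrite put_other ?mul0r//; apply: contra ni => /eqP e; apply/eqP/val_inj.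
  apply: comb_le => i _; rewrite normrM ler_piMl// /put.
  by case: ifP; rewrite ?normr1 ?normr0.
Qed.

Lemma dual_ordered_ball : ordered_ball dual_ball dual_le 1.
Proof.
split.
- by move=> x [].
- exact: dual_ball_solid.
- exact: dual_ball_unit.
- exact: dual_ball_bound.
- by move=> n x w.
- by move=> n x z u xz zu w wn Bw Buw; apply: xz => //; exact: zu.
- move=> n x z Bx Bz xn zn; have [x0 _ _] := Bx; have [z0 _ _] := Bz.
  have [] := y_alpha ((fin_ball_comb_ge0 xn x0).2 Bx) ((fin_ball_comb_ge0 zn z0).2 Bz).
    by left; exact: dot_le_dual.
  by right; exact: dot_le_dual.
- move=> n x z xz w wn; apply: xz => i ni; apply: wn; exact: ltnW.
- move=> n x z xz w _ [w0 _ _] Bzw; apply: dual_ball_solid Bzw _ => i.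
  have /andP[x0 xzi] := xz i; change (0 <= x i + w i <= z i + w i).
  by rewrite addr_ge0//= lerD2r.
- move=> n x z a b Bx Bz xn zn a0 b0 zxa Bxab.
  have [x0 _ _] := Bx; have [z0 _ _] := Bz.
  (* Property (beta) speaks of coefficients in [0, 1]. *)
  have ab1 : a + b <= 1 by have := dual_ball_bound Bxab n; rewrite put_same.
  have put0 (u : nat -> R) (t : R) : (forall i, 0 <= u i) -> 0 <= t -> forall i, 0 <= put u n t i.
    by move=> u0 t0 i; rewrite /put; case: ifP.
  have putn (u : nat -> R) (t : R) : supp_lt n u -> supp_lt n.+1 (put u n t).
    by move=> un i ni; rewrite put_other ?un//; [exact: ltnW|rewrite neq_ltn ni orbT].
  have Bxa : dual_ball (put x n a).
    apply: dual_ball_solid Bxab _ => i; apply/andP; split.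
      exact: put0 x0 (ltW a0) i.
    by rewrite /put; case: ifP => _; [lra|exact: lexx].
  have ea := dual_comb_put a xn; have eab := dual_comb_put (a + b) xn.
  have eb := dual_comb_put b zn; have ab0 : 0 <= a + b by lra.
  have [||||||||Bzb zb] := @y_beta (dual_comb n x) (dual_comb n z) n a b.
  + exact/(fin_ball_comb_ge0 xn x0).
  + exact/(fin_ball_comb_ge0 zn z0).
  + move=> i; rewrite ltnNge => ii; apply/negP => ni.
    by case: ii => [/(supp_comb _ xn)|/(supp_comb _ zn)]; rewrite ?xn ?zn ?eqxx.
  + lra.
  + lra.
  + by rewrite -ea; apply: (fin_ball_comb_ge0 (putn x a xn) (put0 x a x0 (ltW a0))).2.
  + by rewrite -ea; apply: dual_le_dot.
  + by rewrite -eab; apply: (fin_ball_comb_ge0 (putn x (a + b) xn) (put0 x (a + b) x0 ab0)).2.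
  split.
    by apply: (fin_ball_comb_ge0 (putn z b zn) (put0 z b z0 b0)).1; rewrite eb.
  apply: dot_le_dual; [exact: putn|exact: putn|exact: put0|exact: put0|].
  by rewrite eb eab.
Qed.

Theorem basis_embedding (f : nat -> rat) : bijective f ->
  contains_copy (sierpinski_space R f) Y.
Proof.
move=> f_bij.
apply: (embedding f_bij dual_ordered_ball (c := fun i v => ystar i v) (C1 := 1) (C2 := 1)) => //.
- by move=> n l u v; exact: dual_linear.
- move=> a N v [_ _ /(_ N (coord v)) h]; rewrite mul1r.
  exact: le_trans h (comb_coord_le N v).
- move=> v M vM; rewrite mul1r; have [h h1 hv] := hahn_banach_norm v.
  apply/ler_addgt0Pr => e e0; have [N /(_ N (leqnn N)) vN] := coord_cvg v e0.
  (* The absolute values of the coefficients of a norming functional, cut at [N], belong to the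
     ball. *)
  pose a i := if (i < N)%N then `|h (y i)| else 0.
  have Ba : dual_ball a.
    split.
    + by move=> i; rewrite /a; case: ifP.
    + by exists N => i Ni; rewrite /a ltnNge Ni.
    + move=> L c; pose d i := if (i < N)%N then Num.sg (h (y i)) * `|c i| else 0.
      have dc i : (i < L)%N -> `|d i| <= `|c i|.
        rewrite /d; case: ifP => _ _; last by rewrite normr0.
        by rewrite normrM normr_id normr_sg ler_piMl// lern1 leq_b1.
      apply: le_trans (comb_le dc).
      have -> : \sum_(i < L) a i * `|c i| = h (comb L d).
        rewrite dual_sum; apply: eq_bigr => i _; rewrite dualZ /a /d.
        case: ifP => _; last by rewrite !mul0r.
        by rewrite mulrAC -normrEsg.
      apply: le_trans (ler_norm _) (le_trans (dual_norm_bound _ _) _).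
      by rewrite ler_piMl.
  have hN : h (comb N (coord v)) <= M.
    apply: le_trans (vM a N Ba); rewrite dual_sum; apply: ler_sum => i _.
    rewrite dualZ mulrC; apply: le_trans (ler_norm _) _.
    by rewrite normrM /a ltn_ord.
  have : h (v - comb N (coord v)) <= e.
    apply: le_trans (ler_norm _) (le_trans (dual_norm_bound _ _) _).
    by apply: le_trans vN; rewrite ler_piMl.
  by rewrite dualD dualN hv; lra.
- move=> v e e0; have [N0 /(_ N0 (leqnn N0)) vN] := coord_cvg v e0.
  (* From [N0] on the pairing only sees the remainder [u] of the expansion, whose norm is at most
     [e]. *)
  exists N0 => a N [a0 _ ac]; set u := v - comb N0 (coord v) in vN.
  apply: le_trans vN; apply: le_trans (comb_coord_le N u).
  apply: le_trans (ac N (coord u)); rewrite big_mkcond/=; apply: ler_sum => i _.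
  case: ifP => [Ni|_]; last by rewrite mulr_ge0.
  by rewrite /coord /u dualD dualN ystar_comb ltnNge Ni subr0.
Qed.

End UnconditionalBasis.

Theorem theorem7p4 (R : realType) (f : nat -> rat) (f_bij : bijective f) :
  [/\ forall (Y : completeNormedModType R) (y : nat -> Y)
        (ystar : nat -> dual Y),
        schauder_basis y -> normalized y -> one_unconditional y ->
        biorthogonal y ystar ->
        property_alpha ystar -> property_beta ystar ->
        contains_copy (sierpinski_space R f) Y,
      forall (Phi : nat -> R -> \bar R)
        (PhiO : forall i, orlicz_function (Phi i)),
        reflexive_space (musielak_orlicz_space PhiO) ->
        contains_copy (sierpinski_space R f) (musielak_orlicz_space PhiO),
      forall (p : R) (p1 : 1 <= p),
        contains_copy (sierpinski_space R f) (ellp_space p1) &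
      contains_copy (sierpinski_space R f) (c0_space R)].
Proof.
split.
- move=> Y y ystar y_basis y_normalized y_unc y_bi y_alpha y_beta.
  exact: (basis_embedding y_basis y_normalized y_unc y_bi y_alpha y_beta f_bij).
- by move=> Phi PhiO; exact: musielak_orlicz_embedding.
- by move=> p p1; exact: ellp_embedding.
- exact: c0_embedding.
Qed.
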